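(* Let $\lambda,\mu,\omega,l\in\mathbb C$, $\lambda+\mu^2=\frac1{4\omega^2}$, $\omega\neq0$, $\mu\neq0$, $n=l+1$, $l\notin2\mathbb Z+1$. The monodromy operator of the equation $$z^2E''+(nz+\mu(1-z^2))E'+(\lambda-\mu nz)E=0$$ has eigenvalue $-e^{-\pi il}$ if and only if $$R_{1,11}\pm2\omega\mu(R_{1,11}-R_{1,21})=0$$ with some choice of sign.
   Context: The monodromy operator of the equation acts on germs of its solutions at a nonzero point by analytic continuation along a counterclockwise circuit around zero. The matrices are $$M_k=\begin{pmatrix}1+\frac{\lambda}{(k-\frac12)^2-\frac{l^2}4} & \frac{\mu^2}{(k-\frac12)^2-\frac{l^2}4}\\ 1&0\end{pmatrix},\qquad R_k=M_kM_{k+1}\cdots$$ (the infinite products converge), and $R_{1,ij}$ denote the matrix elements of $R_1$. *)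

(* Defs.v *)
From Stdlib Require Import Reals ZArith.
From Coquelicot Require Import Coquelicot.

Open Scope C_scope.

Definition Cexp (z : C) : C :=
  RtoC (exp (Re z)) * (cos (Im z), sin (Im z)).

(* A germ at z0 is represented by a total function C -> C, only its values near
   z0 being relevant; germ_eq is equality of the germs so represented. *)
Definition germ_eq (z0 : C) (f g : C -> C) : Prop :=
  locally z0 (fun z => f z = g z).

Definition analytic_at (f : C -> C) (z0 : C) : Prop :=
  exists a : nat -> C,
    locally z0 (fun z =>
      is_pseries (K := C_AbsRing) (V := C_NormedModule) a (z - z0) (f z)).

(* The germ of f at (gamma 0) is continued along the path gamma on [0,1] by
   analytic germs F t at (gamma t) to the germ of g at (gamma 1). *)
Definition analytic_continuation (gamma : R -> C) (f g : C -> C) : Prop :=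
  exists F : R -> C -> C,
    (forall t : R, (0 <= t <= 1)%R -> analytic_at (F t) (gamma t)) /\
    (forall t : R, (0 <= t <= 1)%R ->
       locally t (fun s => (0 <= s <= 1)%R -> germ_eq (gamma s) (F s) (F t))) /\
    germ_eq (gamma 0%R) (F 0%R) f /\
    germ_eq (gamma 1%R) (F 1%R) g.

Definition circuit (z0 : C) (t : R) : C :=
  z0 * (cos (2 * PI * t), sin (2 * PI * t)).

(* C_derive is a total operator with a default value; analyticity makes both
   derivatives genuine. *)
Definition solution_germ (lambda mu n : C) (E : C -> C) (z0 : C) : Prop :=
  analytic_at E z0 /\
  locally z0 (fun z =>
    z ^ 2 * C_derive (C_derive E) z
    + (n * z + mu * (1 - z ^ 2)) * C_derive E z
    + (lambda - mu * n * z) * E z = 0).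

(* The graph of the monodromy operator on germs at z0: analytic continuation
   along a path is unique when it exists, so g is determined, as a germ, by f. *)
Definition monodromy (z0 : C) (f g : C -> C) : Prop :=
  analytic_continuation (circuit z0) f g.

Definition monodromy_eigenvalue (lambda mu n z0 chi : C) : Prop :=
  exists E : C -> C,
    solution_germ lambda mu n E z0 /\
    ~ germ_eq z0 E (fun _ => 0) /\
    monodromy z0 E (fun z => chi * E z).

(* In mk_matrix and coeff_mat, rows and columns are numbered from 0. *)
Definition M (lambda mu l : C) (k : nat) : @matrix C 2 2 :=
  let d := (RtoC (INR k) - 1 / 2) ^ 2 - l ^ 2 / 4 in
  mk_matrix 2 2 (fun i j =>
    match i, j with
    | 0%nat, 0%nat => 1 + lambda / d
    | 0%nat, _     => mu ^ 2 / d
    | _,     0%nat => 1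
    | _,     _     => 0
    end).

(* M_k M_(k+1) ... M_(k+N-1) *)
Fixpoint Mprod (lambda mu l : C) (k N : nat) : @matrix C 2 2 :=
  match N with
  | O => Mone (T := C_Ring)
  | S N' => Mmult (T := C_Ring) (Mprod lambda mu l k N') (M lambda mu l (k + N'))
  end.

(* The infinite product M_k M_(k+1) ..., as an entrywise limit. *)
Definition Rmat (lambda mu l : C) (k : nat) : @matrix C 2 2 :=
  mk_matrix 2 2 (fun i j =>
    lim (T := C_CompleteNormedModule)
      (filtermap (fun N => coeff_mat (0 : C) (Mprod lambda mu l k N) i j)
         eventually)).

(* 1-based matrix element R_(k,ij). *)
Definition Rcoef (lambda mu l : C) (k i j : nat) : C :=
  coeff_mat (0 : C) (Rmat lambda mu l k) (pred i) (pred j).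

(* Main.v *)
Require Import Defs.
From Stdlib Require Import Reals ZArith Lra Lia Psatz.
From Coquelicot Require Import Coquelicot.

Open Scope C_scope.

(** Put [b = (1 - l) / 2], so that [- exp (- pi i l) = exp (2 pi i b)].  An eigenfunction with this
    eigenvalue is [z^b] times a single-valued function; its Fourier coefficients on the circle
    through [z0] satisfy a three-term recurrence, and conversely every two-sided solution of the
    recurrence decaying in both directions sums to an eigenfunction.  The solution decaying at
    [+oo] has coefficients built from [x_k = R_(k,11)], because
    [x_k = (1 + lambda / d_k) x_(k+1) + (mu^2 / d_k) x_(k+2)].  The symmetry
    [E(z) |-> z^(-l-1) (E'(1/z) - mu E(1/z))] of the equation turns it into the solution decaying
    at [-oo], built from [x_(k+1) - x_k].  The eigenvalue occurs if and only if the two are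
    proportional, and the determinant expressing this is a nonzero multiple of
    [x_1^2 - 4 omega^2 mu^2 (x_1 - x_2)^2], with [x_2 = R_(1,21)]. *)

(** * Complex power series *)

(** The half-integers come from (k + b) (k + b + l) = (k + 1/2)^2 - l^2/4 = d_(k+1): with this b the
    diagonal coefficient of the recurrence is d_(k+1) + lambda, and division by d_(k+1) gives the
    entry 1 + lambda / d_(k+1). Some d_k vanishes exactly when l is an odd integer. The identity
    d_(1-k) = d_k is the trace of the symmetry z |-> 1/z on the indices. An eigenfunction is given
    only as a family of germs along the circuit. It is replaced by the pair (E, E') on the circle,
    which solves a linear first-order system, so that continuation becomes an initial value problem.
    The Fourier coefficients are then merely known to be bounded, and this suffices: the Casoratian
    of a bounded solution with the decaying one would fall off faster than every geometric sequence,
    which a nonzero Casoratian cannot do. The relation lambda + mu^2 = 1 / (4 omega^2) enters twice.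
    It makes the determinant (lambda + mu^2) x_1^2 - mu^2 (x_1 - x_2)^2 a difference of squares,
    whose two factors are the two signs, and it gives lambda + mu^2 <> 0, without which the solution
    built from x_(k+1) - x_k could vanish identically. *)

Lemma sqrt2_lt_2 : (sqrt 2 < 2)%R.
Proof. rewrite <- (sqrt_square 2) at 2 by lra. apply sqrt_lt_1_alt. lra. Qed.

Lemma Cmult_eq_0_reg (x y : C) : x <> 0 -> x * y = 0 -> y = 0.
Proof. intros Hx E. transitivity (/ x * (x * y)); [now field|]. rewrite E. ring. Qed.

Lemma Rlt_Rmin_l (x y z : R) : (x < Rmin y z)%R -> (x < y)%R.
Proof. intros H. exact (Rlt_le_trans _ _ _ H (Rmin_l _ _)). Qed.

Lemma Rlt_Rmin_r (x y z : R) : (x < Rmin y z)%R -> (x < z)%R.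
Proof. intros H. exact (Rlt_le_trans _ _ _ H (Rmin_r _ _)). Qed.

Lemma Cmod_diag (z : C) : Cmod (z - z) = 0%R.
Proof. replace (z - z) with (RtoC 0) by ring. apply Cmod_0. Qed.

(** A [ball] in [C] is a square, contained only in a disc whose radius is sqrt 2 times as large;
    halving the radius absorbs this factor. *)
Lemma locally_Cmod (z : C) (P : C -> Prop) :
  locally z P <->
  exists d : R, (0 < d)%R /\ forall w : C, (Cmod (w - z) < d)%R -> P w.
Proof.
  split.
  - intros [e He]. exists e. split; [apply cond_pos|].
    intros w Hw. apply He. now apply C_NormedModule_mixin_compat1.
  - intros [d [Hd H]].
    assert (Hd2 : (0 < d / 2)%R) by lra.
    exists (mkposreal _ Hd2). intros w Hw. apply H.
    apply (C_NormedModule_mixin_compat2 z w) in Hw. simpl in Hw.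
    apply Rlt_le_trans with (1 := Hw).
    generalize sqrt2_lt_2. nra.
Qed.

Lemma Cmod_le_Re_Im (z : C) : (Cmod z <= Rabs (Re z) + Rabs (Im z))%R.
Proof.
  apply Rsqr_incr_0_var; [| generalize (Rabs_pos (Re z)) (Rabs_pos (Im z)); lra].
  unfold Rsqr. replace (Cmod z * Cmod z)%R with (Cmod z ^ 2)%R by ring.
  rewrite Cmod2_alt, <- (pow2_abs (Re z)), <- (pow2_abs (Im z)).
  generalize (Rabs_pos (Re z)) (Rabs_pos (Im z)); nra.
Qed.

Lemma Im_le_Cmod (z : C) : (Rabs (Im z) <= Cmod z)%R.
Proof.
  eapply Rle_trans; [|apply (Rmax_Cmod z)]. apply Rmax_r.
Qed.

Lemma C_eq (z w : C) : Re z = Re w -> Im z = Im w -> z = w.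
Proof. destruct z, w; simpl; intros; congruence. Qed.

Lemma Cmod_minus_sym (x y : C) : Cmod (x - y) = Cmod (y - x).
Proof. rewrite <- Cmod_opp. f_equal. ring. Qed.

Lemma Cmod_triangle_rev (x y : C) : (Cmod x - Cmod y <= Cmod (x - y))%R.
Proof.
  generalize (Cmod_triangle (x - y) y). replace (x - y + y) with x by ring. lra.
Qed.

Local Notation Cseries := (is_series (K := C_AbsRing) (V := C_NormedModule)).

Lemma is_series_C (a : nat -> C) (l : C) :
  Cseries a l <->
  is_series (fun n => Re (a n)) (Re l) /\ is_series (fun n => Im (a n)) (Im l).
Proof.
  assert (HR : forall n, Re (sum_n (G := C_AbelianMonoid) a n) = sum_n (fun n => Re (a n)) n).
  { intros n. induction n as [|n IH]; [now rewrite !sum_O|]. now rewrite !sum_Sn, <- IH. }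
  assert (HI : forall n, Im (sum_n (G := C_AbelianMonoid) a n) = sum_n (fun n => Im (a n)) n).
  { intros n. induction n as [|n IH]; [now rewrite !sum_O|]. now rewrite !sum_Sn, <- IH. }
  unfold is_series. split.
  - intros H. split; apply filterlim_locally; intros eps;
    destruct (proj1 (filterlim_locally (U := C_UniformSpace) _ _) H eps) as [N HN];
    exists N; intros n Hn; destruct (HN n Hn) as [H1 H2].
    + rewrite <- HR. exact H1.
    + rewrite <- HI. exact H2.
  - intros [H1 H2]. apply (filterlim_locally (U := C_UniformSpace)). intros eps.
    destruct (proj1 (filterlim_locally (U := R_UniformSpace) _ _) H1 eps) as [N1 K1].
    destruct (proj1 (filterlim_locally (U := R_UniformSpace) _ _) H2 eps) as [N2 K2].
    clear H1 H2. rename K1 into H1, K2 into H2. exists (max N1 N2). intros n Hn.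
    split.
    + specialize (H1 n ltac:(lia)). rewrite <- HR in H1. exact H1.
    + specialize (H2 n ltac:(lia)). rewrite <- HI in H2. exact H2.
Qed.

Definition is_cps (a : nat -> C) (h l : C) : Prop :=
  is_pseries (K := C_AbsRing) (V := C_NormedModule) a h l.

(** [Series] returns a value even without convergence, so [CPS] has a meaning only together with
    [is_cps]. *)
Definition CPS (a : nat -> C) (h : C) : C :=
  (Series (fun n => Re (h ^ n * a n)), Series (fun n => Im (h ^ n * a n))).

(** For r > 0 this forces a radius of convergence of at least / r. Leaving the constant unspecified
    makes the bound stable under the operations on coefficients, differentiation costing a slightly
    larger r. *)
Definition geom (a : nat -> C) (r : R) : Prop :=
  exists K : R, forall n : nat, (Cmod (a n) <= K * r ^ n)%R.

Lemma pow_n_Cpow (h : C) (n : nat) : pow_n (K := C_Ring) h n = h ^ n.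
Proof. induction n as [|n IH]; [reflexivity|]. simpl. now rewrite IH. Qed.

Lemma is_cps_series (a : nat -> C) (h l : C) :
  is_cps a h l <-> Cseries (fun n => h ^ n * a n) l.
Proof.
  unfold is_cps, is_pseries. split; apply is_series_ext; intros n.
  - rewrite <- (pow_n_Cpow h n). reflexivity.
  - rewrite <- (pow_n_Cpow h n). reflexivity.
Qed.

Lemma is_cps_unique (a : nat -> C) (h l : C) : is_cps a h l -> CPS a h = l.
Proof.
  intros H. apply is_cps_series, is_series_C in H. destruct H as [H1 H2].
  apply C_eq; simpl; now apply is_series_unique.
Qed.

Lemma geom_K_nonneg (a : nat -> C) (r K : R) :
  (forall n : nat, (Cmod (a n) <= K * r ^ n)%R) -> (0 <= K)%R.
Proof. intros H. specialize (H 0%nat). generalize (Cmod_ge_0 (a 0%nat)). simpl in H. lra. Qed.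

Lemma is_series_C_geom (b : nat -> C) (K q : R) :
  (0 <= q < 1)%R -> (forall n, (Cmod (b n) <= K * q ^ n)%R) ->
  exists l, Cseries b l.
Proof.
  intros Hq H.
  assert (E : ex_series (fun n => K * q ^ n)%R).
  { apply (ex_series_scal_l (K := R_AbsRing) (V := R_NormedModule) K (fun n => q ^ n)%R). apply ex_series_geom.
    rewrite Rabs_pos_eq; lra. }
  assert (E1 : ex_series (fun n => Re (b n))).
  { apply (ex_series_le (K := R_AbsRing) (V := R_CompleteNormedModule)) with (2 := E).
    intros n. eapply Rle_trans; [apply re_le_Cmod|]. apply H. }
  assert (E2 : ex_series (fun n => Im (b n))).
  { apply (ex_series_le (K := R_AbsRing) (V := R_CompleteNormedModule)) with (2 := E).
    intros n. eapply Rle_trans; [apply Im_le_Cmod|]. apply H. }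
  destruct E1 as [l1 E1], E2 as [l2 E2]. exists (l1, l2). now apply is_series_C.
Qed.

Lemma is_series_C_Cmod_le (b : nat -> C) (K q : R) (l : C) :
  (0 <= q < 1)%R -> (forall n, (Cmod (b n) <= K * q ^ n)%R) ->
  Cseries b l ->
  (Cmod l <= K / (1 - q))%R.
Proof.
  intros Hq H Hl.
  assert (HK : (0 <= K)%R) by (now apply (geom_K_nonneg b q)).
  assert (HS : forall n, (Cmod (sum_n (G := C_AbelianMonoid) b n) <= K / (1 - q) * (1 - q ^ S n))%R).
  { intros n. induction n as [|n IH].
    - rewrite sum_O. eapply Rle_trans; [apply H|]. simpl. right. field. lra.
    - rewrite sum_Sn. eapply Rle_trans; [apply Cmod_triangle|].
      eapply Rle_trans; [apply Rplus_le_compat; [apply IH|apply H]|].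
      right. simpl. field. lra. }
  apply le_epsilon. intros eps Heps.
  assert (He2 : (0 < eps / 2)%R) by lra.
  destruct (proj1 (filterlim_locally (U := C_UniformSpace) _ _) Hl (mkposreal _ He2)) as [N HN]. specialize (HN N (le_n N)).
  apply (C_NormedModule_mixin_compat2 l _) in HN. simpl in HN.
  change (minus (sum_n b N) l) with (sum_n (G := C_AbelianMonoid) b N - l) in HN.
  rewrite Cmod_minus_sym in HN.
  generalize (Cmod_triangle_rev l (sum_n (G := C_AbelianMonoid) b N)). intros HT.
  pose proof sqrt2_lt_2.
  specialize (HS N).
  assert (0 <= K / (1 - q))%R by (apply Rdiv_le_0_compat; lra).
  assert (0 <= q ^ S N)%R by (apply pow_le; lra).
  nra.
Qed.

Lemma CPS_correct (a : nat -> C) (r : R) (h : C) :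
  (0 <= r)%R -> geom a r -> (r * Cmod h < 1)%R -> is_cps a h (CPS a h).
Proof.
  intros Hr [K HK] Hh.
  destruct (is_series_C_geom (fun n => h ^ n * a n) K (r * Cmod h)) as [l Hl].
  - split; [|lra]. apply Rmult_le_pos; [lra|apply Cmod_ge_0].
  - intros n. rewrite Cmod_mult, Cmod_pow, Rpow_mult_distr.
    specialize (HK n). generalize (pow_le (Cmod h) n (Cmod_ge_0 h)). nra.
  - apply is_cps_series in Hl. now rewrite (is_cps_unique _ _ _ Hl).
Qed.

(** Abel's lemma: convergence at one point bounds the terms there, hence the coefficients. This
    recovers [geom] from [analytic_at], which only asserts convergence. *)
Lemma is_cps_geom (a : nat -> C) (h l : C) :
  h <> 0 -> is_cps a h l -> geom a (/ Cmod h).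
Proof.
  intros Hh H. apply is_cps_series, is_series_C in H. destruct H as [H1 H2].
  assert (B : forall u : nat -> R, (exists l, is_series u l) -> exists K, forall n, (Rabs (u n) <= K)%R).
  { intros u Hu. apply ex_series_lim_0 in Hu.
    destruct (filterlim_bounded u) as [K HK]; [now exists 0%R|].
    exists K. exact HK. }
  destruct (B _ (ex_intro _ _ H1)) as [K1 HK1]. destruct (B _ (ex_intro _ _ H2)) as [K2 HK2].
  exists (K1 + K2)%R. intros n.
  assert (0 < Cmod h)%R by (now apply Cmod_gt_0).
  assert (E : (Cmod (a n) * Cmod h ^ n <= K1 + K2)%R).
  { rewrite <- Cmod_pow, <- Cmod_mult, Cmult_comm.
    eapply Rle_trans; [apply Cmod_le_Re_Im|]. apply Rplus_le_compat; auto. }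
  rewrite pow_inv. apply (Rmult_le_reg_r (Cmod h ^ n)).
  - now apply pow_lt.
  - rewrite Rmult_assoc, Rinv_l; [lra|]. apply pow_nonzero. lra.
Qed.

Lemma geom_le (a : nat -> C) (r s : R) : (0 <= r <= s)%R -> geom a r -> geom a s.
Proof.
  intros Hrs [K HK]. exists K. intros n.
  generalize (geom_K_nonneg _ _ _ HK) (pow_incr r s n Hrs) (HK n). nra.
Qed.

Lemma geom_plus (a b : nat -> C) (r : R) :
  geom a r -> geom b r -> geom (fun n => a n + b n) r.
Proof.
  intros [K HK] [L HL]. exists (K + L)%R. intros n.
  eapply Rle_trans; [apply Cmod_triangle|]. specialize (HK n). specialize (HL n). lra.
Qed.

Lemma geom_scal (c : C) (a : nat -> C) (r : R) : geom a r -> geom (fun n => c * a n) r.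
Proof.
  intros [K HK]. exists (Cmod c * K)%R. intros n. rewrite Cmod_mult, Rmult_assoc.
  apply Rmult_le_compat_l; [apply Cmod_ge_0|apply HK].
Qed.

Lemma geom_shift (a : nat -> C) (r : R) : geom a r -> geom (fun n => a (S n)) r.
Proof.
  intros [K HK]. exists (K * r)%R. intros n. specialize (HK (S n)). simpl in HK. lra.
Qed.

(** Lets a factor n be absorbed into a geometric bound by any enlargement s > 1 of the ratio. *)
Lemma INR_le_pow (s : R) (n : nat) : (1 < s)%R -> (INR n <= s ^ n / (s - 1))%R.
Proof.
  intros Hs. apply (Rmult_le_reg_r (s - 1)); [lra|].
  replace (s ^ n / (s - 1) * (s - 1))%R with (s ^ n)%R by (field; lra).
  induction n as [|n IH]; [simpl; lra|].
  rewrite S_INR. simpl.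
  assert (1 <= s ^ n)%R by (apply pow_R1_Rle; lra). nra.
Qed.

Lemma geom_INR (a : nat -> C) (r s : R) :
  (0 <= r)%R -> (1 < s)%R -> geom a r -> geom (fun n => INR n * a n) (s * r).
Proof.
  intros Hr Hs [K HK]. exists (K / (s - 1))%R. intros n.
  rewrite Cmod_mult, Cmod_R, Rabs_pos_eq by apply pos_INR.
  rewrite Rpow_mult_distr.
  replace (K / (s - 1) * (s ^ n * r ^ n))%R with ((s ^ n / (s - 1)) * (K * r ^ n))%R by (field; lra).
  apply Rmult_le_compat; [apply pos_INR|apply Cmod_ge_0|now apply INR_le_pow|apply HK].
Qed.

Definition dcoef (a : nat -> C) (n : nat) : C := INR (S n) * a (S n).

Lemma geom_dcoef (a : nat -> C) (r s : R) :
  (0 <= r)%R -> (1 < s)%R -> geom a r -> geom (dcoef a) (s * r).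
Proof.
  intros Hr Hs H. apply (geom_INR a r s Hr Hs) in H. now apply geom_shift in H.
Qed.

Lemma is_cps_plus (a b : nat -> C) (h x y : C) :
  is_cps a h x -> is_cps b h y -> is_cps (fun n => a n + b n) h (x + y).
Proof. apply (is_pseries_plus (K := C_AbsRing) (V := C_NormedModule)). Qed.

Lemma is_cps_scal (c : C) (a : nat -> C) (h x : C) :
  is_cps a h x -> is_cps (fun n => c * a n) h (c * x).
Proof.
  apply (is_pseries_scal (K := C_AbsRing) (V := C_NormedModule)). apply Cmult_comm.
Qed.

Definition shift_right (a : nat -> C) (n : nat) : C :=
  match n with O => 0 | S m => a m end.

Lemma is_cps_shift_right (a : nat -> C) (h x : C) : is_cps a h x -> is_cps (shift_right a) h (h * x).
Proof. apply (is_pseries_incr_1 (K := C_AbsRing) (V := C_NormedModule)). Qed.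

Lemma is_cps_ext (a b : nat -> C) (h x : C) : (forall n, a n = b n) -> is_cps a h x -> is_cps b h x.
Proof. apply (is_pseries_ext (K := C_AbsRing) (V := C_NormedModule)). Qed.

Lemma is_cps_0 (h : C) : is_cps (fun _ => 0) h 0.
Proof.
  apply is_cps_series. apply is_series_C. simpl.
  assert (is_series (fun _ : nat => 0%R) 0%R).
  { apply filterlim_ext with (fun _ => 0%R); [|apply filterlim_const].
    intros n. symmetry. induction n; [now rewrite sum_O|]. rewrite sum_Sn, IHn. apply Rplus_0_l. }
  split; (eapply is_series_ext; [|eassumption]); intros n; simpl; ring.
Qed.

Lemma is_cps_const (c h : C) : is_cps (fun n => match n with O => c | S _ => 0 end) h c.
Proof.
  apply is_cps_series.
  apply (is_series_decr_1 (K := C_AbsRing) (V := C_NormedModule)).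
  generalize (proj1 (is_cps_series _ _ _) (is_cps_0 h)). intros H.
  replace (plus c _) with (RtoC 0).
  - eapply is_series_ext; [|apply H]. intros n. simpl. ring.
  - simpl. change (RtoC 0 = c + - (1 * c)). ring.
Qed.

Lemma is_cps_shift (a : nat -> C) (h x : C) :
  h <> 0 -> is_cps a h x -> is_cps (fun n => a (S n)) h ((x - a 0%nat) / h).
Proof.
  intros Hh H.
  eapply (is_pseries_decr_1 (K := C_AbsRing) (V := C_NormedModule)) with (y := / h) in H.
  - unfold is_cps. replace ((x - a 0%nat) / h) with (scal (/ h : C_AbsRing) (plus x (opp (a 0%nat)) : C)).
    + exact H.
    + change (/ h * (x + - a 0%nat) = (x - a 0%nat) / h). field. exact Hh.
  - change (/ h * h = 1). now field.
Qed.

(** * Complex derivatives *)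

(** Written without a quotient, so that w = z needs no exception and the default values of
    [C_derive] stay out of the estimates. *)
Definition cderiv (f : C -> C) (z l : C) : Prop :=
  forall eps : R, (0 < eps)%R -> exists d : R, (0 < d)%R /\
    forall w : C, (Cmod (w - z) < d)%R ->
      (Cmod (f w - f z - (w - z) * l) <= eps * Cmod (w - z))%R.

(** Componentwise, so that the mean value theorem and the fundamental theorem of calculus for real
    functions apply directly. *)
Definition rderiv (f : R -> C) (t : R) (l : C) : Prop :=
  is_derive (fun s => Re (f s)) t (Re l) /\ is_derive (fun s => Im (f s)) t (Im l).

(** The second-order remainder of a power, multiplied by rho^2 so that no exponent n - 2 occurs. In
    the induction the remainder for n + 1 is y times the remainder for n plus n x^(n-1) (y -
    x)^2. *)
Lemma Cpow_taylor (x y : C) (rho : R) (n : nat) :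
  (Cmod x <= rho)%R -> (Cmod y <= rho)%R ->
  (rho ^ 2 * Cmod (y ^ n - x ^ n - (y - x) * (INR n * x ^ (pred n)))
    <= INR n ^ 2 * rho ^ n * Cmod (y - x) ^ 2)%R.
Proof.
  intros Hx Hy. assert (Hr : (0 <= rho)%R) by (generalize (Cmod_ge_0 x); lra).
  induction n as [|n IH].
  - simpl. replace (1 - 1 - (y - x) * (0 * 1)) with (RtoC 0) by ring. rewrite Cmod_0. lra.
  - replace (y ^ S n - x ^ S n - (y - x) * (INR (S n) * x ^ pred (S n)))
      with (y * (y ^ n - x ^ n - (y - x) * (INR n * x ^ (pred n)))
            + INR n * x ^ (pred n) * ((y - x) * (y - x))).
    2:{ rewrite S_INR, RtoC_plus. destruct n; [simpl; ring|].
        cbn [pred Cpow]. ring. }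
    set (T := Cmod (y ^ n - x ^ n - (y - x) * (INR n * x ^ (pred n)))) in *.
    assert (E : (rho ^ 2 * Cmod (INR n * x ^ pred n * ((y - x) * (y - x)))
        <= INR n * rho ^ S n * Cmod (y - x) ^ 2)%R).
    { rewrite !Cmod_mult, Cmod_pow, Cmod_R, Rabs_pos_eq by apply pos_INR.
      destruct n; [simpl; lra|]. cbn [pred].
      assert (Cmod x ^ n <= rho ^ n)%R by (apply pow_incr; split; [apply Cmod_ge_0|auto]).
      assert (0 <= rho ^ 2 * INR (S n) * Cmod (y - x) ^ 2)%R.
      { apply Rmult_le_pos; [|apply pow2_ge_0].
        apply Rmult_le_pos; [apply pow2_ge_0|apply pos_INR]. }
      replace (rho ^ 2 * (INR (S n) * Cmod x ^ n * (Cmod (y - x) * Cmod (y - x))))%R with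
        (rho ^ 2 * INR (S n) * Cmod (y - x) ^ 2 * Cmod x ^ n)%R by ring.
      replace (INR (S n) * rho ^ S (S n) * Cmod (y - x) ^ 2)%R with
        (rho ^ 2 * INR (S n) * Cmod (y - x) ^ 2 * rho ^ n)%R by (cbn [pow]; ring).
      now apply Rmult_le_compat_l. }
    assert (E2 : (rho ^ 2 * Cmod (y * (y ^ n - x ^ n - (y - x) * (INR n * x ^ (pred n))))
        <= INR n ^ 2 * rho ^ S n * Cmod (y - x) ^ 2)%R).
    { rewrite Cmod_mult. fold T. generalize (Cmod_ge_0 y). intros.
      assert (0 <= T)%R by apply Cmod_ge_0.
      apply Rle_trans with (rho * (rho ^ 2 * T))%R; [|simpl; simpl in IH; nra].
      assert (0 <= rho ^ 2 * T)%R by (apply Rmult_le_pos; [apply pow2_ge_0|auto]). nra. }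
    eapply Rle_trans.
    { apply Rmult_le_compat_l; [apply pow2_ge_0|apply Cmod_triangle]. }
    rewrite S_INR.
    assert (0 <= rho ^ S n * Cmod (y - x) ^ 2)%R.
    { apply Rmult_le_pos; [now apply pow_le|apply pow2_ge_0]. }
    generalize (pos_INR n). nra.
Qed.

Lemma is_cps_dcoef (a : nat -> C) (r : R) (x : C) :
  (0 < r)%R -> geom a r -> (r * Cmod x < 1)%R -> is_cps (dcoef a) x (CPS (dcoef a) x).
Proof.
  intros Hr Ha Hx. set (m := (r * Cmod x)%R) in *.
  assert (0 <= m)%R by (apply Rmult_le_pos; [lra|apply Cmod_ge_0]).
  (* 2 / (1 + m) exceeds 1, while its product with m is still below 1. *)
  assert (Hs : (1 < 2 / (1 + m))%R).
  { apply (Rmult_lt_reg_r (1 + m)); [lra|].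
    replace (2 / (1 + m) * (1 + m))%R with 2%R by (field; lra). lra. }
  apply (CPS_correct _ (2 / (1 + m) * r)).
  - nra.
  - apply geom_dcoef; auto; lra.
  - rewrite Rmult_assoc. fold m.
    apply (Rmult_lt_reg_r (1 + m)); [lra|].
    replace (2 / (1 + m) * m * (1 + m))%R with (2 * m)%R by (field; lra). lra.
Qed.

(** The termwise remainders n^2 rho^n |y - x|^2 |a_n| / rho^2 sum to O(|y - x|^2) once r * rho < 1:
    two factors s > 1 absorb n^2 and leave the ratio q = s^2 r rho below 1. *)
Lemma cderiv_CPS (a : nat -> C) (r : R) (x : C) :
  (0 < r)%R -> geom a r -> (r * Cmod x < 1)%R -> cderiv (CPS a) x (CPS (dcoef a) x).
Proof.
  intros Hr Ha Hx. pose proof Ha as [K HK].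
  pose proof (geom_K_nonneg _ _ _ HK) as HK0.
  set (rho := ((Cmod x + / r) / 2)%R).
  assert (Hir : (Cmod x < / r)%R).
  { apply (Rmult_lt_reg_l r); [auto|]. rewrite Rinv_r by lra. lra. }
  assert (Hxr : (Cmod x < rho)%R) by (unfold rho; lra).
  assert (Hrho : (0 < rho)%R) by (generalize (Cmod_ge_0 x); lra).
  set (m := (r * rho)%R).
  assert (Hm : (0 < m < 1)%R).
  { unfold m. split; [nra|]. unfold rho.
    apply (Rmult_lt_reg_l (/ r)); [now apply Rinv_0_lt_compat|].
    rewrite <- Rmult_assoc, Rinv_l by lra. lra. }
  (* Here s^2 m = 4 m / (1 + m)^2 < 1, because (1 - m)^2 > 0. *)
  set (s := (2 / (1 + m))%R).
  assert (Hs : (1 < s)%R).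
  { apply (Rmult_lt_reg_r (1 + m)); [lra|]. unfold s.
    replace (2 / (1 + m) * (1 + m))%R with 2%R by (field; lra). lra. }
  set (q := (s * s * m)%R).
  assert (Hq : (0 <= q < 1)%R).
  { split; [unfold q; apply Rmult_le_pos; [apply Rmult_le_pos|]; lra|].
    unfold q, s. apply (Rmult_lt_reg_r ((1 + m) * (1 + m))); [nra|].
    replace (2 / (1 + m) * (2 / (1 + m)) * m * ((1 + m) * (1 + m)))%R
      with (4 * m)%R by (field; lra). nra. }
  set (L := (K / ((s - 1) ^ 2 * rho ^ 2 * (1 - q)))%R).
  assert (HL0 : (0 < (s - 1) ^ 2 * rho ^ 2 * (1 - q))%R).
  { apply Rmult_lt_0_compat; [apply Rmult_lt_0_compat; apply pow_lt; lra|lra]. }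
  assert (HL : (0 <= L)%R) by (now apply Rdiv_le_0_compat).
  intros eps Heps.
  exists (Rmin (rho - Cmod x) (eps / (L + 1))).
  assert (He : (0 < eps / (L + 1))%R) by (apply Rdiv_lt_0_compat; lra).
  split; [apply Rmin_pos; lra|].
  intros y Hy.
  assert (Hy1 : (Cmod (y - x) < rho - Cmod x)%R) by (exact (Rlt_Rmin_l _ _ _ Hy)).
  assert (Hy2 : (Cmod (y - x) < eps / (L + 1))%R) by (exact (Rlt_Rmin_r _ _ _ Hy)).
  assert (Hyr : (Cmod y <= rho)%R) by (generalize (Cmod_triangle_rev y x); lra).
  assert (Sx := proj1 (is_cps_series _ _ _) (CPS_correct a r x ltac:(lra) Ha Hx)).
  assert (Sy := proj1 (is_cps_series _ _ _) (CPS_correct a r y ltac:(lra) Ha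
     ltac:(unfold m in Hm; generalize (Cmod_ge_0 y); nra))).
  assert (Sd := proj1 (is_cps_series _ _ _) (is_cps_dcoef a r x Hr Ha Hx)).
  assert (Sd' : Cseries
     (fun n => INR n * x ^ (pred n) * a n) (CPS (dcoef a) x)).
  { apply (is_series_decr_1 (K := C_AbsRing) (V := C_NormedModule)).
    replace (plus _ _) with (CPS (dcoef a) x).
    - eapply is_series_ext; [|exact Sd]. intros n. unfold dcoef. cbn [pred].
      change (x ^ n * (INR (S n) * a (S n)) = INR (S n) * x ^ n * a (S n)). ring.
    - simpl INR. simpl pred.
      change (CPS (dcoef a) x = CPS (dcoef a) x + - (0 * x ^ 0 * a 0%nat)). ring. }
  apply Rle_trans with (L * Cmod (y - x) ^ 2)%R.
  2:{ assert ((L + 1) * Cmod (y - x) <= eps)%R.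
      { apply Rle_trans with ((L + 1) * (eps / (L + 1)))%R; [apply Rmult_le_compat_l; lra|].
        right; field; lra. }
      generalize (Cmod_ge_0 (y - x)). nra. }
  replace (L * Cmod (y - x) ^ 2)%R with
     ((K / ((s - 1) ^ 2 * rho ^ 2) * Cmod (y - x) ^ 2) / (1 - q))%R.
  2:{ unfold L. field. repeat split; lra. }
  apply (is_series_C_Cmod_le (fun n => (y ^ n - x ^ n - (y - x) * (INR n * x ^ (pred n))) * a n)).
  - exact Hq.
  - intros n. rewrite Cmod_mult.
    apply (Rmult_le_reg_l (rho ^ 2)); [now apply pow_lt|].
    rewrite <- Rmult_assoc.
    apply Rle_trans with ((INR n ^ 2 * rho ^ n * Cmod (y - x) ^ 2) * (K * r ^ n))%R.
    { apply Rmult_le_compat.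
      - apply Rmult_le_pos; [apply pow2_ge_0|apply Cmod_ge_0].
      - apply Cmod_ge_0.
      - apply Cpow_taylor; lra.
      - apply HK. }
    unfold q, m. rewrite !Rpow_mult_distr.
    replace (rho ^ 2 * (K / ((s - 1) ^ 2 * rho ^ 2) * Cmod (y - x) ^ 2 * (s ^ n * s ^ n * (r ^ n * rho ^ n))))%R
      with ((s ^ n / (s - 1)) ^ 2 * (rho ^ n * Cmod (y - x) ^ 2 * (K * r ^ n)))%R.
    2:{ field. split; lra. }
    replace (INR n ^ 2 * rho ^ n * Cmod (y - x) ^ 2 * (K * r ^ n))%R with
      (INR n ^ 2 * (rho ^ n * Cmod (y - x) ^ 2 * (K * r ^ n)))%R by ring.
    apply Rmult_le_compat_r.
    + apply Rmult_le_pos; apply Rmult_le_pos; try apply pow2_ge_0; try lra; apply pow_le; lra.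
    + apply pow_incr. split; [apply pos_INR|now apply INR_le_pow].
  - generalize (is_series_plus (K := C_AbsRing) (V := C_NormedModule) _ _ _ _ Sy
      (is_series_plus (K := C_AbsRing) (V := C_NormedModule) _ _ _ _
        (is_series_scal (K := C_AbsRing) (V := C_NormedModule) (- (1)) _ _ Sx)
        (is_series_scal (K := C_AbsRing) (V := C_NormedModule) (- (y - x)) _ _ Sd'))).
    intros H.
    replace (CPS a y - CPS a x - (y - x) * CPS (dcoef a) x) with
      (CPS a y + (- (1) * CPS a x + - (y - x) * CPS (dcoef a) x)) by ring.
    eapply is_series_ext; [|exact H]. intros n.
    change (y ^ n * a n + (- (1) * (x ^ n * a n) + - (y - x) * (INR n * x ^ pred n * a n)) =
       (y ^ n - x ^ n - (y - x) * (INR n * x ^ pred n)) * a n). ring.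
Qed.

Lemma cderiv_ext_loc (f g : C -> C) (z l : C) :
  locally z (fun w => f w = g w) -> cderiv f z l -> cderiv g z l.
Proof.
  intros H Hf eps Heps. apply locally_Cmod in H. destruct H as [d1 [Hd1 H1]].
  destruct (Hf eps Heps) as [d2 [Hd2 H2]].
  exists (Rmin d1 d2). split; [now apply Rmin_pos|]. intros w Hw.
  rewrite <- (H1 w), <- (H1 z).
  - apply H2. exact (Rlt_Rmin_r _ _ _ Hw).
  - rewrite Cmod_diag. exact Hd1.
  - exact (Rlt_Rmin_l _ _ _ Hw).
Qed.

Lemma cderiv_translate (f : C -> C) (c z l : C) :
  cderiv f (z - c) l -> cderiv (fun w => f (w - c)) z l.
Proof.
  intros H eps Heps. destruct (H eps Heps) as [d [Hd Hw]].
  exists d. split; [auto|]. intros w Hwz. specialize (Hw (w - c)).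
  replace (w - c - (z - c)) with (w - z) in Hw by ring. auto.
Qed.

Lemma cderiv_continuous (f : C -> C) (z l : C) (eps : R) :
  cderiv f z l -> (0 < eps)%R -> exists d, (0 < d)%R /\
  forall w, (Cmod (w - z) < d)%R -> (Cmod (f w - f z) < eps)%R.
Proof.
  intros H Heps. destruct (H 1%R Rlt_0_1) as [d [Hd Hw]].
  assert (HL : (0 < Cmod l + 1)%R) by (generalize (Cmod_ge_0 l); lra).
  exists (Rmin d (eps / (Cmod l + 1))). split.
  { apply Rmin_pos; [auto|]. now apply Rdiv_lt_0_compat. }
  intros w Hwz. specialize (Hw w (Rlt_Rmin_l _ _ _ Hwz)).
  apply Rlt_Rmin_r in Hwz.
  apply (Rmult_lt_compat_r (Cmod l + 1)) in Hwz; [|auto].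
  replace (eps / (Cmod l + 1) * (Cmod l + 1))%R with eps in Hwz by (field; lra).
  generalize (Cmod_triangle_rev (f w - f z) ((w - z) * l)). rewrite Cmod_mult. nra.
Qed.

Lemma C_derive_cderiv (f : C -> C) (z l : C) : cderiv f z l -> C_derive f z = l.
Proof.
  intros H. unfold C_derive. apply is_C_lim_unique.
  apply (filterlim_locally (U := C_UniformSpace)). intros eps.
  change (locally z (fun x => x <> z -> ball l eps ((f x - f z) / (x - z)))).
  apply locally_Cmod.
  destruct (H (eps / 2)%R) as [d [Hd Hw]]; [generalize (cond_pos eps); lra|].
  exists d. split; [auto|]. intros w Hwz Hne.
  apply C_NormedModule_mixin_compat1.
  assert (Hn : w - z <> 0) by (intros E; apply Hne; apply Ceq_minus; exact E).
  replace (minus _ l) with ((f w - f z - (w - z) * l) / (w - z)).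
  2:{ change ((f w - f z - (w - z) * l) / (w - z) = (f w - f z) / (w - z) + - l). field. exact Hn. }
  rewrite Cmod_div by exact Hn.
  apply Cmod_gt_0 in Hn. specialize (Hw w Hwz).
  apply (Rmult_lt_reg_r (Cmod (w - z))); [auto|].
  replace (Cmod (f w - f z - (w - z) * l) / Cmod (w - z) * Cmod (w - z))%R
    with (Cmod (f w - f z - (w - z) * l)) by (field; lra).
  generalize (cond_pos eps). nra.
Qed.

(** * Derivatives of complex functions of a real variable *)

Lemma is_derive_eps (f : R -> R) (t l : R) :
  is_derive f t l <->
  forall eps : R, (0 < eps)%R -> exists d : R, (0 < d)%R /\
    forall h : R, (Rabs h < d)%R -> (Rabs (f (t + h)%R - f t - h * l) <= eps * Rabs h)%R.
Proof.
  split.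
  - intros H. apply is_derive_Reals in H. intros eps Heps.
    destruct (H eps Heps) as [d Hd]. exists d. split; [apply cond_pos|].
    intros h Hh. destruct (Req_dec h 0) as [->|Hn].
    + rewrite Rplus_0_r. replace (f t - f t - 0 * l)%R with 0%R by ring. rewrite Rabs_R0. lra.
    + specialize (Hd h Hn Hh).
      replace (f (t + h)%R - f t - h * l)%R with (((f (t + h)%R - f t) / h - l) * h)%R by (field; auto).
      rewrite Rabs_mult. generalize (Rabs_pos h). nra.
  - intros H. apply is_derive_Reals. intros eps Heps.
    destruct (H (eps / 2)%R ltac:(lra)) as [d [Hd Hh]].
    exists (mkposreal d Hd). simpl. intros h Hn Hhd. specialize (Hh h Hhd).
    replace ((f (t + h)%R - f t) / h - l)%R with ((f (t + h)%R - f t - h * l) / h)%R by (field; auto).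
    unfold Rdiv. rewrite Rabs_mult, Rabs_inv.
    assert (0 < Rabs h)%R by (now apply Rabs_pos_lt).
    apply (Rmult_lt_reg_r (Rabs h)); [auto|].
    rewrite Rmult_assoc, Rinv_l by lra. nra.
Qed.

Lemma rderiv_eps (f : R -> C) (t : R) (l : C) :
  rderiv f t l <->
  forall eps : R, (0 < eps)%R -> exists d : R, (0 < d)%R /\
    forall h : R, (Rabs h < d)%R -> (Cmod (f (t + h)%R - f t - h * l) <= eps * Rabs h)%R.
Proof.
  assert (ER : forall h, Re (f (t + h)%R - f t - h * l) = (Re (f (t + h)%R) - Re (f t) - h * Re l)%R).
  { intros h. unfold Re; simpl. ring. }
  assert (EI : forall h, Im (f (t + h)%R - f t - h * l) = (Im (f (t + h)%R) - Im (f t) - h * Im l)%R).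
  { intros h. unfold Im; simpl. ring. }
  split.
  - intros [H1 H2] eps Heps.
    destruct (proj1 (is_derive_eps _ _ _) H1 (eps / 2)%R ltac:(lra)) as [d1 [Hd1 K1]].
    destruct (proj1 (is_derive_eps _ _ _) H2 (eps / 2)%R ltac:(lra)) as [d2 [Hd2 K2]].
    exists (Rmin d1 d2). split; [now apply Rmin_pos|]. intros h Hh.
    eapply Rle_trans; [apply Cmod_le_Re_Im|]. rewrite ER, EI.
    generalize (K1 h (Rlt_Rmin_l _ _ _ Hh)) (K2 h (Rlt_Rmin_r _ _ _ Hh)). lra.
  - intros H. split; apply is_derive_eps; intros eps Heps;
    destruct (H eps Heps) as [d [Hd Hh]]; exists d; split; auto; intros h Hhd; specialize (Hh h Hhd).
    + rewrite <- ER. eapply Rle_trans; [apply re_le_Cmod|auto].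
    + rewrite <- EI. eapply Rle_trans; [apply Im_le_Cmod|auto].
Qed.

Lemma rderiv_comp (f : C -> C) (g : R -> C) (t : R) (l d : C) :
  cderiv f (g t) l -> rderiv g t d -> rderiv (fun s => f (g s)) t (d * l).
Proof.
  intros Hf Hg. apply rderiv_eps. intros eps Heps.
  pose proof (proj1 (rderiv_eps _ _ _) Hg) as Hg'.
  assert (Hd0 := Cmod_ge_0 d). assert (Hl0 := Cmod_ge_0 l).
  set (e1 := (eps / 2 / (Cmod d + 1))%R).
  assert (He1 : (0 < e1)%R) by (unfold e1; apply Rdiv_lt_0_compat; lra).
  destruct (Hf e1 He1) as [r1 [Hr1 K1]].
  destruct (Hg' 1%R Rlt_0_1) as [r2 [Hr2 K2]].
  set (e3 := (eps / 2 / (Cmod l + 1))%R).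
  assert (He3 : (0 < e3)%R) by (unfold e3; apply Rdiv_lt_0_compat; lra).
  destruct (Hg' e3 He3) as [r3 [Hr3 K3]].
  exists (Rmin (Rmin r2 r3) (r1 / (Cmod d + 1))).
  split.
  { repeat apply Rmin_pos; auto. apply Rdiv_lt_0_compat; lra. }
  intros h Hh.
  assert (Hh2 : (Rabs h < r2)%R) by (eapply Rlt_le_trans; [exact Hh|]; eapply Rle_trans; [apply Rmin_l|apply Rmin_l]).
  assert (Hh3 : (Rabs h < r3)%R) by (eapply Rlt_le_trans; [exact Hh|]; eapply Rle_trans; [apply Rmin_l|apply Rmin_r]).
  assert (Hh1 : (Rabs h < r1 / (Cmod d + 1))%R) by (exact (Rlt_Rmin_r _ _ _ Hh)).
  specialize (K2 h Hh2). specialize (K3 h Hh3).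
  assert (B : (Cmod (g (t + h)%R - g t) <= (Cmod d + 1) * Rabs h)%R).
  { generalize (Cmod_triangle_rev (g (t + h)%R - g t) (h * d)).
    rewrite Cmod_mult, Cmod_R. lra. }
  assert (B1 : (Cmod (g (t + h)%R - g t) < r1)%R).
  { apply Rle_lt_trans with (1 := B). apply (Rmult_lt_compat_l (Cmod d + 1)) in Hh1; [|lra].
    replace ((Cmod d + 1) * (r1 / (Cmod d + 1)))%R with r1 in Hh1 by (field; lra). exact Hh1. }
  specialize (K1 _ B1).
  replace (f (g (t + h)%R) - f (g t) - h * (d * l)) with
    ((f (g (t + h)%R) - f (g t) - (g (t + h)%R - g t) * l) + (g (t + h)%R - g t - h * d) * l) by ring.
  eapply Rle_trans; [apply Cmod_triangle|]. rewrite (Cmod_mult _ l).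
  apply Rle_trans with (e1 * ((Cmod d + 1) * Rabs h) + (e3 * Rabs h) * Cmod l)%R.
  - apply Rplus_le_compat.
    + eapply Rle_trans; [exact K1|]. apply Rmult_le_compat_l; lra.
    + apply Rmult_le_compat_r; auto.
  - replace (e1 * ((Cmod d + 1) * Rabs h))%R with (eps / 2 * Rabs h)%R by (unfold e1; field; lra).
    assert (e3 * Cmod l <= eps / 2)%R.
    { apply Rle_trans with (e3 * (Cmod l + 1))%R; [nra|]. right. unfold e3. field. lra. }
    generalize (Rabs_pos h). nra.
Qed.

Lemma rderiv_ext_loc (f g : R -> C) (t : R) (l : C) :
  locally t (fun s => f s = g s) -> rderiv f t l -> rderiv g t l.
Proof.
  intros H [H1 H2]. split.
  - eapply is_derive_ext_loc; [|exact H1]. revert H. apply filter_imp. intros s E. now rewrite E.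
  - eapply is_derive_ext_loc; [|exact H2]. revert H. apply filter_imp. intros s E. now rewrite E.
Qed.

Lemma rderiv_ext (f g : R -> C) (t : R) (l : C) :
  (forall s, f s = g s) -> rderiv f t l -> rderiv g t l.
Proof. intros H. apply rderiv_ext_loc. now apply filter_forall. Qed.

Lemma rderiv_const (c : C) (t : R) : rderiv (fun _ => c) t 0.
Proof. split; apply (is_derive_const (K := R_AbsRing) (V := R_NormedModule)). Qed.

Lemma rderiv_plus (f g : R -> C) (t : R) (l m : C) :
  rderiv f t l -> rderiv g t m -> rderiv (fun s => f s + g s) t (l + m).
Proof.
  intros [H1 H2] [H3 H4]. split; now apply (is_derive_plus (K := R_AbsRing) (V := R_NormedModule)).
Qed.

Lemma rderiv_mult (f g : R -> C) (t : R) (l m : C) :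
  rderiv f t l -> rderiv g t m -> rderiv (fun s => f s * g s) t (l * g t + f t * m).
Proof.
  intros [H1 H2] [H3 H4]. split.
  - replace (Re (l * g t + f t * m)) with
      ((Re l * Re (g t) + Re (f t) * Re m) - (Im l * Im (g t) + Im (f t) * Im m))%R
      by (unfold Re, Im; simpl; ring).
    exact (is_derive_minus _ _ _ _ _ (Derive.is_derive_mult _ _ _ _ _ H1 H3)
      (Derive.is_derive_mult _ _ _ _ _ H2 H4)).
  - replace (Im (l * g t + f t * m)) with
      ((Re l * Im (g t) + Re (f t) * Im m) + (Im l * Re (g t) + Im (f t) * Re m))%R
      by (unfold Re, Im; simpl; ring).
    exact (is_derive_plus _ _ _ _ _ (Derive.is_derive_mult _ _ _ _ _ H1 H4)
      (Derive.is_derive_mult _ _ _ _ _ H2 H3)).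
Qed.

Lemma rderiv_scal (c : C) (f : R -> C) (t : R) (l : C) :
  rderiv f t l -> rderiv (fun s => c * f s) t (c * l).
Proof.
  intros H. replace (c * l) with (0 * f t + c * l) by ring.
  apply (rderiv_mult (fun _ => c)); [apply rderiv_const|exact H].
Qed.

Lemma rderiv_minus (f g : R -> C) (t : R) (l m : C) :
  rderiv f t l -> rderiv g t m -> rderiv (fun s => f s - g s) t (l - m).
Proof.
  intros Hf Hg. replace (l - m) with (l + (- (1)) * m) by ring.
  apply rderiv_ext with (fun s => f s + (- (1)) * g s); [intros s; ring|].
  apply rderiv_plus; [auto|now apply rderiv_scal].
Qed.

Lemma rderiv_affine (f : R -> C) (t0 c t : R) (l : C) :
  rderiv f (t0 + t * c)%R l -> rderiv (fun s => f (t0 + s * c)%R) t (c * l).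
Proof.
  intros [H1 H2].
  assert (D : is_derive (fun s => (t0 + s * c)%R) t c) by (auto_derive; [auto|ring]).
  split.
  - rewrite re_scal_l. apply (is_derive_comp (fun s => Re (f s)) _ _ _ _ H1 D).
  - rewrite im_scal_l. apply (is_derive_comp (fun s => Im (f s)) _ _ _ _ H2 D).
Qed.

Lemma continuous_ex_derive (f : R -> R) (t : R) : ex_derive f t -> continuous f t.
Proof. apply (ex_derive_continuous (K := R_AbsRing) (V := R_NormedModule)). Qed.

Lemma rderiv_continuous_Re (f : R -> C) (t : R) (l : C) : rderiv f t l -> continuous (fun s => Re (f s)) t.
Proof. intros [H _]. apply continuous_ex_derive. eexists; exact H. Qed.

Lemma rderiv_continuous_Im (f : R -> C) (t : R) (l : C) : rderiv f t l -> continuous (fun s => Im (f s)) t.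
Proof. intros [_ H]. apply continuous_ex_derive. eexists; exact H. Qed.

(** * Uniqueness for linear systems on [0,1] *)

Lemma real_nonincr (f df : R -> R) (a b : R) :
  (a <= b)%R -> (forall t, (a <= t <= b)%R -> is_derive f t (df t)) ->
  (forall t, (a <= t <= b)%R -> (df t <= 0)%R) -> (f b <= f a)%R.
Proof.
  intros [Hab|<-] Hf Hd; [|lra].
  destruct (MVT_cor2 f df a b Hab) as [c [Hc Hc2]].
  - intros c Hc. apply is_derive_Reals. now apply Hf.
  - specialize (Hd c ltac:(lra)). nra.
Qed.

(* Gronwall: [N = |y1|^2 + |y2|^2] satisfies [N' <= 4 K N], so [N exp (- 4 K t)] does not increase. *)
Lemma linear_system_unique (y1 y2 d1 d2 : R -> C) (K : R) :
  (forall t, (0 <= t <= 1)%R -> rderiv y1 t (d1 t)) ->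
  (forall t, (0 <= t <= 1)%R -> rderiv y2 t (d2 t)) ->
  (forall t, (0 <= t <= 1)%R -> (Cmod (d1 t) <= K * (Cmod (y1 t) + Cmod (y2 t)))%R) ->
  (forall t, (0 <= t <= 1)%R -> (Cmod (d2 t) <= K * (Cmod (y1 t) + Cmod (y2 t)))%R) ->
  y1 0%R = 0 -> y2 0%R = 0 ->
  forall t, (0 <= t <= 1)%R -> y1 t = 0 /\ y2 t = 0.
Proof.
  intros H1 H2 B1 B2 Z1 Z2.
  set (N := fun t => (Re (y1 t) ^ 2 + Im (y1 t) ^ 2 + (Re (y2 t) ^ 2 + Im (y2 t) ^ 2))%R).
  set (dN := fun t => (2 * (Re (y1 t) * Re (d1 t) + Im (y1 t) * Im (d1 t)
     + (Re (y2 t) * Re (d2 t) + Im (y2 t) * Im (d2 t))))%R).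
  assert (CS : forall u v : C, (Re u * Re v + Im u * Im v <= Cmod u * Cmod v)%R).
  { intros u v. rewrite <- (Cmod_conj v), <- Cmod_mult.
    replace (Re u * Re v + Im u * Im v)%R with (Re (u * Cconj v)) by (unfold Re, Im; simpl; ring).
    eapply Rle_trans; [apply Rle_abs|apply re_le_Cmod]. }
  assert (NE : forall t, N t = (Cmod (y1 t) ^ 2 + Cmod (y2 t) ^ 2)%R).
  { intros t. unfold N. now rewrite !Cmod2_alt. }
  assert (HN : forall t, (0 <= t <= 1)%R -> is_derive N t (dN t)).
  { intros t Ht. destruct (H1 t Ht) as [A1 A2], (H2 t Ht) as [A3 A4].
    assert (SQ : forall u l, is_derive u t l -> is_derive (fun s => u s ^ 2)%R t (2 * (u t * l))%R).
    { intros u l Hu. replace (2 * (u t * l))%R with (l * u t + u t * l)%R by ring.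
      apply is_derive_ext with (fun s => u s * u s)%R; [intros s; simpl; ring|].
      now apply Derive.is_derive_mult. }
    unfold N, dN.
    replace (2 * _)%R with (2 * (Re (y1 t) * Re (d1 t)) + 2 * (Im (y1 t) * Im (d1 t))
     + (2 * (Re (y2 t) * Re (d2 t)) + 2 * (Im (y2 t) * Im (d2 t))))%R by ring.
    exact (is_derive_plus _ _ _ _ _ (is_derive_plus _ _ _ _ _ (SQ _ _ A1) (SQ _ _ A2))
      (is_derive_plus _ _ _ _ _ (SQ _ _ A3) (SQ _ _ A4))). }
  assert (HB : forall t, (0 <= t <= 1)%R -> (dN t <= 4 * K * N t)%R).
  { intros t Ht. unfold dN. rewrite NE.
    generalize (CS (y1 t) (d1 t)) (CS (y2 t) (d2 t)) (B1 t Ht) (B2 t Ht)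
      (Cmod_ge_0 (y1 t)) (Cmod_ge_0 (y2 t)) (Cmod_ge_0 (d1 t)).
    set (a := Cmod (y1 t)). set (b := Cmod (y2 t)). intros.
    assert (a * Cmod (d1 t) <= a * (K * (a + b)))%R by (apply Rmult_le_compat_l; auto).
    assert (b * Cmod (d2 t) <= b * (K * (a + b)))%R by (apply Rmult_le_compat_l; auto).
    (* The sign of [K] is not given; for K < 0 the hypotheses already force both components to
       vanish at t. *)
    destruct (Rle_or_lt 0 K) as [HK|HK].
    - generalize (Rmult_le_pos _ _ HK (pow2_ge_0 (a - b))). nra.
    - assert (a + b <= 0)%R.
      { apply Rnot_lt_le. intros Hab. generalize (Rmult_lt_0_compat _ _ (Ropp_0_gt_lt_contravar _ HK) Hab). lra. }
      assert (Ea : a = 0%R) by lra. assert (Eb : b = 0%R) by lra. rewrite Ea, Eb in *. nra. }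
  intros t Ht.
  assert (HE : (N t * exp (- (4 * K) * t) <= N 0 * exp (- (4 * K) * 0))%R).
  { apply (real_nonincr (fun s => N s * exp (- (4 * K) * s))%R
      (fun s => (dN s - 4 * K * N s) * exp (- (4 * K) * s))%R); [lra| |].
    - intros s Hs. specialize (HN s ltac:(lra)). auto_derive; [eexists; exact HN|].
      replace (Derive (fun x => N x) s) with (dN s) by (symmetry; now apply is_derive_unique).
      ring.
    - intros s Hs. specialize (HB s ltac:(lra)). generalize (exp_pos (- (4 * K) * s)). nra. }
  assert (N0 : N 0%R = 0%R) by (unfold N; rewrite Z1, Z2; simpl; ring).
  rewrite N0, Rmult_0_l in HE.
  assert (Nt : (N t <= 0)%R) by (generalize (exp_pos (- (4 * K) * t)); nra).
  rewrite NE in Nt. generalize (Cmod_ge_0 (y1 t)) (Cmod_ge_0 (y2 t)). intros.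
  split; apply Cmod_eq_0; nra.
Qed.

(** * Local solutions of the equation *)

(** Each of the two differentiations doubles the ratio, whence the 4 here and in the radii 4 r rho
    <= 1 below. *)
Lemma CPS_derive2 (a : nat -> C) (r : R) (h : C) :
  (0 < r)%R -> geom a r -> (4 * r * Cmod h < 1)%R ->
  cderiv (CPS a) h (CPS (dcoef a) h) /\
  cderiv (CPS (dcoef a)) h (CPS (dcoef (dcoef a)) h) /\
  is_cps a h (CPS a h) /\ is_cps (dcoef a) h (CPS (dcoef a) h) /\
  is_cps (dcoef (dcoef a)) h (CPS (dcoef (dcoef a)) h).
Proof.
  intros Hr Ha Hh. assert (Hc := Cmod_ge_0 h).
  assert (G1 : geom (dcoef a) (2 * r)) by (apply geom_dcoef; auto; lra).
  assert (G2 : geom (dcoef (dcoef a)) (2 * (2 * r))) by (apply geom_dcoef; auto; lra).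
  split; [apply (cderiv_CPS a r); auto; nra|].
  split; [apply (cderiv_CPS (dcoef a) (2 * r)); auto; nra|].
  split; [apply (CPS_correct a r); auto; nra|].
  split; [apply (CPS_correct _ (2 * r)); auto; nra|].
  apply (CPS_correct _ (2 * (2 * r))); auto; nra.
Qed.

(** Continuity at 0 kills the constant coefficient; then the series divided by h vanishes at the
    same points h <> 0, and the induction goes on with the shifted coefficients. *)
Lemma CPS_isolated_zero (a : nat -> C) (r : R) :
  (0 < r)%R -> geom a r ->
  (forall eps : R, (0 < eps)%R -> exists h : C, h <> 0 /\ (Cmod h < eps)%R /\ CPS a h = 0) ->
  forall n, a n = 0.
Proof.
  intros Hr Ha Hz n. revert a Ha Hz.
  assert (Z0 : forall a, geom a r ->
    (forall eps : R, (0 < eps)%R -> exists h : C, h <> 0 /\ (Cmod h < eps)%R /\ CPS a h = 0) -> a 0%nat = 0).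
  { intros a Ha Hz.
    assert (Hc : (r * Cmod 0 < 1)%R) by (rewrite Cmod_0; lra).
    assert (E0 : CPS a 0 = a 0%nat) by (apply is_cps_unique, (is_pseries_0 (K := C_AbsRing) (V := C_NormedModule) a)).
    rewrite <- E0. apply Cmod_eq_0. apply Rle_antisym; [|apply Cmod_ge_0].
    apply le_epsilon. intros eps Heps. rewrite Rplus_0_l.
    destruct (cderiv_continuous _ _ _ eps (cderiv_CPS a r 0 Hr Ha Hc) Heps) as [d [Hd H]].
    destruct (Hz d Hd) as [h [_ [Hh Hh0]]]. specialize (H h).
    replace (h - 0) with h in H by ring. specialize (H Hh). rewrite Hh0, Cmod_minus_sym in H.
    replace (CPS a 0 - 0) with (CPS a 0) in H by ring. lra. }
  induction n as [|n IH]; intros a Ha Hz; [now apply Z0|].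
  assert (A0 := Z0 a Ha Hz).
  apply (IH (fun k => a (S k))); [now apply geom_shift|].
  intros eps Heps.
  destruct (Hz (Rmin eps (/ r))) as [h [Hh [Hhe Hh0]]].
  { apply Rmin_pos; [auto|now apply Rinv_0_lt_compat]. }
  exists h. split; [auto|]. split; [exact (Rlt_Rmin_l _ _ _ Hhe)|].
  assert (Hrh : (r * Cmod h < 1)%R).
  { apply Rlt_Rmin_r in Hhe.
    apply (Rmult_lt_compat_l r) in Hhe; [|auto]. rewrite Rinv_r in Hhe by lra. exact Hhe. }
  generalize (is_cps_shift _ _ _ Hh (CPS_correct a r h ltac:(lra) Ha Hrh)). intros H.
  rewrite (is_cps_unique _ _ _ H), Hh0, A0. field. exact Hh.
Qed.

Lemma analytic_at_CPS (f : C -> C) (w : C) :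
  analytic_at f w <->
  exists (a : nat -> C) (r rho : R), (0 < r)%R /\ (0 < rho)%R /\ geom a r /\
    (4 * r * rho <= 1)%R /\
    forall z, (Cmod (z - w) < rho)%R -> f z = CPS a (z - w).
Proof.
  split.
  - intros [a H]. apply locally_Cmod in H. destruct H as [d [Hd H]].
    assert (Hh : (0 < d / 2)%R) by lra.
    assert (Hm : Cmod (RtoC (d / 2)) = (d / 2)%R) by (rewrite Cmod_R, Rabs_pos_eq; lra).
    assert (G : geom a (/ Cmod (RtoC (d / 2)))).
    { apply is_cps_geom with (l := f (w + RtoC (d / 2))).
      - intros E. apply (f_equal Cmod) in E. rewrite Hm, Cmod_0 in E. lra.
      - specialize (H (w + RtoC (d / 2))).
        replace (w + RtoC (d / 2) - w) with (RtoC (d / 2)) in H by ring.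
        apply H. rewrite Hm. lra. }
    rewrite Hm in G.
    (* Convergence at the point w + d / 2 gives the ratio 2 / d, and 4 * (2 / d) * (d / 8) = 1. *)
    exists a, (/ (d / 2))%R, (d / 8)%R.
    repeat split; auto; try lra.
    + now apply Rinv_0_lt_compat.
    + right. field. lra.
    + intros z Hz. symmetry. apply is_cps_unique. apply H. lra.
  - intros [a [r [rho [Hr [Hrho [G [Hrr H]]]]]]]. exists a.
    apply locally_Cmod. exists rho. split; [auto|]. intros z Hz.
    rewrite (H z Hz). apply (CPS_correct a r); auto; [lra|].
    generalize (Cmod_ge_0 (z - w)). nra.
Qed.

(** To identify [C_derive (C_derive g)] at a point, [C_derive g] must be known near it; hence the
    statement on a whole disc. *)
Lemma ball_derive2 (g f0 f1 f2 : C -> C) (w : C) (d : R) :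
  (forall z, (Cmod (z - w) < d)%R -> f0 z = g z) ->
  (forall z, (Cmod (z - w) < d)%R -> cderiv f0 z (f1 z) /\ cderiv f1 z (f2 z)) ->
  forall z, (Cmod (z - w) < d)%R ->
    cderiv g z (f1 z) /\ C_derive g z = f1 z /\
    cderiv (C_derive g) z (f2 z) /\ C_derive (C_derive g) z = f2 z.
Proof.
  intros E D.
  assert (L : forall (P : C -> Prop) z, (forall y, (Cmod (y - w) < d)%R -> P y) ->
    (Cmod (z - w) < d)%R -> locally z P).
  { intros P z HP Hz. apply locally_Cmod. exists (d - Cmod (z - w))%R. split; [lra|].
    intros y Hy. apply HP. replace (y - w) with ((y - z) + (z - w)) by ring.
    eapply Rle_lt_trans; [apply Cmod_triangle|]. lra. }
  assert (D1 : forall z, (Cmod (z - w) < d)%R -> cderiv g z (f1 z)).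
  { intros z Hz. apply cderiv_ext_loc with f0; [now apply L|now apply D]. }
  assert (D2 : forall z, (Cmod (z - w) < d)%R -> cderiv (C_derive g) z (f2 z)).
  { intros z Hz. apply cderiv_ext_loc with f1; [|now apply D].
    apply L; [|auto]. intros y Hy. symmetry. now apply C_derive_cderiv, D1. }
  intros z Hz. repeat split; auto; apply C_derive_cderiv; auto.
Qed.

Lemma CPS_center_derives (a : nat -> C) (r rho : R) (f : C -> C) (w : C) :
  (0 < r)%R -> geom a r -> (4 * r * rho <= 1)%R ->
  (forall z, (Cmod (z - w) < rho)%R -> f z = CPS a (z - w)) ->
  forall z, (Cmod (z - w) < rho)%R ->
    cderiv f z (CPS (dcoef a) (z - w)) /\
    C_derive f z = CPS (dcoef a) (z - w) /\
    cderiv (C_derive f) z (CPS (dcoef (dcoef a)) (z - w)) /\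
    C_derive (C_derive f) z = CPS (dcoef (dcoef a)) (z - w).
Proof.
  intros Hr G Hrr H.
  apply (ball_derive2 f (fun z => CPS a (z - w)) (fun z => CPS (dcoef a) (z - w))
    (fun z => CPS (dcoef (dcoef a)) (z - w))).
  - intros z Hz. symmetry. auto.
  - intros z Hz. destruct (CPS_derive2 a r (z - w) Hr G) as [D1 [D2 _]].
    + generalize (Cmod_ge_0 (z - w)). nra.
    + split; [apply (cderiv_translate (CPS a))|apply (cderiv_translate (CPS (dcoef a)))]; auto.
Qed.

(** * The equation in terms of Taylor coefficients *)

Definition ode (lambda mu n z E E' E'' : C) : C :=
  z ^ 2 * E'' + (n * z + mu * (1 - z ^ 2)) * E' + (lambda - mu * n * z) * E.

(* Multiplication by the variable, for series in powers of [z - w]. *)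
Definition mulz (w : C) (a : nat -> C) (k : nat) : C := w * a k + shift_right a k.

Lemma is_cps_mulz (w h x : C) (a : nat -> C) : is_cps a h x -> is_cps (mulz w a) h ((w + h) * x).
Proof.
  intros H. replace ((w + h) * x) with (w * x + h * x) by ring.
  apply is_cps_plus; [now apply is_cps_scal|now apply is_cps_shift_right].
Qed.

Lemma geom_shift_right (a : nat -> C) (r : R) : (0 < r)%R -> geom a r -> geom (shift_right a) r.
Proof.
  intros Hr [K HK]. pose proof (geom_K_nonneg _ _ _ HK).
  exists (K / r)%R. intros [|k]; simpl.
  - rewrite Cmod_0, Rmult_1_r. apply Rdiv_le_0_compat; lra.
  - replace (K / r * (r * r ^ k))%R with (K * r ^ k)%R by (field; lra). apply HK.
Qed.

Lemma geom_mulz (w : C) (a : nat -> C) (r : R) : (0 < r)%R -> geom a r -> geom (mulz w a) r.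
Proof. intros Hr H. apply geom_plus; [now apply geom_scal|now apply geom_shift_right]. Qed.

(** Coefficients of the left side of the equation in powers of z - w, kept as nested [mulz] and
    [dcoef] so that the convergence and growth lemmas apply summand by summand. *)
Definition ode_coef (lambda mu n w : C) (a : nat -> C) (k : nat) : C :=
  mulz w (mulz w (dcoef (dcoef a))) k
  + (n * mulz w (dcoef a) k
  + (mu * dcoef a k + (- mu * mulz w (mulz w (dcoef a)) k
  + (lambda * a k + - (mu * n) * mulz w a k)))).

Lemma is_cps_ode_coef (lambda mu n w h x0 x1 x2 : C) (a : nat -> C) :
  is_cps a h x0 -> is_cps (dcoef a) h x1 -> is_cps (dcoef (dcoef a)) h x2 ->
  is_cps (ode_coef lambda mu n w a) h (ode lambda mu n (w + h) x0 x1 x2).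
Proof.
  intros H0 H1 H2.
  replace (ode lambda mu n (w + h) x0 x1 x2) with
    ((w + h) * ((w + h) * x2) + (n * ((w + h) * x1) + (mu * x1 + (- mu * ((w + h) * ((w + h) * x1))
     + (lambda * x0 + - (mu * n) * ((w + h) * x0)))))) by (unfold ode; ring).
  pose proof (is_cps_mulz w h _ _ (is_cps_mulz w h _ _ H2)) as A2.
  pose proof (is_cps_mulz w h _ _ H1) as A1. pose proof (is_cps_mulz w h _ _ A1) as A11.
  pose proof (is_cps_mulz w h _ _ H0) as A0.
  exact (is_cps_plus _ _ _ _ _ A2 (is_cps_plus _ _ _ _ _ (is_cps_scal n _ _ _ A1)
    (is_cps_plus _ _ _ _ _ (is_cps_scal mu _ _ _ H1) (is_cps_plus _ _ _ _ _ (is_cps_scal (- mu) _ _ _ A11)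
    (is_cps_plus _ _ _ _ _ (is_cps_scal lambda _ _ _ H0) (is_cps_scal (- (mu * n)) _ _ _ A0)))))).
Qed.

Lemma geom_ode_coef (lambda mu n w : C) (a : nat -> C) (r : R) :
  (0 < r)%R -> geom a r -> geom (ode_coef lambda mu n w a) (4 * r).
Proof.
  intros Hr Ha.
  assert (G1 : geom (dcoef a) (2 * r)) by (apply geom_dcoef; auto; lra).
  assert (G2 : geom (dcoef (dcoef a)) (4 * r)).
  { replace (4 * r)%R with (2 * (2 * r))%R by ring. apply geom_dcoef; auto; lra. }
  assert (G1' : geom (dcoef a) (4 * r)) by (apply geom_le with (2 * r)%R; auto; lra).
  assert (G0' : geom a (4 * r)) by (apply geom_le with r; auto; lra).
  assert (H4 : (0 < 4 * r)%R) by lra.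
  pose proof (geom_mulz w _ _ H4 (geom_mulz w _ _ H4 G2)) as A2.
  pose proof (geom_mulz w _ _ H4 G1') as A1. pose proof (geom_mulz w _ _ H4 A1) as A11.
  pose proof (geom_mulz w _ _ H4 G0') as A0.
  exact (geom_plus _ _ _ A2 (geom_plus _ _ _ (geom_scal n _ _ A1)
    (geom_plus _ _ _ (geom_scal mu _ _ G1') (geom_plus _ _ _ (geom_scal (- mu) _ _ A11)
    (geom_plus _ _ _ (geom_scal lambda _ _ G0') (geom_scal (- (mu * n)) _ _ A0)))))).
Qed.

Definition ode_rest (lambda mu n w : C) (k : nat) (x y z : C) : C :=
  (2 * w * INR k * (INR k + 1) + (INR k + 1) * (n * w + mu - mu * w ^ 2)) * z
  + ((INR k - 1) * INR k + INR k * (n - 2 * mu * w) + (lambda - mu * n * w)) * y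
  + (- mu * (INR k - 1) - mu * n) * x.

(* [ode_state k] is [(a (k - 1), a k, a (k + 1))] for the Taylor coefficients [a] at [w];
   the coefficient of order [k] of the equation is
   [w ^ 2 * (k + 1) * (k + 2) * a (k + 2) + ode_rest k]. *)
Fixpoint ode_state (lambda mu n w e0 e1 : C) (k : nat) : C * C * C :=
  match k with
  | O => (RtoC 0, e0, e1)
  | S k' =>
      let '(x, y, z) := ode_state lambda mu n w e0 e1 k' in
      (y, z, - ode_rest lambda mu n w k' x y z / (w ^ 2 * (INR k' + 1) * (INR k' + 2)))
  end.

Definition ode_series (lambda mu n w e0 e1 : C) (k : nat) : C :=
  snd (fst (ode_state lambda mu n w e0 e1 k)).

Lemma ode_state_next (lambda mu n w e0 e1 : C) (k : nat) :
  snd (ode_state lambda mu n w e0 e1 k) = ode_series lambda mu n w e0 e1 (S k).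
Proof.
  unfold ode_series. simpl. now destruct (ode_state lambda mu n w e0 e1 k) as [[x y] z].
Qed.

Lemma ode_state_prev (lambda mu n w e0 e1 : C) (k : nat) :
  fst (fst (ode_state lambda mu n w e0 e1 k)) = shift_right (ode_series lambda mu n w e0 e1) k.
Proof.
  destruct k; [reflexivity|]. unfold ode_series. simpl.
  now destruct (ode_state lambda mu n w e0 e1 k) as [[x y] z].
Qed.

Lemma INR_neq_0 (k : nat) (j : R) : (0 < j)%R -> INR k + j <> 0.
Proof.
  intros Hj E. apply (f_equal Re) in E. simpl in E. generalize (pos_INR k). lra.
Qed.

Lemma ode_series_coef (lambda mu n w e0 e1 : C) (k : nat) :
  w <> 0 -> ode_coef lambda mu n w (ode_series lambda mu n w e0 e1) k = 0.
Proof.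
  intros Hw. set (a := ode_series lambda mu n w e0 e1).
  assert (H1 := INR_neq_0 k 1 Rlt_0_1). assert (H2 := INR_neq_0 k 2 Rlt_0_2).
  assert (E : a (S (S k)) = - ode_rest lambda mu n w k (shift_right a k) (a k) (a (S k)) /
      (w ^ 2 * (INR k + 1) * (INR k + 2))).
  { unfold a. rewrite <- (ode_state_next lambda mu n w e0 e1 (S k)), <- ode_state_next, <- ode_state_prev.
    unfold ode_series at 1. simpl ode_state.
    now destruct (ode_state lambda mu n w e0 e1 k) as [[x y] z]. }
  assert (E' : w ^ 2 * (INR k + 1) * (INR k + 2) * a (S (S k))
      + ode_rest lambda mu n w k (shift_right a k) (a k) (a (S k)) = 0).
  { rewrite E. field. auto. }
  clear E. rewrite <- E'.
  unfold ode_coef, mulz, dcoef, ode_rest.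
  assert (HS : forall j, RtoC (INR (S j)) = INR j + 1) by (intros j; rewrite S_INR; apply RtoC_plus).
  destruct k as [|[|k]]; cbn [shift_right]; rewrite !HS; simpl (INR 0); ring.
Qed.

Lemma Cmod_triangle3 (x y z : C) : (Cmod (x + y + z) <= Cmod x + Cmod y + Cmod z)%R.
Proof.
  eapply Rle_trans; [apply Cmod_triangle|]. apply Rplus_le_compat_r. apply Cmod_triangle.
Qed.

(** The coefficients of [ode_rest] grow at most quadratically in k, like the factor w^2 (k + 1) (k +
    2) of the new coefficient; this is why the recursion produces a positive radius of
    convergence. *)
Lemma ode_rest_bound (lambda mu n w : C) :
  exists Q : R, (0 <= Q)%R /\ forall (k : nat) (x y z : C),
    (Cmod (ode_rest lambda mu n w k x y z)
      <= Q * ((INR k + 1) * (INR k + 2)) * (Cmod x + Cmod y + Cmod z))%R.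
Proof.
  set (c1 := Cmod (2 * w)). set (c2 := Cmod (n * w + mu - mu * w ^ 2)).
  set (c3 := Cmod (n - 2 * mu * w)). set (c4 := Cmod (lambda - mu * n * w)).
  set (c5 := Cmod (- mu)). set (c6 := Cmod (mu * n)).
  assert (P : (0 <= c1 /\ 0 <= c2 /\ 0 <= c3 /\ 0 <= c4 /\ 0 <= c5 /\ 0 <= c6)%R)
    by (repeat split; apply Cmod_ge_0).
  destruct P as [P1 [P2 [P3 [P4 [P5 P6]]]]].
  exists (c1 + c2 + (1 + c3 + c4) + (c5 + c6))%R. split; [lra|].
  intros k x y z. set (K := ((INR k + 1) * (INR k + 2))%R).
  assert (Hk := pos_INR k).
  assert (M : forall p : R, (0 <= p)%R -> Cmod p = p) by (intros p Hp; rewrite Cmod_R; now apply Rabs_pos_eq).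
  assert (Mk : Cmod (INR k) = INR k) by auto.
  assert (Mk1 : Cmod (INR k + 1) = (INR k + 1)%R) by (rewrite <- RtoC_plus; apply M; lra).
  assert (Mk2 : (Cmod (INR k - 1) <= INR k + 1)%R).
  { eapply Rle_trans; [apply Cmod_triangle|]. rewrite Cmod_opp, Mk, Cmod_1. lra. }
  assert (A1 : (Cmod (2 * w * INR k * (INR k + 1) + (INR k + 1) * (n * w + mu - mu * w ^ 2)) <= (c1 + c2) * K)%R).
  { eapply Rle_trans; [apply Cmod_triangle|].
    replace (2 * w * INR k * (INR k + 1)) with (2 * w * (INR k * (INR k + 1))) by ring.
    rewrite (Cmod_mult (2 * w)), !(Cmod_mult _ (INR k + 1)), (Cmod_mult (INR k + 1)), Mk, Mk1.
    fold c1 c2. unfold K. nra. }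
  assert (A2 : (Cmod ((INR k - 1) * INR k + INR k * (n - 2 * mu * w) + (lambda - mu * n * w)) <= (1 + c3 + c4) * K)%R).
  { eapply Rle_trans; [apply Cmod_triangle3|].
    rewrite (Cmod_mult (INR k - 1)), (Cmod_mult (INR k)), Mk. fold c3 c4.
    assert (Cmod (INR k - 1) * INR k <= (INR k + 1) * INR k)%R by (apply Rmult_le_compat_r; auto).
    unfold K. nra. }
  assert (A3 : (Cmod (- mu * (INR k - 1) - mu * n) <= (c5 + c6) * K)%R).
  { eapply Rle_trans; [apply Cmod_triangle|]. rewrite Cmod_opp, (Cmod_mult (- mu)). fold c5 c6.
    assert (c5 * Cmod (INR k - 1) <= c5 * (INR k + 1))%R by (apply Rmult_le_compat_l; auto).
    unfold K. nra. }
  assert (HK : (0 <= K)%R) by (unfold K; nra).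
  unfold ode_rest. eapply Rle_trans; [apply Cmod_triangle3|]. rewrite !(Cmod_mult _ z), !(Cmod_mult _ y), !(Cmod_mult _ x).
  generalize (Cmod_ge_0 x) (Cmod_ge_0 y) (Cmod_ge_0 z). intros Hx Hy Hz.
  apply (fun H => Rmult_le_compat_r _ _ _ H A1) in Hz as B1.
  apply (fun H => Rmult_le_compat_r _ _ _ H A2) in Hy as B2.
  apply (fun H => Rmult_le_compat_r _ _ _ H A3) in Hx as B3.
  assert (forall c d u : R, (0 <= c)%R -> (0 <= d)%R -> (0 <= u)%R -> (c * K * u <= (c + d) * K * u)%R).
  { intros c d u Hc Hd Hu. assert (0 <= d * K * u)%R by (apply Rmult_le_pos; [apply Rmult_le_pos|]; assumption). lra. }
  generalize (H (c1 + c2) (1 + c3 + c4 + (c5 + c6)) (Cmod z) ltac:(lra) ltac:(lra) Hz)%R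
     (H (1 + c3 + c4) (c1 + c2 + (c5 + c6)) (Cmod y) ltac:(lra) ltac:(lra) Hy)%R
     (H (c5 + c6) (c1 + c2 + (1 + c3 + c4)) (Cmod x) ltac:(lra) ltac:(lra) Hx)%R. lra.
Qed.

Lemma ode_series_geom (lambda mu n w e0 e1 : C) :
  w <> 0 -> exists r : R, (0 < r)%R /\ geom (ode_series lambda mu n w e0 e1) r.
Proof.
  intros Hw. destruct (ode_rest_bound lambda mu n w) as [Q0 [HQ0 HQ]].
  assert (Hw1 : (0 < Cmod w)%R) by (now apply Cmod_gt_0).
  assert (Hw2 : (0 < Cmod w ^ 2)%R) by (now apply pow_lt).
  set (Q := (Q0 / Cmod w ^ 2)%R).
  assert (HQn : (0 <= Q)%R) by (now apply Rdiv_le_0_compat).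
  (* Each of the three previous coefficients is at most K r^(k+1), since r >= 1, so the next one is
     at most 3 Q K r^(k+1) <= K r^(k+2). *)
  set (r := (1 + 3 * Q)%R). exists r. assert (Hr : (1 <= r)%R) by (unfold r; lra).
  split; [lra|]. exists (Cmod e0 + Cmod e1)%R. set (K := (Cmod e0 + Cmod e1)%R).
  assert (He0 := Cmod_ge_0 e0). assert (He1 := Cmod_ge_0 e1).
  assert (B : forall k, match ode_state lambda mu n w e0 e1 k with (x, y, z) =>
     (Cmod x <= K * r ^ k)%R /\ (Cmod y <= K * r ^ k)%R /\ (Cmod z <= K * r ^ S k)%R end).
  { induction k as [|k IH].
    - simpl. rewrite Cmod_0. unfold K. repeat split; nra.
    - cbn [ode_state]. destruct (ode_state lambda mu n w e0 e1 k) as [[x y] z].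
      destruct IH as [Hx [Hy Hz]].
      assert (Hp : (0 <= K * r ^ k)%R) by (apply Rmult_le_pos; [unfold K; lra|apply pow_le; lra]).
      assert (Hp1 : (K * r ^ k <= K * r ^ S k)%R) by (simpl; nra).
      split; [lra|]. split; [exact Hz|].
      assert (H1 := INR_neq_0 k 1 Rlt_0_1). assert (H2 := INR_neq_0 k 2 Rlt_0_2).
      assert (Hk := pos_INR k).
      set (k2 := ((INR k + 1) * (INR k + 2))%R).
      assert (Hk2 : (0 < k2)%R) by (unfold k2; nra).
      assert (Ek : w ^ 2 * (INR k + 1) * (INR k + 2) = w ^ 2 * k2).
      { unfold k2. rewrite RtoC_mult, !RtoC_plus. ring. }
      rewrite Ek.
      assert (Hd : w ^ 2 * k2 <> 0).
      { apply Cmult_neq_0; [now apply Cpow_nz|]. intros E. apply RtoC_inj in E. lra. }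
      rewrite Cmod_div, Cmod_opp, Cmod_mult, Cmod_pow, Cmod_R, Rabs_pos_eq by (auto; lra).
      specialize (HQ k x y z). fold k2 in HQ.
      apply Rle_trans with (Q * (Cmod x + Cmod y + Cmod z))%R.
      + apply (Rmult_le_reg_r (Cmod w ^ 2 * k2)); [nra|].
        replace (Cmod (ode_rest lambda mu n w k x y z) / (Cmod w ^ 2 * k2) * (Cmod w ^ 2 * k2))%R
          with (Cmod (ode_rest lambda mu n w k x y z)) by (field; split; lra).
        replace (Q * (Cmod x + Cmod y + Cmod z) * (Cmod w ^ 2 * k2))%R
          with (Q0 * k2 * (Cmod x + Cmod y + Cmod z))%R by (unfold Q; field; lra). exact HQ.
      + apply Rle_trans with (Q * (3 * (K * r ^ S k)))%R; [apply Rmult_le_compat_l; lra|].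
        replace (K * r ^ S (S k))%R with (r * (K * r ^ S k))%R by (simpl; ring).
        unfold r at 2. nra. }
  intros k. specialize (B k). unfold ode_series.
  destruct (ode_state lambda mu n w e0 e1 k) as [[x y] z]. apply B.
Qed.

(** The first two clauses certify that the values of the total operator [C_derive] are genuine
    derivatives. *)
Definition local_solution (lambda mu n : C) (f : C -> C) (w : C) (rho : R) : Prop :=
  forall z, (Cmod (z - w) < rho)%R ->
    cderiv f z (C_derive f z) /\ cderiv (C_derive f) z (C_derive (C_derive f) z) /\
    ode lambda mu n z (f z) (C_derive f z) (C_derive (C_derive f) z) = 0.

Definition initial_solution (lambda mu n w e0 e1 z : C) : C :=
  CPS (ode_series lambda mu n w e0 e1) (z - w).

Lemma initial_solution_spec (lambda mu n w e0 e1 : C) :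
  w <> 0 ->
  let f := initial_solution lambda mu n w e0 e1 in
  analytic_at f w /\ f w = e0 /\ C_derive f w = e1 /\
  exists rho : R, (0 < rho)%R /\ local_solution lambda mu n f w rho.
Proof.
  intros Hw f. destruct (ode_series_geom lambda mu n w e0 e1 Hw) as [r [Hr G]].
  unfold f, initial_solution.
  set (a := ode_series lambda mu n w e0 e1) in *.
  assert (Hrho : (0 < / (4 * r))%R) by (apply Rinv_0_lt_compat; lra).
  assert (Hrr : (4 * r * / (4 * r) <= 1)%R) by (rewrite Rinv_r; lra).
  pose proof (CPS_center_derives a r (/ (4 * r)) (fun z => CPS a (z - w)) w Hr G Hrr
     (fun z _ => eq_refl)) as D.
  assert (Ew : w - w = 0) by ring.
  split.
  { apply analytic_at_CPS. exists a, r, (/ (4 * r))%R. repeat split; auto. }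
  split.
  { rewrite Ew. apply is_cps_unique, (is_pseries_0 (K := C_AbsRing) (V := C_NormedModule) a). }
  split.
  { destruct (D w) as [_ [E _]]; [rewrite Ew, Cmod_0; auto|]. rewrite E, Ew.
    rewrite (is_cps_unique (dcoef a) 0 _ (is_pseries_0 (K := C_AbsRing) (V := C_NormedModule) (dcoef a))).
    unfold dcoef, a. rewrite <- ode_state_next. simpl. ring. }
  exists (/ (4 * r))%R. split; [auto|]. intros z Hz.
  destruct (D z Hz) as [D1 [D2 [D3 D4]]].
  assert (Hrz : (4 * r * Cmod (z - w) < 1)%R) by (generalize (Cmod_ge_0 (z - w)); nra).
  destruct (CPS_derive2 a r (z - w) Hr G Hrz) as [_ [K2 [K3 [K4 K5]]]].
  rewrite D4, D2. repeat split; auto.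
  pose proof (is_cps_ode_coef lambda mu n w _ _ _ _ _ K3 K4 K5) as H.
  replace (w + (z - w)) with z in H by ring.
  rewrite <- (is_cps_unique _ _ _ H). apply is_cps_unique.
  apply is_cps_ext with (fun _ => 0); [|apply is_cps_0].
  intros k. symmetry. now apply ode_series_coef.
Qed.

(** The left side of the equation is itself a power series about w, so it vanishes on a disc as soon
    as its zeros accumulate at w. This carries the equation to limit points of the circuit. *)
Lemma analytic_local (lambda mu n : C) (f : C -> C) (w : C) :
  analytic_at f w -> exists rho : R, (0 < rho)%R /\
    (forall z, (Cmod (z - w) < rho)%R ->
      cderiv f z (C_derive f z) /\ cderiv (C_derive f) z (C_derive (C_derive f) z)) /\
    ((forall eps : R, (0 < eps)%R -> exists z, z <> w /\ (Cmod (z - w) < eps)%R /\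
       ode lambda mu n z (f z) (C_derive f z) (C_derive (C_derive f) z) = 0) ->
     forall z, (Cmod (z - w) < rho)%R ->
       ode lambda mu n z (f z) (C_derive f z) (C_derive (C_derive f) z) = 0).
Proof.
  intros Ha. apply analytic_at_CPS in Ha. destruct Ha as [a [r [rho [Hr [Hrho [G [Hrr E]]]]]]].
  exists rho. split; [auto|].
  pose proof (CPS_center_derives a r rho f w Hr G Hrr E) as D.
  assert (O : forall z, (Cmod (z - w) < rho)%R ->
    ode lambda mu n z (f z) (C_derive f z) (C_derive (C_derive f) z) = CPS (ode_coef lambda mu n w a) (z - w)).
  { intros z Hz. destruct (D z Hz) as [_ [E1 [_ E2]]]. rewrite E1, E2, (E z Hz).
    assert (Hrz : (4 * r * Cmod (z - w) < 1)%R) by (generalize (Cmod_ge_0 (z - w)); nra).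
    destruct (CPS_derive2 a r (z - w) Hr G Hrz) as [_ [_ [K3 [K4 K5]]]].
    pose proof (is_cps_ode_coef lambda mu n w _ _ _ _ _ K3 K4 K5) as H.
    replace (w + (z - w)) with z in H by ring. symmetry. now apply is_cps_unique. }
  split.
  - intros z Hz. destruct (D z Hz) as [D1 [D2 [D3 D4]]]. now rewrite D4, D2.
  - intros Hz z Hzr. rewrite (O z Hzr). apply is_cps_unique.
    apply is_cps_ext with (fun _ => 0); [|apply is_cps_0]. intros k. symmetry. revert k.
    apply (CPS_isolated_zero _ (4 * r)); [lra|now apply geom_ode_coef|].
    intros eps Heps. destruct (Hz (Rmin eps rho)) as [y [Hyw [Hye Hy0]]]; [now apply Rmin_pos|].
    exists (y - w). split; [intros F; apply Hyw; apply Ceq_minus; exact F|].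
    split; [exact (Rlt_Rmin_l _ _ _ Hye)|].
    rewrite <- O; [exact Hy0|]. exact (Rlt_Rmin_r _ _ _ Hye).
Qed.

(** * Solutions along curves *)

Lemma Cexp_0 : Cexp 0 = 1.
Proof. unfold Cexp. simpl. rewrite exp_0, cos_0, sin_0. apply C_eq; unfold Re, Im; simpl; ring. Qed.

Lemma Cexp_plus (z w : C) : Cexp (z + w) = Cexp z * Cexp w.
Proof.
  unfold Cexp. simpl. rewrite exp_plus, cos_plus, sin_plus. apply C_eq; unfold Re, Im; simpl; ring.
Qed.

Lemma Cexp_opp_l (z : C) : Cexp (- z) * Cexp z = 1.
Proof. rewrite <- Cexp_plus. replace (- z + z) with (RtoC 0) by ring. apply Cexp_0. Qed.

Lemma Cexp_neq_0 (z : C) : Cexp z <> 0.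
Proof.
  intros E. apply C1_nz. rewrite <- (Cexp_opp_l z), E. ring.
Qed.

Lemma Cmod_Cexp (z : C) : Cmod (Cexp z) = exp (Re z).
Proof.
  unfold Cexp. rewrite Cmod_mult, Cmod_R, Rabs_pos_eq by (left; apply exp_pos).
  assert (E : Cmod (cos (Im z), sin (Im z)) = 1%R).
  { unfold Cmod. simpl. rewrite !Rmult_1_r, Rplus_comm.
    replace (sin (Im z) * sin (Im z) + cos (Im z) * cos (Im z))%R with 1%R; [apply sqrt_1|].
    generalize (sin2_cos2 (Im z)). unfold Rsqr. lra. }
  rewrite E. ring.
Qed.

Lemma Cexp_PI : Cexp (PI * Ci) = - (1).
Proof.
  unfold Cexp. simpl. replace (PI * 0 - 0 * 1)%R with 0%R by ring.
  replace (PI * 1 + 0 * 0)%R with PI by ring.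
  rewrite exp_0, cos_PI, sin_PI. apply C_eq; unfold Re, Im; simpl; ring.
Qed.

Lemma rderiv_eq (f : R -> C) (t : R) (l l' : C) : rderiv f t l' -> l' = l -> rderiv f t l.
Proof. now intros H <-. Qed.

Lemma rderiv_Cexp (c : C) (t : R) : rderiv (fun s => Cexp (c * s)) t (c * Cexp (c * t)).
Proof.
  assert (ER : forall s : R, Re (Cexp (c * s)) = (exp (Re c * s) * cos (Im c * s))%R).
  { intros s. unfold Cexp. simpl.
    replace (fst c * s - snd c * 0)%R with (Re c * s)%R by (unfold Re; ring).
    replace (fst c * 0 + snd c * s)%R with (Im c * s)%R by (unfold Im; ring). ring. }
  assert (EI : forall s : R, Im (Cexp (c * s)) = (exp (Re c * s) * sin (Im c * s))%R).
  { intros s. unfold Cexp. simpl.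
    replace (fst c * s - snd c * 0)%R with (Re c * s)%R by (unfold Re; ring).
    replace (fst c * 0 + snd c * s)%R with (Im c * s)%R by (unfold Im; ring). ring. }
  split.
  - apply is_derive_ext with (fun s => exp (Re c * s) * cos (Im c * s))%R; [now intros s; rewrite ER|].
    replace (Re (c * Cexp (c * t))) with (Re c * Re (Cexp (c * t)) - Im c * Im (Cexp (c * t)))%R by reflexivity.
    rewrite ER, EI. auto_derive; [auto|]. ring.
  - apply is_derive_ext with (fun s => exp (Re c * s) * sin (Im c * s))%R; [now intros s; rewrite EI|].
    replace (Im (c * Cexp (c * t))) with (Re c * Im (Cexp (c * t)) + Im c * Re (Cexp (c * t)))%R by reflexivity.
    rewrite ER, EI. auto_derive; [auto|]. ring.
Qed.

Lemma circuit_Cexp (z0 : C) (t : R) : circuit z0 t = z0 * Cexp (2 * PI * Ci * t).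
Proof.
  unfold circuit, Cexp. simpl.
  replace ((2 * PI - 0 * 0) * 0 - (2 * 0 + 0 * PI) * 1)%R with 0%R by ring.
  replace ((2 * PI - 0 * 0) * 1 + (2 * 0 + 0 * PI) * 0)%R with (2 * PI)%R by ring.
  replace (0 * t - 2 * PI * 0)%R with 0%R by ring.
  replace (0 * 0 + 2 * PI * t)%R with (2 * PI * t)%R by ring.
  rewrite exp_0. apply C_eq; unfold Re, Im; simpl; ring.
Qed.

Definition dcircuit (z0 : C) (t : R) : C := 2 * PI * Ci * circuit z0 t.

Lemma rderiv_circuit (z0 : C) (t : R) : rderiv (circuit z0) t (dcircuit z0 t).
Proof.
  unfold dcircuit. rewrite circuit_Cexp.
  replace (2 * PI * Ci * (z0 * Cexp (2 * PI * Ci * t))) with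
    (z0 * (2 * PI * Ci * Cexp (2 * PI * Ci * t))) by ring.
  apply rderiv_ext with (fun s => z0 * Cexp (2 * PI * Ci * s)).
  - intros s. now rewrite circuit_Cexp.
  - apply rderiv_scal, rderiv_Cexp.
Qed.

Lemma Cmod_circuit (z0 : C) (t : R) : Cmod (circuit z0 t) = Cmod z0.
Proof.
  rewrite circuit_Cexp, Cmod_mult, Cmod_Cexp.
  replace (Re (2 * PI * Ci * t)) with 0%R by (simpl; ring). rewrite exp_0. ring.
Qed.

Lemma circuit_0 (z0 : C) : circuit z0 0 = z0.
Proof. rewrite circuit_Cexp. replace (2 * PI * Ci * 0) with (RtoC 0) by ring. rewrite Cexp_0. ring. Qed.

Lemma circuit_1 (z0 : C) : circuit z0 1 = z0.
Proof. unfold circuit. rewrite Rmult_1_r, cos_2PI, sin_2PI. apply C_eq; unfold Re, Im; simpl; ring. Qed.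

Lemma circuit_neq_0 (z0 : C) (t : R) : z0 <> 0 -> circuit z0 t <> 0.
Proof. intros H. rewrite circuit_Cexp. apply Cmult_neq_0; [auto|apply Cexp_neq_0]. Qed.

(** Supplies the points different from the centre that [analytic_local] asks for. The rotation angle
    2 pi (t - s) lies in (0, pi), where the sine is positive. *)
Lemma circuit_locally_injective (z0 : C) (s t : R) :
  z0 <> 0 -> (0 < t - s < 1 / 2)%R -> circuit z0 s <> circuit z0 t.
Proof.
  intros Hz Hst E. rewrite !circuit_Cexp in E.
  assert (E1 : Cexp (2 * PI * Ci * s) = Cexp (2 * PI * Ci * t)).
  { replace (Cexp (2 * PI * Ci * s)) with (/ z0 * (z0 * Cexp (2 * PI * Ci * s))) by (now field).
    rewrite E. now field. }
  replace (2 * PI * Ci * t) with (2 * PI * Ci * (t - s) + 2 * PI * Ci * s) in E1 by ring.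
  rewrite Cexp_plus in E1.
  assert (E2 : Cexp (2 * PI * Ci * (t - s)) = 1).
  { replace (Cexp (2 * PI * Ci * (t - s))) with
     (Cexp (2 * PI * Ci * (t - s)) * Cexp (2 * PI * Ci * s) * / Cexp (2 * PI * Ci * s))
      by (field; apply Cexp_neq_0). rewrite <- E1. apply Cinv_r, Cexp_neq_0. }
  rewrite <- RtoC_minus in E2. pose proof (circuit_Cexp 1 (t - s)) as E3.
  rewrite E2 in E3. unfold circuit in E3. apply (f_equal Im) in E3. simpl in E3.
  assert (0 < sin (2 * PI * (t - s)))%R.
  { generalize PI_RGT_0. intros. apply sin_gt_0; nra. }
  lra.
Qed.

Lemma circuit_continuous (z0 : C) (t eps : R) :
  (0 < eps)%R -> exists d, (0 < d)%R /\
  forall s, (Rabs (s - t) < d)%R -> (Cmod (circuit z0 s - circuit z0 t) < eps)%R.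
Proof.
  intros Heps. destruct (proj1 (rderiv_eps _ _ _) (rderiv_circuit z0 t) 1%R Rlt_0_1) as [d [Hd H]].
  set (L := (Cmod (dcircuit z0 t) + 1)%R).
  assert (HL : (0 < L)%R) by (unfold L; generalize (Cmod_ge_0 (dcircuit z0 t)); lra).
  exists (Rmin d (eps / L)). split; [apply Rmin_pos; auto; now apply Rdiv_lt_0_compat|].
  intros s Hs. specialize (H (s - t)%R (Rlt_Rmin_l _ _ _ Hs)).
  apply Rlt_Rmin_r in Hs.
  replace (t + (s - t))%R with s in H by ring.
  generalize (Cmod_triangle_rev (circuit z0 s - circuit z0 t) ((s - t)%R * dcircuit z0 t)).
  rewrite Cmod_mult, Cmod_R. intros H1.
  apply (Rmult_lt_compat_r L) in Hs; [|auto].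
  replace (eps / L * L)%R with eps in Hs by (field; lra). unfold L in Hs. lra.
Qed.

(** * The equation along a curve as a first-order system *)

Definition ode_second (lambda mu n z x y : C) : C :=
  - ((n * z + mu * (1 - z ^ 2)) * y + (lambda - mu * n * z) * x) / z ^ 2.

Lemma ode_solved (lambda mu n z x y u : C) :
  z <> 0 -> ode lambda mu n z x y u = 0 -> u = ode_second lambda mu n z x y.
Proof.
  intros Hz H. unfold ode_second.
  replace u with ((ode lambda mu n z x y u - ((n * z + mu * (1 - z ^ 2)) * y + (lambda - mu * n * z) * x)) / z ^ 2).
  - rewrite H. field. auto.
  - unfold ode. field. auto.
Qed.

(** The system satisfied by x = E(g) and y = E'(g), with [dg] standing for the velocity of [g]. It
    makes sense for functions of t alone, without a function E defined near the curve. *)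
Definition curve_solution (lambda mu n : C) (g dg : R -> C) (x y : R -> C) (t : R) : Prop :=
  rderiv x t (dg t * y t) /\ rderiv y t (dg t * ode_second lambda mu n (g t) (x t) (y t)).

Lemma ode_second_minus (lambda mu n z x1 y1 x2 y2 : C) : z <> 0 ->
  ode_second lambda mu n z x1 y1 - ode_second lambda mu n z x2 y2 = ode_second lambda mu n z (x1 - x2) (y1 - y2).
Proof. intros Hz. unfold ode_second. field. auto. Qed.

Lemma ode_second_bound (lambda mu n : C) (m M : R) :
  (0 < m)%R -> exists K : R, (0 <= K)%R /\ forall z x y : C, (m <= Cmod z <= M)%R ->
    (Cmod (ode_second lambda mu n z x y) <= K * (Cmod x + Cmod y))%R.
Proof.
  intros Hm.
  set (L := (Cmod n * M + Cmod mu * (1 + M ^ 2) + (Cmod lambda + Cmod (mu * n) * M))%R).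
  assert (H1 := Cmod_ge_0 n). assert (H2 := Cmod_ge_0 mu). assert (H3 := Cmod_ge_0 lambda).
  assert (H4 := Cmod_ge_0 (mu * n)).
  destruct (Rle_or_lt 0 M) as [HM|HM].
  2:{ exists 0%R. split; [lra|]. intros z x y Hz. generalize (Cmod_ge_0 z). lra. }
  assert (P1 : (0 <= Cmod n * M)%R) by now apply Rmult_le_pos.
  assert (P2 : (0 <= Cmod mu * (1 + M ^ 2))%R) by (apply Rmult_le_pos; [auto|generalize (pow2_ge_0 M); lra]).
  assert (P3 : (0 <= Cmod (mu * n) * M)%R) by now apply Rmult_le_pos.
  assert (HL : (0 <= L)%R) by (unfold L; lra).
  exists (L / m ^ 2)%R.
  assert (Hm2 : (0 < m ^ 2)%R) by now apply pow_lt.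
  split; [now apply Rdiv_le_0_compat|].
  intros z x y Hz.
  assert (Hz0 : z <> 0) by (intros ->; rewrite Cmod_0 in Hz; lra).
  unfold ode_second. rewrite Cmod_div by (now apply Cpow_nz). rewrite Cmod_opp, Cmod_pow.
  assert (Hz2 : (m ^ 2 <= Cmod z ^ 2)%R) by (apply pow_incr; lra).
  assert (Hz3 : (Cmod z ^ 2 <= M ^ 2)%R) by (apply pow_incr; lra).
  assert (Hx := Cmod_ge_0 x). assert (Hy := Cmod_ge_0 y).
  assert (B : (Cmod ((n * z + mu * (1 - z ^ 2)) * y + (lambda - mu * n * z) * x) <= L * (Cmod x + Cmod y))%R).
  { assert (B1 : (Cmod (n * z + mu * (1 - z ^ 2)) <= Cmod n * M + Cmod mu * (1 + M ^ 2))%R).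
    { eapply Rle_trans; [apply Cmod_triangle|]. rewrite !Cmod_mult.
      apply Rplus_le_compat; apply Rmult_le_compat_l; auto; [lra|].
      eapply Rle_trans; [apply Cmod_triangle|]. rewrite Cmod_opp, Cmod_pow, Cmod_1. lra. }
    assert (B2 : (Cmod (lambda - mu * n * z) <= Cmod lambda + Cmod (mu * n) * M)%R).
    { eapply Rle_trans; [apply Cmod_triangle|]. rewrite Cmod_opp, (Cmod_mult _ z).
      apply Rplus_le_compat_l. apply Rmult_le_compat_l; auto. lra. }
    eapply Rle_trans; [apply Cmod_triangle|]. rewrite !(Cmod_mult _ x), !(Cmod_mult _ y).
    apply (Rmult_le_compat_r _ _ _ Hy) in B1. apply (Rmult_le_compat_r _ _ _ Hx) in B2.
    unfold L. nra. }
  apply (Rmult_le_reg_r (Cmod z ^ 2)); [lra|].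
  unfold Rdiv at 1. rewrite Rmult_assoc, Rinv_l by lra. rewrite Rmult_1_r.
  eapply Rle_trans; [exact B|].
  replace (L / m ^ 2 * (Cmod x + Cmod y) * Cmod z ^ 2)%R
    with (L * (Cmod x + Cmod y) * (Cmod z ^ 2 / m ^ 2))%R by (field; lra).
  assert (1 <= Cmod z ^ 2 / m ^ 2)%R.
  { apply (Rmult_le_reg_r (m ^ 2)); [auto|]. unfold Rdiv. rewrite Rmult_assoc, Rinv_l by lra. lra. }
  assert (0 <= L * (Cmod x + Cmod y))%R by (apply Rmult_le_pos; lra). nra.
Qed.

(** On a curve that stays in an annulus about the singular point 0 the coefficients are bounded, so
    the difference of two solutions falls under [linear_system_unique]. *)
Lemma curve_solution_unique (lambda mu n : C) (g dg x1 y1 x2 y2 : R -> C) (m M M' : R) :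
  (0 < m)%R ->
  (forall t, (0 <= t <= 1)%R -> (m <= Cmod (g t) <= M)%R /\ (Cmod (dg t) <= M')%R) ->
  (forall t, (0 <= t <= 1)%R -> curve_solution lambda mu n g dg x1 y1 t) ->
  (forall t, (0 <= t <= 1)%R -> curve_solution lambda mu n g dg x2 y2 t) ->
  x1 0%R = x2 0%R -> y1 0%R = y2 0%R ->
  forall t, (0 <= t <= 1)%R -> x1 t = x2 t /\ y1 t = y2 t.
Proof.
  intros Hm Hg S1 S2 E1 E2 t Ht.
  destruct (ode_second_bound lambda mu n m M Hm) as [K [HK B]].
  assert (HM' : (0 <= M')%R) by (destruct (Hg t Ht) as [_ H]; generalize (Cmod_ge_0 (dg t)); lra).
  assert (Z : x1 t - x2 t = 0 /\ y1 t - y2 t = 0).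
  { apply (linear_system_unique (fun t => x1 t - x2 t) (fun t => y1 t - y2 t)
      (fun t => dg t * (y1 t - y2 t)) (fun t => dg t * ode_second lambda mu n (g t) (x1 t - x2 t) (y1 t - y2 t))
      (M' * (K + 1))%R); auto.
    - intros s Hs. destruct (S1 s Hs) as [A1 _], (S2 s Hs) as [A2 _].
      replace (dg s * (y1 s - y2 s)) with (dg s * y1 s - dg s * y2 s) by ring.
      now apply rderiv_minus.
    - intros s Hs. destruct (S1 s Hs) as [_ A1], (S2 s Hs) as [_ A2].
      rewrite <- ode_second_minus.
      + replace (dg s * (ode_second lambda mu n (g s) (x1 s) (y1 s) - ode_second lambda mu n (g s) (x2 s) (y2 s)))
         with (dg s * ode_second lambda mu n (g s) (x1 s) (y1 s) - dg s * ode_second lambda mu n (g s) (x2 s) (y2 s)) by ring.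
        now apply rderiv_minus.
      + intros F. destruct (Hg s Hs) as [H _]. rewrite F, Cmod_0 in H. lra.
    - intros s Hs. destruct (Hg s Hs) as [_ H]. rewrite Cmod_mult.
      generalize (Cmod_ge_0 (x1 s - x2 s)) (Cmod_ge_0 (y1 s - y2 s)) (Cmod_ge_0 (dg s)). intros P1 P2 P3.
      apply Rle_trans with (M' * Cmod (y1 s - y2 s))%R; [now apply Rmult_le_compat_r|].
      rewrite Rmult_assoc. apply Rmult_le_compat_l; [auto|]. nra.
    - intros s Hs. destruct (Hg s Hs) as [Hgs H]. rewrite Cmod_mult.
      specialize (B (g s) (x1 s - x2 s) (y1 s - y2 s) Hgs).
      generalize (Cmod_ge_0 (x1 s - x2 s)) (Cmod_ge_0 (y1 s - y2 s)) (Cmod_ge_0 (dg s))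
        (Cmod_ge_0 (ode_second lambda mu n (g s) (x1 s - x2 s) (y1 s - y2 s))). intros P1 P2 P3 P4.
      rewrite Rmult_assoc. apply Rmult_le_compat; auto. nra.
    - rewrite E1. ring.
    - rewrite E2. ring. }
  destruct Z as [Z1 Z2]. split; now apply Ceq_minus.
Qed.

Lemma local_solution_curve (lambda mu n : C) (f : C -> C) (w : C) (rho : R) (g dg : R -> C) (t : R) :
  local_solution lambda mu n f w rho -> (Cmod (g t - w) < rho)%R -> g t <> 0 ->
  rderiv g t (dg t) ->
  curve_solution lambda mu n g dg (fun s => f (g s)) (fun s => C_derive f (g s)) t.
Proof.
  intros S Hg Hn Hd. destruct (S (g t) Hg) as [D1 [D2 D3]]. split.
  - now apply rderiv_comp.
  - apply ode_solved in D3; [|auto]. rewrite <- D3. now apply rderiv_comp.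
Qed.

(** Uniqueness along the segment from w to z, which avoids 0 because |z - w| < |w| / 2. *)
Lemma local_solution_unique (lambda mu n : C) (f g : C -> C) (w : C) (rho : R) :
  w <> 0 -> (0 < rho)%R ->
  local_solution lambda mu n f w rho -> local_solution lambda mu n g w rho ->
  f w = g w -> C_derive f w = C_derive g w -> germ_eq w f g.
Proof.
  intros Hw Hrho Sf Sg E0 E1. apply locally_Cmod.
  assert (Hwm : (0 < Cmod w)%R) by now apply Cmod_gt_0.
  exists (Rmin rho (Cmod w / 2)). split; [apply Rmin_pos; lra|].
  intros z Hz.
  assert (Hz1 : (Cmod (z - w) < rho)%R) by (exact (Rlt_Rmin_l _ _ _ Hz)).
  assert (Hz2 : (Cmod (z - w) < Cmod w / 2)%R) by (exact (Rlt_Rmin_r _ _ _ Hz)).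
  set (c := fun t : R => w + t * (z - w)).
  assert (Hc : forall t, rderiv c t (z - w)).
  { intros t. apply rderiv_eq with (0 + (1 * (z - w) + t * 0)); [|ring].
    apply rderiv_plus; [apply rderiv_const|].
    apply (rderiv_mult (fun s => RtoC s) (fun _ => z - w)); [|apply rderiv_const].
    split; simpl; [apply (is_derive_id (K := R_AbsRing))|apply (is_derive_const (K := R_AbsRing) (V := R_NormedModule))]. }
  assert (Hcw : forall t, (0 <= t <= 1)%R -> (Cmod (c t - w) <= Cmod (z - w))%R).
  { intros t Ht. unfold c. replace (w + t * (z - w) - w) with (t * (z - w)) by ring.
    rewrite Cmod_mult, Cmod_R, Rabs_pos_eq by lra. generalize (Cmod_ge_0 (z - w)). nra. }
  assert (Hcn : forall t, (0 <= t <= 1)%R -> (Cmod w / 2 <= Cmod (c t) <= 2 * Cmod w)%R).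
  { intros t Ht. specialize (Hcw t Ht).
    generalize (Cmod_triangle_rev w (c t)) (Cmod_triangle_rev (c t) w).
    rewrite (Cmod_minus_sym w). lra. }
  assert (Hn0 : forall t, (0 <= t <= 1)%R -> c t <> 0).
  { intros t Ht F. specialize (Hcn t Ht). rewrite F, Cmod_0 in Hcn. lra. }
  destruct (curve_solution_unique lambda mu n c (fun _ => z - w)
    (fun s => f (c s)) (fun s => C_derive f (c s)) (fun s => g (c s)) (fun s => C_derive g (c s))
    (Cmod w / 2) (2 * Cmod w) (Cmod (z - w))) with (t := 1%R) as [H _]; try lra.
  - intros t Ht. split; [now apply Hcn|lra].
  - intros t Ht. apply (local_solution_curve _ _ _ f w rho); auto. generalize (Hcw t Ht); lra.
  - intros t Ht. apply (local_solution_curve _ _ _ g w rho); auto. generalize (Hcw t Ht); lra.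
  - unfold c. replace (w + 0 * (z - w)) with w by ring. exact E0.
  - unfold c. replace (w + 0 * (z - w)) with w by ring. exact E1.
  - unfold c in H. replace (w + 1 * (z - w)) with z in H by ring. exact H.
Qed.

Lemma local_solution_sub (lambda mu n : C) (f : C -> C) (w w' : C) (rho rho' : R) :
  local_solution lambda mu n f w rho -> (rho' + Cmod (w' - w) <= rho)%R ->
  local_solution lambda mu n f w' rho'.
Proof.
  intros S H z Hz. apply S. replace (z - w) with ((z - w') + (w' - w)) by ring.
  eapply Rle_lt_trans; [apply Cmod_triangle|]. lra.
Qed.

Lemma local_solution_ball_eq (lambda mu n : C) (f g : C -> C) (w : C) (d : R) :
  local_solution lambda mu n f w d ->
  (forall z, (Cmod (z - w) < d)%R -> f z = g z) -> local_solution lambda mu n g w d.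
Proof.
  intros S E z Hz.
  destruct (ball_derive2 g f _ _ w d E (fun y Hy => conj (proj1 (S y Hy)) (proj1 (proj2 (S y Hy)))) z Hz)
    as [D1 [D2 [D3 D4]]].
  destruct (S z Hz) as [_ [_ S3]].
  rewrite D4, D2, <- (E z Hz). auto.
Qed.

Lemma cderiv_zero (z : C) : cderiv (fun _ => 0) z 0.
Proof.
  intros eps Heps. exists 1%R. split; [lra|]. intros w _.
  replace (0 - 0 - (w - z) * 0) with (RtoC 0) by ring. rewrite Cmod_0.
  apply Rmult_le_pos; [lra|apply Cmod_ge_0].
Qed.

Lemma cderiv_scal (c : C) (f : C -> C) (z l : C) :
  cderiv f z l -> cderiv (fun w => c * f w) z (c * l).
Proof.
  intros H eps Heps. assert (Hc := Cmod_ge_0 c).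
  destruct (H (eps / (Cmod c + 1))%R) as [e [He Hy]]; [apply Rdiv_lt_0_compat; lra|].
  exists e. split; [auto|]. intros y Hyz. specialize (Hy y Hyz).
  replace (c * f y - c * f z - (y - z) * (c * l)) with (c * (f y - f z - (y - z) * l)) by ring.
  rewrite Cmod_mult. apply Rle_trans with ((Cmod c + 1) * (eps / (Cmod c + 1) * Cmod (y - z)))%R.
  - apply Rmult_le_compat; auto; [apply Cmod_ge_0|lra].
  - right. field. lra.
Qed.

Lemma local_solution_scal (lambda mu n c : C) (f : C -> C) (w : C) (d : R) :
  local_solution lambda mu n f w d -> local_solution lambda mu n (fun z => c * f z) w d.
Proof.
  intros S z Hz.
  destruct (ball_derive2 (fun z => c * f z) (fun z => c * f z) (fun z => c * C_derive f z)
    (fun z => c * C_derive (C_derive f) z) w d (fun _ _ => eq_refl)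
    (fun y Hy => conj (cderiv_scal c _ _ _ (proj1 (S y Hy))) (cderiv_scal c _ _ _ (proj1 (proj2 (S y Hy))))) z Hz)
    as [D1 [D2 [D3 D4]]].
  rewrite D4, D2. split; [auto|]. split; [auto|].
  transitivity (c * ode lambda mu n z (f z) (C_derive f z) (C_derive (C_derive f) z)).
  - unfold ode. ring.
  - rewrite (proj2 (proj2 (S z Hz))). ring.
Qed.

(* [x] and [y] are the values of the continued solution and of its derivative along the circuit. *)
Definition floquet (lambda mu n z0 chi : C) : Prop :=
  exists x y : R -> C,
    (forall t, (0 <= t <= 1)%R -> curve_solution lambda mu n (circuit z0) (dcircuit z0) x y t) /\
    x 1%R = chi * x 0%R /\ y 1%R = chi * y 0%R /\ ~ (x 0%R = 0 /\ y 0%R = 0).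

(** * Monodromy and Floquet solutions *)

Lemma locally_R (t : R) (P : R -> Prop) :
  locally t P <-> exists d : R, (0 < d)%R /\ forall s, (Rabs (s - t) < d)%R -> P s.
Proof.
  split.
  - intros [e He]. exists e. split; [apply cond_pos|]. exact He.
  - intros [d [Hd H]]. exists (mkposreal d Hd). exact H.
Qed.

(** Real induction: the supremum of the initial segments on which [P] holds satisfies [P] by the
    third hypothesis, and by the second it cannot be less than 1. *)
Lemma unit_interval_induction (P : R -> Prop) :
  P 0%R ->
  (forall t, (0 <= t < 1)%R -> P t ->
     exists d, (0 < d)%R /\ forall s, (t < s <= 1)%R -> (s < t + d)%R -> P s) ->
  (forall t, (0 < t <= 1)%R -> (forall s, (0 <= s < t)%R -> P s) -> P t) ->
  forall t, (0 <= t <= 1)%R -> P t.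
Proof.
  intros P0 Ps Pl.
  set (S := fun t => (0 <= t <= 1)%R /\ forall s, (0 <= s <= t)%R -> P s).
  assert (S0 : S 0%R).
  { split; [lra|]. intros s Hs. replace s with 0%R by lra. exact P0. }
  destruct (completeness S) as [m [Hub Hlub]].
  { exists 1%R. intros t [Ht _]. lra. }
  { exists 0%R. exact S0. }
  assert (Hm : (0 <= m <= 1)%R).
  { split; [now apply Hub|]. apply Hlub. intros t [Ht _]. lra. }
  assert (Hlt : forall s, (0 <= s < m)%R -> P s).
  { intros s Hs. destruct (Classical_Prop.classic (P s)) as [H|H]; [auto|exfalso].
    assert (m <= s)%R; [|lra]. apply Hlub. intros t [Ht Hst].
    apply Rnot_lt_le. intros Hts. apply H, Hst. lra. }
  assert (Pm : P m).
  { destruct (Rle_lt_or_eq_dec 0 m) as [Hm0|<-]; [lra| |auto]. apply Pl; [lra|auto]. }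
  assert (m = 1%R).
  { destruct (Rle_lt_or_eq_dec m 1) as [Hm1|]; [lra| |auto]. exfalso.
    destruct (Ps m) as [d [Hd H]]; [lra|auto|].
    assert (S (Rmin 1 (m + d / 2))).
    { split.
      - split; [apply Rmin_glb; lra|apply Rmin_l].
      - intros s [Hs1 Hs2].
        assert (s <= 1)%R by (eapply Rle_trans; [exact Hs2|apply Rmin_l]).
        assert (s <= m + d / 2)%R by (eapply Rle_trans; [exact Hs2|apply Rmin_r]).
        destruct (Rlt_or_le s m); [apply Hlt; lra|].
        destruct (Req_dec s m) as [->|]; [auto|]. apply H; lra. }
    apply Hub in H0. assert (m < Rmin 1 (m + d / 2))%R by (apply Rmin_glb_lt; lra). lra. }
  intros t Ht. destruct (Req_dec t 1) as [->|]; [now subst m|]. apply Hlt. lra.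
Qed.

Lemma local_solution_vanishes (lambda mu n : C) (f : C -> C) (w : C) (rho : R) :
  w <> 0 -> (0 < rho)%R -> local_solution lambda mu n f w rho ->
  f w = 0 -> C_derive f w = 0 -> germ_eq w f (fun _ => 0).
Proof.
  intros Hw Hrho S F0 F1.
  (* The zero solution is taken in the form 0 * f, so that [local_solution_scal] applies to it. *)
  assert (E : germ_eq w f (fun z => 0 * f z)).
  { assert (D : C_derive (fun z => 0 * f z) w = 0).
    { apply C_derive_cderiv. apply cderiv_ext_loc with (fun _ => 0); [|apply cderiv_zero].
      apply filter_forall. intros; ring. }
    apply (local_solution_unique lambda mu n _ _ w rho); auto.
    - now apply local_solution_scal.
    - rewrite F0. ring.
    - now rewrite F1. }
  unfold germ_eq in *. revert E. apply filter_imp. intros z ->. ring.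
Qed.

Lemma germ_eq_refl (w : C) (f : C -> C) : germ_eq w f f.
Proof. unfold germ_eq. now apply filter_forall. Qed.

(** A continuation is a family of analytic germs of which only the first is known to solve the
    equation. Real induction spreads the equation along the circuit; then the values and derivatives
    of the germs at the points of the circle form the Floquet solution. *)
Lemma monodromy_floquet (lambda mu n z0 chi : C) :
  z0 <> 0 -> monodromy_eigenvalue lambda mu n z0 chi -> floquet lambda mu n z0 chi.
Proof.
  intros Hz0 [E [[Ea Eo] [En [F [Fa [Fc [F0 F1]]]]]]].
  assert (Fo : forall t, (0 <= t <= 1)%R -> exists d, (0 < d)%R /\ local_solution lambda mu n (F t) (circuit z0 t) d).
  { apply unit_interval_induction.
    - destruct (analytic_local lambda mu n E z0 Ea) as [r [Hr [D _]]].
      apply locally_Cmod in Eo. destruct Eo as [r2 [Hr2 Eo]].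
      rewrite circuit_0. unfold germ_eq in F0. rewrite circuit_0 in F0.
      apply locally_Cmod in F0. destruct F0 as [r3 [Hr3 F0]].
      set (d := Rmin (Rmin r r2) r3).
      assert (Ld : (0 < d /\ d <= r /\ d <= r2 /\ d <= r3)%R) by (unfold d, Rmin; repeat destruct Rle_dec; lra).
      exists d. split; [lra|].
      apply local_solution_ball_eq with E.
      + intros z Hz. destruct (D z) as [D1 D2]; [lra|]. repeat split; auto. apply Eo. lra.
      + intros z Hz. symmetry. apply F0. lra.
    - intros t Ht [d [Hd S]].
      specialize (Fc t ltac:(lra)). apply locally_R in Fc. destruct Fc as [e [He Fc]].
      destruct (circuit_continuous z0 t (d / 2) ltac:(lra)) as [e2 [He2 Hc]].
      exists (Rmin e e2). split; [now apply Rmin_pos|]. intros s Hs Hsd.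
      assert (Hs1 : (s < t + e)%R) by (generalize (Rmin_l e e2); lra).
      assert (Hs2 : (s < t + e2)%R) by (generalize (Rmin_r e e2); lra).
      assert (G : germ_eq (circuit z0 s) (F s) (F t)).
      { apply Fc; [|lra]. rewrite Rabs_pos_eq; lra. }
      assert (Hcs : (Cmod (circuit z0 s - circuit z0 t) < d / 2)%R).
      { apply Hc. rewrite Rabs_pos_eq; lra. }
      apply locally_Cmod in G. destruct G as [d2 [Hd2 G]].
      exists (Rmin d2 (d / 2)). split; [apply Rmin_pos; lra|].
      apply local_solution_ball_eq with (F t).
      + apply local_solution_sub with (1 := S). generalize (Rmin_r d2 (d / 2)). lra.
      + intros z Hz. symmetry. apply G. exact (Rlt_Rmin_l _ _ _ Hz).
    (* Limit step: [F t] coincides with [F s] near earlier points of the circuit, so it satisfies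
       the equation at points accumulating at [circuit z0 t]. *)
    - intros t Ht Hs.
      destruct (analytic_local lambda mu n (F t) (circuit z0 t) (Fa t ltac:(lra))) as [r [Hr [D Z]]].
      exists r. split; [auto|]. intros z Hz. destruct (D z Hz) as [D1 D2]. repeat split; auto.
      revert z Hz D1 D2. intros z Hz _ _. revert z Hz. apply Z.
      intros eps Heps.
      specialize (Fc t ltac:(lra)). apply locally_R in Fc. destruct Fc as [e [He Fc]].
      destruct (circuit_continuous z0 t (Rmin eps r)) as [e2 [He2 Hc]]; [now apply Rmin_pos|].
      set (m := Rmin (Rmin e e2) (Rmin t (1 / 2))).
      assert (Hm : (0 < m /\ m <= e /\ m <= e2 /\ m <= t /\ m <= 1 / 2)%R)
        by (unfold m, Rmin; repeat destruct Rle_dec; lra).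
      set (s := (t - m / 2)%R).
      assert (Hst : Rabs (s - t) = (m / 2)%R).
      { unfold s. rewrite Rabs_left; lra. }
      exists (circuit z0 s).
      specialize (Hc s ltac:(lra)).
      assert (Hc1 : (Cmod (circuit z0 s - circuit z0 t) < eps)%R) by (exact (Rlt_Rmin_l _ _ _ Hc)).
      assert (Hc2 : (Cmod (circuit z0 s - circuit z0 t) < r)%R) by (exact (Rlt_Rmin_r _ _ _ Hc)).
      split; [apply circuit_locally_injective; auto; unfold s; lra|].
      split; [auto|].
      assert (G : germ_eq (circuit z0 s) (F s) (F t)).
      { apply Fc; unfold s in *; lra. }
      destruct (Hs s) as [d [Hd S]]; [unfold s; lra|].
      apply locally_Cmod in G. destruct G as [d2 [Hd2 G]].
      set (q := Rmin d d2).
      assert (Sq : local_solution lambda mu n (F t) (circuit z0 s) q).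
      { apply local_solution_ball_eq with (F s).
        - apply local_solution_sub with (1 := S).
          rewrite Cmod_diag.
          generalize (Rmin_l d d2). unfold q. lra.
        - intros z Hz. apply G. exact (Rlt_Rmin_r _ _ _ Hz). }
      apply Sq. rewrite Cmod_diag.
      now apply Rmin_pos. }
  (* Outside [0,1] the family is frozen at its endpoints, so that two-sided derivatives exist there. *)
  set (cl := fun s : R => Rmax 0 (Rmin 1 s)).
  assert (Hcl : forall s, (0 <= cl s <= 1)%R).
  { intros s. unfold cl. split; [apply Rmax_l|]. apply Rmax_lub; [lra|apply Rmin_l]. }
  assert (Hcl2 : forall s, (0 <= s <= 1)%R -> cl s = s).
  { intros s Hs. unfold cl. rewrite Rmin_right, Rmax_right; lra. }
  set (x := fun s => F (cl s) (circuit z0 s)).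
  set (y := fun s => C_derive (F (cl s)) (circuit z0 s)).
  exists x, y.
  assert (X0 : x 0%R = E z0 /\ y 0%R = C_derive E z0).
  { unfold x, y. rewrite Hcl2 by lra. unfold germ_eq in F0. rewrite circuit_0 in *.
    destruct (analytic_local lambda mu n E z0 Ea) as [r [Hr [D _]]].
    split; [now apply locally_singleton in F0|].
    apply C_derive_cderiv. apply cderiv_ext_loc with E.
    - revert F0. apply filter_imp. intros; now symmetry.
    - apply D. now rewrite Cmod_diag. }
  assert (X1 : x 1%R = chi * E z0 /\ y 1%R = chi * C_derive E z0).
  { unfold x, y. rewrite Hcl2 by lra. unfold germ_eq in F1. rewrite circuit_1 in *.
    destruct (analytic_local lambda mu n E z0 Ea) as [r [Hr [D _]]].
    split; [now apply locally_singleton in F1|].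
    apply C_derive_cderiv. apply cderiv_ext_loc with (fun z => chi * E z).
    - revert F1. apply filter_imp. intros; now symmetry.
    - apply cderiv_scal. apply D. now rewrite Cmod_diag. }
  destruct X0 as [X0 Y0], X1 as [X1 Y1].
  split; [|split; [now rewrite X1, X0|split; [now rewrite Y1, Y0|]]].
  - intros t Ht. destruct (Fo t Ht) as [d [Hd S]].
    assert (L : locally t (fun s => F t (circuit z0 s) = x s /\ C_derive (F t) (circuit z0 s) = y s)).
    { specialize (Fc t Ht). apply locally_R in Fc. destruct Fc as [e [He Fc]].
      destruct (circuit_continuous z0 t d Hd) as [e2 [He2 Hc]].
      assert (E3 : exists e3, (0 < e3)%R /\ (t < 1 -> e3 <= 1 - t)%R /\ (0 < t -> e3 <= t)%R).
      { destruct (Req_dec t 0); [exists 1%R; lra|]. destruct (Req_dec t 1); [exists 1%R; lra|].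
        exists (Rmin t (1 - t)). split; [apply Rmin_pos; lra|].
        split; intros; [apply Rmin_r|apply Rmin_l]. }
      destruct E3 as [e3 [He3 [E31 E30]]].
      apply locally_R. exists (Rmin (Rmin e e2) e3). split; [repeat apply Rmin_pos; auto|].
      intros s Hs.
      assert (Hs3 : (Rabs (s - t) < e3)%R) by (exact (Rlt_Rmin_r _ _ _ Hs)).
      apply Rlt_Rmin_l in Hs.
      assert (Hs1 : (Rabs (s - t) < e)%R) by (exact (Rlt_Rmin_l _ _ _ Hs)).
      assert (Hs2 : (Rabs (s - t) < e2)%R) by (exact (Rlt_Rmin_r _ _ _ Hs)).
      apply Rabs_def2 in Hs3.
      assert (G : germ_eq (circuit z0 s) (F (cl s)) (F t)).
      { destruct (Rle_dec 0 s) as [H0|H0]; [destruct (Rle_dec s 1) as [H1|H1]|].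
        - rewrite Hcl2 by lra. apply Fc; lra.
        - assert (Ec : cl s = 1%R) by (unfold cl; rewrite Rmin_left, Rmax_right; lra).
          rewrite Ec. destruct (Req_dec t 1) as [->|]; [now apply germ_eq_refl|lra].
        - assert (Ec : cl s = 0%R) by (unfold cl; rewrite Rmin_right, Rmax_left; lra).
          rewrite Ec. destruct (Req_dec t 0) as [->|]; [now apply germ_eq_refl|lra]. }
      unfold germ_eq in G.
      unfold x, y. split.
      - symmetry. now apply locally_singleton in G.
      - symmetry. apply C_derive_cderiv. apply cderiv_ext_loc with (F t).
        + revert G. apply filter_imp. intros; now symmetry.
        + apply S. now apply Hc. }
    destruct (local_solution_curve lambda mu n (F t) (circuit z0 t) d (circuit z0) (dcircuit z0) t) as [D1 D2]; auto.
    { now rewrite Cmod_diag. }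
    { now apply circuit_neq_0. }
    { apply rderiv_circuit. }
    pose proof (locally_singleton _ _ L) as [Lx Ly].
    split.
    + rewrite <- Ly. eapply rderiv_ext_loc; [|exact D1]. revert L. apply filter_imp. now intros s [H _].
    + rewrite <- Lx, <- Ly. eapply rderiv_ext_loc; [|exact D2]. revert L. apply filter_imp. now intros s [_ H].
  - intros [Z0 Z1]. apply En. rewrite X0 in Z0. rewrite Y0 in Z1.
    destruct (Fo 0%R ltac:(lra)) as [d [Hd S]]. rewrite circuit_0 in S.
    unfold germ_eq in F0. rewrite circuit_0 in F0.
    assert (G : germ_eq z0 (F 0%R) (fun _ => 0)).
    { apply (local_solution_vanishes lambda mu n _ _ d); auto.
      - rewrite <- Z0. now apply locally_singleton in F0.
      - destruct (analytic_local lambda mu n E z0 Ea) as [r [Hr [D _]]].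
        rewrite <- Z1. apply C_derive_cderiv. apply cderiv_ext_loc with E.
        + revert F0. apply filter_imp. intros; now symmetry.
        + apply D. now rewrite Cmod_diag. }
    unfold germ_eq in *. generalize (filter_and _ _ F0 G). apply filter_imp.
    intros z [H1 H2]. now rewrite <- H1.
Qed.

(** At each point of the circuit the power series solution with initial data (x t, y t) serves as
    the germ. Germs at neighbouring points agree because on the arc between them both have the
    values and derivatives of the same curve solution. *)
Lemma floquet_monodromy (lambda mu n z0 chi : C) :
  z0 <> 0 -> floquet lambda mu n z0 chi -> monodromy_eigenvalue lambda mu n z0 chi.
Proof.
  intros Hz0 [x [y [S [X1 [Y1 XY]]]]].
  set (F := fun t => initial_solution lambda mu n (circuit z0 t) (x t) (y t)).
  assert (HF : forall t, analytic_at (F t) (circuit z0 t) /\ F t (circuit z0 t) = x t /\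
     C_derive (F t) (circuit z0 t) = y t /\
     exists rho, (0 < rho)%R /\ local_solution lambda mu n (F t) (circuit z0 t) rho).
  { intros t. exact (initial_solution_spec lambda mu n _ (x t) (y t) (circuit_neq_0 z0 t Hz0)). }
  assert (Hz0m : (0 < Cmod z0)%R) by now apply Cmod_gt_0.
  exists (F 0%R).
  destruct (HF 0%R) as [A0 [B0 [C0 [r0 [Hr0 S0]]]]]. rewrite circuit_0 in *.
  split; [|split].
  - split; [exact A0|]. apply locally_Cmod. exists r0. split; [auto|]. intros z Hz. now apply S0.
  - intros G. apply XY.
    assert (D : C_derive (F 0%R) z0 = 0).
    { apply C_derive_cderiv. apply cderiv_ext_loc with (fun _ => 0).
      - unfold germ_eq in G. revert G. apply filter_imp. intros; now symmetry.
      - apply cderiv_zero. }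
    unfold germ_eq in G. apply locally_singleton in G. now rewrite <- B0, <- C0, D, G.
  - exists F. split; [|split; [|split]].
    + intros t Ht. apply HF.
    + intros t Ht. destruct (HF t) as [At [Bt [Ct [rt [Hrt St]]]]].
      destruct (circuit_continuous z0 t (rt / 2) ltac:(lra)) as [d [Hd Hc]].
      apply locally_R. exists d. split; [auto|]. intros s Hs Hs01.
      destruct (HF s) as [As [Bs [Cs [rs [Hrs Ss]]]]].
      (* The arc from t to s, reparametrised by [0,1] so that [curve_solution_unique] applies; s < t
         is allowed. *)
      set (g := fun u : R => circuit z0 (t + u * (s - t))%R).
      set (dg := fun u : R => (s - t)%R * dcircuit z0 (t + u * (s - t))%R).
      assert (Hg : forall u, rderiv g u (dg u)).
      { intros u. apply (rderiv_affine (circuit z0)). apply rderiv_circuit. }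
      assert (Hu : forall u, (0 <= u <= 1)%R -> (0 <= t + u * (s - t) <= 1)%R).
      { intros u Hu. nra. }
      assert (Hgd : forall u, (0 <= u <= 1)%R -> (Cmod (g u - circuit z0 t) < rt / 2)%R).
      { intros u Hu2. apply Hc. replace (t + u * (s - t) - t)%R with (u * (s - t))%R by ring.
        rewrite Rabs_mult, (Rabs_pos_eq u) by lra. generalize (Rabs_pos (s - t)). nra. }
      destruct (curve_solution_unique lambda mu n g dg
        (fun u => F t (g u)) (fun u => C_derive (F t) (g u))
        (fun u => x (t + u * (s - t))%R) (fun u => y (t + u * (s - t))%R)
        (Cmod z0) (Cmod z0) (Cmod (2 * PI * Ci) * Cmod z0)) with (t := 1%R) as [H1 H2]; auto; try lra.
      * intros u Hu2. unfold g. rewrite Cmod_circuit. split; [lra|].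
        unfold dg, dcircuit. set (c := 2 * PI * Ci).
        rewrite (Cmod_mult _ (c * _)), (Cmod_mult c), Cmod_circuit, Cmod_R.
        assert (Rabs (s - t) <= 1)%R by (unfold Rabs; destruct Rcase_abs; lra).
        assert (0 <= Cmod c * Cmod z0)%R by (apply Rmult_le_pos; apply Cmod_ge_0). nra.
      * intros u Hu2. apply (local_solution_curve _ _ _ _ _ _ _ _ _ St); auto.
        -- generalize (Hgd u Hu2). lra.
        -- now apply circuit_neq_0.
      * intros u Hu2. destruct (S _ (Hu u Hu2)) as [D1 D2]. unfold g, dg. split.
        -- rewrite <- Cmult_assoc. apply (rderiv_affine x). exact D1.
        -- rewrite <- Cmult_assoc. apply (rderiv_affine y). exact D2.
      * unfold g. rewrite Rmult_0_l, Rplus_0_r. exact Bt.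
      * unfold g. rewrite Rmult_0_l, Rplus_0_r. exact Ct.
      * unfold g in H1, H2. replace (t + 1 * (s - t))%R with s in H1, H2 by ring.
        apply (local_solution_unique lambda mu n _ _ _ (Rmin rs (rt / 2))).
        -- now apply circuit_neq_0.
        -- apply Rmin_pos; lra.
        -- apply local_solution_sub with (1 := Ss).
           rewrite Cmod_diag.
           generalize (Rmin_l rs (rt / 2)). lra.
        -- apply local_solution_sub with (1 := St).
           generalize (Rmin_r rs (rt / 2)) (Hc s Hs). lra.
        -- now rewrite Bs, H1.
        -- now rewrite Cs, H2.
    + rewrite circuit_0. apply germ_eq_refl.
    + destruct (HF 1%R) as [A1 [B1 [C1 [r1 [Hr1 S1]]]]]. rewrite circuit_1 in *.
      assert (Hm : (Cmod (z0 - z0) = 0)%R) by (replace (z0 - z0) with (RtoC 0) by ring; apply Cmod_0).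
      apply (local_solution_unique lambda mu n _ _ _ (Rmin r0 r1)); auto.
      * now apply Rmin_pos.
      * apply local_solution_sub with (1 := S1). rewrite Hm. generalize (Rmin_r r0 r1); lra.
      * apply local_solution_scal. apply local_solution_sub with (1 := S0). rewrite Hm. generalize (Rmin_l r0 r1); lra.
      * now rewrite B1, B0.
      * rewrite C1, Y1, <- C0. symmetry. apply C_derive_cderiv, cderiv_scal.
        apply S0. now rewrite Hm.
Qed.

(** * Fourier coefficients *)

(** Continuity is two-sided even at 0 and 1, as [rderiv] provides it. *)
Definition cont01 (f : R -> C) : Prop :=
  forall t, (0 <= t <= 1)%R -> continuous (fun s => Re (f s)) t /\ continuous (fun s => Im (f s)) t.

Lemma rderiv_cont01 (f df : R -> C) : (forall t, (0 <= t <= 1)%R -> rderiv f t (df t)) -> cont01 f.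
Proof.
  intros H t Ht. split.
  - eapply rderiv_continuous_Re, H, Ht.
  - eapply rderiv_continuous_Im, H, Ht.
Qed.

Lemma cont01_ext (f g : R -> C) : (forall t, f t = g t) -> cont01 f -> cont01 g.
Proof.
  intros E H t Ht. destruct (H t Ht) as [H1 H2]. split.
  - apply continuous_ext with (2 := H1). intros s. now rewrite E.
  - apply continuous_ext with (2 := H2). intros s. now rewrite E.
Qed.

Lemma cont01_plus (f g : R -> C) : cont01 f -> cont01 g -> cont01 (fun t => f t + g t).
Proof.
  intros Hf Hg t Ht. destruct (Hf t Ht), (Hg t Ht).
  split; now apply (continuous_plus (V := R_NormedModule)).
Qed.

Lemma cont01_mult (f g : R -> C) : cont01 f -> cont01 g -> cont01 (fun t => f t * g t).
Proof.
  intros Hf Hg t Ht. destruct (Hf t Ht) as [H1 H2], (Hg t Ht) as [H3 H4]. split.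
  - exact (continuous_minus (V := R_NormedModule) _ _ _ (continuous_mult (K := R_AbsRing) _ _ _ H1 H3) (continuous_mult (K := R_AbsRing) _ _ _ H2 H4)).
  - exact (continuous_plus (V := R_NormedModule) _ _ _ (continuous_mult (K := R_AbsRing) _ _ _ H1 H4) (continuous_mult (K := R_AbsRing) _ _ _ H2 H3)).
Qed.

Lemma cont01_const (c : C) : cont01 (fun _ => c).
Proof. intros t _. split; apply continuous_const. Qed.

Lemma cont01_Cexp (c : C) : cont01 (fun t => Cexp (c * t)).
Proof. apply rderiv_cont01 with (fun t => c * Cexp (c * t)). intros t _. apply rderiv_Cexp. Qed.

Definition CInt01 (f : R -> C) : C :=
  (RInt (fun t => Re (f t)) 0 1, RInt (fun t => Im (f t)) 0 1).

Lemma ex_RInt_01 (f : R -> R) : (forall t, (0 <= t <= 1)%R -> continuous f t) -> ex_RInt f 0 1.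
Proof.
  intros H. apply (ex_RInt_continuous (V := R_CompleteNormedModule)). intros t Ht. apply H.
  rewrite Rmin_left, Rmax_right in Ht; lra.
Qed.

Lemma cont01_ex_RInt (f : R -> C) : cont01 f ->
  ex_RInt (fun t => Re (f t)) 0 1 /\ ex_RInt (fun t => Im (f t)) 0 1.
Proof. intros H. split; apply ex_RInt_01; intros t Ht; [exact (proj1 (H t Ht))|exact (proj2 (H t Ht))]. Qed.

Lemma CInt01_ext (f g : R -> C) : (forall t, (0 <= t <= 1)%R -> f t = g t) -> CInt01 f = CInt01 g.
Proof.
  intros H. apply C_eq; unfold CInt01; simpl; apply RInt_ext; intros t Ht;
  rewrite Rmin_left, Rmax_right in Ht by lra; rewrite H; auto; lra.
Qed.

Lemma CInt01_plus (f g : R -> C) : cont01 f -> cont01 g -> CInt01 (fun t => f t + g t) = CInt01 f + CInt01 g.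
Proof.
  intros Hf Hg. apply cont01_ex_RInt in Hf, Hg. destruct Hf, Hg.
  apply C_eq; unfold CInt01; simpl; now apply (RInt_plus (V := R_CompleteNormedModule)).
Qed.

Lemma CInt01_scal (c : C) (f : R -> C) : cont01 f -> CInt01 (fun t => c * f t) = c * CInt01 f.
Proof.
  intros Hf. apply cont01_ex_RInt in Hf. destruct Hf as [H1 H2].
  assert (S : forall (k : R) (g : R -> R), ex_RInt g 0 1 -> RInt (fun t => k * g t)%R 0 1 = (k * RInt g 0 1)%R).
  { intros k g Hg. now apply (RInt_scal (V := R_CompleteNormedModule)). }
  assert (S' : forall (k : R) (g : R -> R), ex_RInt g 0 1 -> ex_RInt (fun t => k * g t)%R 0 1).
  { intros k g Hg. now apply (ex_RInt_scal (V := R_NormedModule)). }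
  apply C_eq; unfold CInt01; simpl.
  - rewrite <- (S (fst c) _ H1), <- (S (snd c) _ H2).
    apply (RInt_minus (V := R_CompleteNormedModule) (fun t => fst c * Re (f t))%R); auto.
  - rewrite <- (S (fst c) _ H2), <- (S (snd c) _ H1).
    apply (RInt_plus (V := R_CompleteNormedModule) (fun t => fst c * Im (f t))%R); auto.
Qed.

Lemma CInt01_derive (F f : R -> C) :
  (forall t, (0 <= t <= 1)%R -> rderiv F t (f t)) -> cont01 f -> CInt01 f = F 1%R - F 0%R.
Proof.
  intros HF Hf. apply C_eq; unfold CInt01; simpl; apply (is_RInt_unique (V := R_CompleteNormedModule)).
  - apply (is_RInt_derive (V := R_CompleteNormedModule) (fun t => Re (F t))); intros t Ht;
    rewrite Rmin_left, Rmax_right in Ht by lra; [exact (proj1 (HF t Ht))|exact (proj1 (Hf t Ht))].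
  - apply (is_RInt_derive (V := R_CompleteNormedModule) (fun t => Im (F t))); intros t Ht;
    rewrite Rmin_left, Rmax_right in Ht by lra; [exact (proj2 (HF t Ht))|exact (proj2 (Hf t Ht))].
Qed.

Lemma continuous_bounded_01 (f : R -> R) :
  (forall t, (0 <= t <= 1)%R -> continuous f t) -> exists M, forall t, (0 <= t <= 1)%R -> (Rabs (f t) <= M)%R.
Proof.
  intros H.
  destruct (continuity_ab_maj (fun t => Rabs (f t)) 0 1) as [m [Hm _]]; [lra| |].
  - intros t Ht. apply continuity_pt_filterlim.
    apply (continuous_comp f Rabs); [now apply H|apply continuous_Rabs].
  - exists (Rabs (f m)). exact Hm.
Qed.

Lemma cont01_bounded (f : R -> C) : cont01 f -> exists M, forall t, (0 <= t <= 1)%R -> (Cmod (f t) <= M)%R.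
Proof.
  intros H.
  destruct (continuous_bounded_01 (fun t => Re (f t))) as [M1 H1]; [intros t Ht; exact (proj1 (H t Ht))|].
  destruct (continuous_bounded_01 (fun t => Im (f t))) as [M2 H2]; [intros t Ht; exact (proj2 (H t Ht))|].
  exists (M1 + M2)%R. intros t Ht. eapply Rle_trans; [apply Cmod_le_Re_Im|]. apply Rplus_le_compat; auto.
Qed.

(** The factor 2 comes from estimating the real and imaginary integrals separately. *)
Lemma Cmod_CInt01_le (f : R -> C) (M : R) :
  cont01 f -> (forall t, (0 <= t <= 1)%R -> (Cmod (f t) <= M)%R) -> (Cmod (CInt01 f) <= 2 * M)%R.
Proof.
  intros Hf HM. apply cont01_ex_RInt in Hf. destruct Hf as [H1 H2].
  eapply Rle_trans; [apply Cmod_le_Re_Im|]. unfold CInt01; simpl.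
  apply (abs_RInt_le_const _ 0 1 M) in H1; [|lra|].
  2:{ intros t Ht. eapply Rle_trans; [apply re_le_Cmod|now apply HM]. }
  apply (abs_RInt_le_const _ 0 1 M) in H2; [|lra|].
  2:{ intros t Ht. eapply Rle_trans; [apply Im_le_Cmod|now apply HM]. }
  lra.
Qed.

(** * An approximate identity made of powers of the cosine *)

Lemma RInt01_plus (f g : R -> R) : ex_RInt f 0 1 -> ex_RInt g 0 1 ->
  RInt (fun t => f t + g t)%R 0 1 = (RInt f 0 1 + RInt g 0 1)%R.
Proof. apply (RInt_plus (V := R_CompleteNormedModule)). Qed.

Lemma RInt01_scal (k : R) (f : R -> R) : ex_RInt f 0 1 ->
  RInt (fun t => k * f t)%R 0 1 = (k * RInt f 0 1)%R.
Proof. apply (RInt_scal (V := R_CompleteNormedModule)). Qed.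

Lemma ex_RInt01_plus (f g : R -> R) : ex_RInt f 0 1 -> ex_RInt g 0 1 ->
  ex_RInt (fun t => f t + g t)%R 0 1.
Proof. apply (ex_RInt_plus (V := R_NormedModule)). Qed.

Lemma ex_RInt01_scal (k : R) (f : R -> R) : ex_RInt f 0 1 -> ex_RInt (fun t => k * f t)%R 0 1.
Proof. apply (ex_RInt_scal (V := R_NormedModule)). Qed.

Lemma RInt01_derive (F f : R -> R) :
  (forall t, is_derive F t (f t)) -> (forall t, continuous f t) -> RInt f 0 1 = (F 1 - F 0)%R.
Proof.
  intros HF Hf. apply (is_RInt_unique (V := R_CompleteNormedModule)).
  apply (is_RInt_derive (V := R_CompleteNormedModule) F f); auto.
Qed.

(* The kernels [cos (pi t) ^ (2 n)] concentrate at the integers: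
   [int sin^2 cos^(2 n) = int cos^(2 n + 2) / (2 n + 1)]. *)
Lemma cos_kernel_orthogonal (u : R -> R) :
  (forall t, (0 <= t <= 1)%R -> continuous u t) -> u 1%R = u 0%R ->
  (forall n : nat, RInt (fun t => u t * cos (PI * t) ^ (2 * n))%R 0 1 = 0%R) ->
  u 0%R = 0%R.
Proof.
  intros Hc H10 Hn.
  set (W := fun n : nat => RInt (fun t => cos (PI * t) ^ (2 * n))%R 0 1).
  set (J := fun n : nat => RInt (fun t => sin (PI * t) ^ 2 * cos (PI * t) ^ (2 * n))%R 0 1).
  assert (CW : forall n t, continuous (fun t => cos (PI * t) ^ (2 * n))%R t).
  { intros n t. apply continuous_ex_derive. auto_derive. auto. }
  assert (CS : forall n t, continuous (fun t => sin (PI * t) ^ 2 * cos (PI * t) ^ (2 * n))%R t).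
  { intros n t. apply continuous_ex_derive. auto_derive. auto. }
  assert (EW : forall n, ex_RInt (fun t => cos (PI * t) ^ (2 * n))%R 0 1) by (intros n; apply ex_RInt_01; auto).
  assert (ES : forall n, ex_RInt (fun t => sin (PI * t) ^ 2 * cos (PI * t) ^ (2 * n))%R 0 1)
    by (intros n; apply ex_RInt_01; auto).
  assert (Kn : forall n t, (0 <= cos (PI * t) ^ (2 * n))%R).
  { intros n t. rewrite pow_mult. apply pow_le, pow2_ge_0. }
  assert (HS : forall n, (0 <= J n)%R).
  { intros n. apply RInt_ge_0; [lra|apply ES|]. intros t _. apply Rmult_le_pos; [apply pow2_ge_0|auto]. }
  (* Integrate the derivative of sin (pi t) cos (pi t)^(2 n + 1), a function vanishing at both
     ends. *)
  assert (R1 : forall n, W (n + 1)%nat = ((2 * INR n + 1) * J n)%R).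
  { intros n.
    assert (I := RInt01_derive (fun t => sin (PI * t) * cos (PI * t) ^ (2 * n + 1))%R
      (fun t => PI * (cos (PI * t) ^ (2 * (n + 1)) + - (2 * INR n + 1) * (sin (PI * t) ^ 2 * cos (PI * t) ^ (2 * n))))%R).
    pose proof (ex_RInt01_scal (- (2 * INR n + 1)) _ (ES n)) as E3.
    rewrite (RInt01_scal PI _ (ex_RInt01_plus _ _ (EW (n + 1)%nat) E3)),
      (RInt01_plus _ _ (EW (n + 1)%nat) E3), (RInt01_scal _ _ (ES n)) in I.
    fold (W (n + 1)%nat) (J n) in I.
    rewrite Rmult_1_r, Rmult_0_r, sin_PI, sin_0 in I.
    generalize PI_RGT_0. intros HPI. apply (Rmult_eq_reg_l PI); [|lra].
    assert (I' : (PI * (W (n + 1)%nat + - (2 * INR n + 1) * J n) = 0)%R).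
    { rewrite I; [ring| |].
      - intros t. auto_derive; [auto|].
        replace (n + (n + 0) + 1)%nat with (2 * n + 1)%nat by lia.
        replace (INR (2 * n + 1)) with (2 * INR n + 1)%R by (rewrite plus_INR, mult_INR; simpl; ring).
        replace (pred (2 * n + 1)) with (2 * n)%nat by lia.
        replace (2 * (n + 1))%nat with (S (2 * n + 1))%nat by lia.
        replace (2 * n + 1)%nat with (S (2 * n))%nat by lia. rewrite <- !tech_pow_Rmult. rewrite pow_O. ring.
      - intros t. apply continuous_ex_derive. auto_derive. auto. }
    lra. }
  assert (R2 : forall n, W n = (W (n + 1)%nat + J n)%R).
  { intros n. unfold W, J.
    rewrite <- (RInt01_plus _ _ (EW (n + 1)%nat) (ES n)).
    apply RInt_ext. intros t _.
    replace (2 * (n + 1))%nat with (2 + 2 * n)%nat by lia. rewrite pow_add.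
    generalize (sin2_cos2 (PI * t)). unfold Rsqr. intros E.
    replace (cos (PI * t) ^ 2)%R with (1 - sin (PI * t) ^ 2)%R by (simpl; lra).
    simpl. ring. }
  assert (HW0 : W 0%nat = 1%R).
  { unfold W. rewrite (RInt_ext _ (fun _ => 1%R)); [|intros; simpl; reflexivity].
    rewrite (RInt_const (V := R_CompleteNormedModule)). unfold scal; simpl. unfold mult; simpl. ring. }
  assert (HW : forall n, (0 < W n)%R).
  { induction n as [|n IH]; [lra|]. specialize (R1 n). specialize (R2 n). rewrite Nat.add_1_r in *.
    specialize (HS n). generalize (pos_INR n). intros. nra. }
  assert (HSW : forall n, (J n * (2 * INR n + 1) <= W n)%R).
  { intros n. specialize (R1 n). specialize (R2 n). specialize (HS n). lra. }
  (* Near 0 and 1 continuity and u 1 = u 0 give the bound eta; elsewhere sin^2 is bounded below, and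
     a large multiple of it dominates the bounded function u. *)
  assert (Hd : forall eta, (0 < eta)%R -> exists K, (0 <= K)%R /\
     forall t, (0 <= t <= 1)%R -> (Rabs (u 0%R - u t) <= eta + K * sin (PI * t) ^ 2)%R).
  { intros eta Heta.
    assert (I0 : (0 <= 0 <= 1)%R) by lra. assert (I1 : (0 <= 1 <= 1)%R) by lra.
    assert (N0 : exists d, (0 < d)%R /\ forall t, (Rabs (t - 0) < d)%R -> (Rabs (u t - u 0%R) < eta)%R).
    { apply (locally_R 0 (fun t => Rabs (u t - u 0%R) < eta)%R).
      apply (proj1 (filterlim_locally (U := R_UniformSpace) _ _) (Hc 0%R I0) (mkposreal eta Heta)). }
    assert (N1 : exists d, (0 < d)%R /\ forall t, (Rabs (t - 1) < d)%R -> (Rabs (u t - u 1%R) < eta)%R).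
    { apply (locally_R 1 (fun t => Rabs (u t - u 1%R) < eta)%R).
      apply (proj1 (filterlim_locally (U := R_UniformSpace) _ _) (Hc 1%R I1) (mkposreal eta Heta)). }
    destruct N0 as [d0 [Hd0 N0]], N1 as [d1 [Hd1 N1]]. rewrite H10 in N1.
    destruct (continuous_bounded_01 u Hc) as [M HM].
    set (d := Rmin (1 / 4) (Rmin d0 d1)).
    assert (Hd : (0 < d /\ d <= 1 / 4 /\ d <= d0 /\ d <= d1)%R) by (unfold d, Rmin; repeat destruct Rle_dec; lra).
    set (m := sin (PI * d)). generalize PI_RGT_0. intros HPI.
    assert (Hm : (0 < m)%R) by (apply sin_gt_0; nra).
    assert (HM0 : (0 <= M)%R) by (generalize (HM 0%R ltac:(lra)) (Rabs_pos (u 0%R)); lra).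
    exists (2 * M / m ^ 2)%R.
    assert (Hm2 : (0 < m ^ 2)%R) by now apply pow_lt.
    split; [apply Rdiv_le_0_compat; lra|].
    assert (Hpos : forall t, (0 <= 2 * M / m ^ 2 * sin (PI * t) ^ 2)%R).
    { intros t. apply Rmult_le_pos; [apply Rdiv_le_0_compat; lra|apply pow2_ge_0]. }
    intros t Ht.
    destruct (Rlt_or_le t d) as [Ht0|Ht0]; [|destruct (Rlt_or_le (1 - d) t) as [Ht1|Ht1]].
    - specialize (N0 t ltac:(rewrite Rabs_pos_eq; lra)). specialize (Hpos t). rewrite Rabs_minus_sym. lra.
    - specialize (N1 t ltac:(rewrite Rabs_left1; lra)). specialize (Hpos t). rewrite Rabs_minus_sym. lra.
    - assert (Hs : (m <= sin (PI * t))%R).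
      { destruct (Rle_or_lt t (1 / 2)) as [Hh|Hh].
        - apply sin_incr_1; nra.
        - unfold m. rewrite <- (sin_PI_x (PI * t)). apply sin_incr_1; nra. }
      assert (m ^ 2 <= sin (PI * t) ^ 2)%R by (apply pow_incr; lra).
      assert (1 <= sin (PI * t) ^ 2 / m ^ 2)%R.
      { apply (Rmult_le_reg_r (m ^ 2)); [auto|]. unfold Rdiv. rewrite Rmult_assoc, Rinv_l; lra. }
      replace (2 * M / m ^ 2 * sin (PI * t) ^ 2)%R with (2 * M * (sin (PI * t) ^ 2 / m ^ 2))%R by (field; lra).
      assert (Rabs (u 0%R - u t) <= 2 * M)%R.
      { eapply Rle_trans; [apply Rabs_triang|]. rewrite Rabs_Ropp.
        generalize (HM 0%R ltac:(lra)) (HM t Ht). lra. }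
      nra. }
  (* Integrate the previous bound against the kernel: by orthogonality the left side gives |u 0|
     [W n], and [J n] is at most [W n] / (2 n + 1). Letting n grow leaves |u 0| <= eta. *)
  assert (B : forall eta K n, (0 < eta)%R -> (0 <= K)%R ->
     (forall t, (0 <= t <= 1)%R -> (Rabs (u 0%R - u t) <= eta + K * sin (PI * t) ^ 2)%R) ->
     (Rabs (u 0%R) * (2 * INR n + 1) <= eta * (2 * INR n + 1) + K)%R).
  { intros eta K n Heta HK HB.
    assert (Eu : ex_RInt (fun t => u t * cos (PI * t) ^ (2 * n))%R 0 1).
    { apply ex_RInt_01. intros t Ht. apply (continuous_mult (K := R_AbsRing)); auto. }
    assert (E1 : ex_RInt (fun t => (u 0%R - u t) * cos (PI * t) ^ (2 * n))%R 0 1).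
    { apply ex_RInt_01. intros t Ht. apply (continuous_mult (K := R_AbsRing)); auto.
      apply (continuous_minus (V := R_NormedModule)); auto. apply continuous_const. }
    assert (I1 : RInt (fun t => (u 0%R - u t) * cos (PI * t) ^ (2 * n))%R 0 1 = (u 0%R * W n)%R).
    { transitivity (RInt (fun t => u 0%R * cos (PI * t) ^ (2 * n) + (-1) * (u t * cos (PI * t) ^ (2 * n)))%R 0 1).
      { apply RInt_ext. intros t _. match goal with |- ?a = ?b => change (@eq R a b) end. ring. }
      rewrite (RInt01_plus _ _ (ex_RInt01_scal _ _ (EW n)) (ex_RInt01_scal _ _ Eu)),
        (RInt01_scal _ _ (EW n)), (RInt01_scal _ _ Eu), Hn. rewrite Rmult_0_r. apply Rplus_0_r. }
    assert (E2 : ex_RInt (fun t => eta * cos (PI * t) ^ (2 * n) + K * (sin (PI * t) ^ 2 * cos (PI * t) ^ (2 * n)))%R 0 1).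
    { exact (ex_RInt01_plus _ _ (ex_RInt01_scal _ _ (EW n)) (ex_RInt01_scal _ _ (ES n))). }
    assert (I2 : RInt (fun t => eta * cos (PI * t) ^ (2 * n) + K * (sin (PI * t) ^ 2 * cos (PI * t) ^ (2 * n)))%R 0 1 = (eta * W n + K * J n)%R).
    { rewrite (RInt01_plus _ _ (ex_RInt01_scal _ _ (EW n)) (ex_RInt01_scal _ _ (ES n))),
        (RInt01_scal _ _ (EW n)), (RInt01_scal _ _ (ES n)). reflexivity. }
    assert (HA : (Rabs (u 0%R * W n) <= eta * W n + K * J n)%R).
    { rewrite <- I1, <- I2. eapply Rle_trans; [apply abs_RInt_le; [lra|auto]|].
      apply RInt_le; [lra| |auto|].
      - apply (ex_RInt_norm (fun t => (u 0%R - u t) * cos (PI * t) ^ (2 * n))%R). exact E1.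
      - intros t Ht. rewrite Rabs_mult, (Rabs_pos_eq (_ ^ _)) by auto.
        specialize (HB t ltac:(lra)). specialize (Kn n t). nra. }
    rewrite Rabs_mult, (Rabs_pos_eq (W n)) in HA by (left; auto).
    specialize (HSW n). specialize (HW n). specialize (HS n). generalize (pos_INR n). intros Hi.
    apply (Rmult_le_reg_r (W n)); [auto|].
    assert (K * (J n * (2 * INR n + 1)) <= K * W n)%R by (apply Rmult_le_compat_l; auto).
    nra. }
  apply Rabs_eq_0. apply Rle_antisym; [|apply Rabs_pos].
  apply le_epsilon. intros eps Heps. rewrite Rplus_0_l.
  destruct (Hd (eps / 2)%R ltac:(lra)) as [K [HK HB]].
  destruct (INR_unbounded (K / (eps / 2))) as [n Hnn].
  specialize (B (eps / 2)%R K n ltac:(lra) HK HB).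
  assert (K < eps / 2 * INR n)%R.
  { apply (Rmult_lt_compat_r (eps / 2)) in Hnn; [|lra].
    replace (K / (eps / 2) * (eps / 2))%R with K in Hnn by (field; lra). lra. }
  assert (0 <= K / (eps / 2))%R by (apply Rdiv_le_0_compat; lra).
  apply (Rmult_le_reg_r (2 * INR n + 1)); [lra|]. nra.
Qed.

(** * Fourier coefficients of functions with multiplier exp (2 pi i b) *)

Lemma two_PI_i_neq_0 : 2 * PI * Ci <> 0.
Proof.
  repeat apply Cmult_neq_0; [| |apply Ci_nz]; intros E; apply RtoC_inj in E;
  generalize PI_RGT_0; lra.
Qed.

Definition freq (b : C) (k : Z) : C := - (2 * PI * Ci * (IZR k + b)).

(** The k-th Fourier coefficient of f(t) exp (- 2 pi i b t), which takes equal values at 0 and 1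
    when f 1 = exp (2 pi i b) * f 0. The exponent b may be complex. *)
Definition fcoef (b : C) (f : R -> C) (k : Z) : C := CInt01 (fun t => f t * Cexp (freq b k * t)).

Lemma cont01_fcoef (b : C) (f : R -> C) (k : Z) : cont01 f -> cont01 (fun t => f t * Cexp (freq b k * t)).
Proof. intros H. apply cont01_mult; [auto|apply cont01_Cexp]. Qed.

Lemma fcoef_plus (b : C) (f g : R -> C) (k : Z) :
  cont01 f -> cont01 g -> fcoef b (fun t => f t + g t) k = fcoef b f k + fcoef b g k.
Proof.
  intros Hf Hg. unfold fcoef. rewrite <- CInt01_plus by (now apply cont01_fcoef).
  apply CInt01_ext. intros t _. ring.
Qed.

Lemma fcoef_scal (b c : C) (f : R -> C) (k : Z) : cont01 f -> fcoef b (fun t => c * f t) k = c * fcoef b f k.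
Proof.
  intros Hf. unfold fcoef. rewrite <- CInt01_scal by (now apply cont01_fcoef).
  apply CInt01_ext. intros t _. ring.
Qed.

Lemma fcoef_Cexp (b : C) (f : R -> C) (k j : Z) :
  fcoef b (fun t => Cexp (2 * PI * Ci * IZR j * t) * f t) k = fcoef b f (k - j).
Proof.
  apply CInt01_ext. intros t _.
  replace (freq b (k - j) * t) with (2 * PI * Ci * IZR j * t + freq b k * t)
    by (unfold freq; rewrite minus_IZR, RtoC_minus; ring).
  rewrite Cexp_plus. ring.
Qed.

Lemma fcoef_circuit (b z0 : C) (f : R -> C) (k : Z) :
  cont01 f -> fcoef b (fun t => circuit z0 t * f t) k = z0 * fcoef b f (k - 1).
Proof.
  intros Hf. rewrite <- fcoef_Cexp, <- fcoef_scal.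
  - apply CInt01_ext. intros t _. rewrite circuit_Cexp.
    replace (2 * PI * Ci * 1 * t) with (2 * PI * Ci * t) by ring. ring.
  - apply cont01_mult; [apply cont01_Cexp|auto].
Qed.

Lemma Cinv_circuit (z0 : C) (t : R) :
  z0 <> 0 -> / circuit z0 t = / z0 * Cexp (2 * PI * Ci * IZR (-1) * t).
Proof.
  intros Hz. rewrite circuit_Cexp.
  assert (E : Cexp (2 * PI * Ci * IZR (-1) * t) * Cexp (2 * PI * Ci * t) = 1).
  { rewrite <- (Cexp_opp_l (2 * PI * Ci * t)). f_equal. f_equal. ring. }
  assert (N := Cexp_neq_0 (2 * PI * Ci * t)).
  replace (Cexp (2 * PI * Ci * IZR (-1) * t)) with
    (Cexp (2 * PI * Ci * IZR (-1) * t) * Cexp (2 * PI * Ci * t) * / Cexp (2 * PI * Ci * t)) by (field; auto).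
  rewrite E. field. auto.
Qed.

Lemma fcoef_circuit_inv (b z0 : C) (f : R -> C) (k : Z) :
  z0 <> 0 -> cont01 f -> fcoef b (fun t => / circuit z0 t * f t) k = / z0 * fcoef b f (k + 1).
Proof.
  intros Hz Hf. replace (k + 1)%Z with (k - -1)%Z by ring. rewrite <- fcoef_Cexp, <- fcoef_scal.
  - apply CInt01_ext. intros t _. rewrite Cinv_circuit by auto. ring.
  - apply cont01_mult; [apply cont01_Cexp|auto].
Qed.

Lemma Cexp_2PI_Z (k : Z) : Cexp (2 * PI * Ci * IZR k) = 1.
Proof.
  assert (N : forall n : nat, Cexp (2 * PI * Ci * INR n) = 1).
  { induction n as [|n IH].
    - simpl. rewrite <- Cexp_0. f_equal. ring.
    - rewrite S_INR, RtoC_plus.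
      replace (2 * PI * Ci * (INR n + 1)) with (2 * PI * Ci * INR n + (PI * Ci + PI * Ci)) by ring.
      rewrite !Cexp_plus, IH, Cexp_PI. ring. }
  destruct (Z_le_gt_dec 0 k) as [H|H].
  - rewrite <- (Z2Nat.id k H), <- INR_IZR_INZ. apply N.
  - replace (Cexp (2 * PI * Ci * IZR k)) with
      (Cexp (- (2 * PI * Ci * INR (Z.to_nat (- k)))) * Cexp (2 * PI * Ci * INR (Z.to_nat (- k)))).
    + apply Cexp_opp_l.
    + rewrite N, Cmult_1_r, INR_IZR_INZ, Z2Nat.id by lia. f_equal. rewrite opp_IZR, RtoC_opp. ring.
Qed.

Lemma Cexp_freq_1 (b : C) (k : Z) : Cexp (freq b k * 1) = Cexp (- (2 * PI * Ci * b)).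
Proof.
  replace (freq b k * 1) with (2 * PI * Ci * IZR (- k) + - (2 * PI * Ci * b))
    by (unfold freq; rewrite opp_IZR, RtoC_opp; ring).
  rewrite Cexp_plus, Cexp_2PI_Z. ring.
Qed.

(* Integration by parts; the boundary terms cancel because [f] times the
   exponential is periodic. *)
Lemma fcoef_derive (b chi : C) (f df : R -> C) (k : Z) :
  chi * Cexp (- (2 * PI * Ci * b)) = 1 ->
  (forall t, (0 <= t <= 1)%R -> rderiv f t (df t)) -> cont01 df -> f 1%R = chi * f 0%R ->
  fcoef b df k = 2 * PI * Ci * (IZR k + b) * fcoef b f k.
Proof.
  intros Hchi Hf Hd H1.
  assert (Cf : cont01 f) by (now apply rderiv_cont01 with df).
  assert (I : CInt01 (fun t => df t * Cexp (freq b k * t) + freq b k * (f t * Cexp (freq b k * t))) = 0).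
  { rewrite (CInt01_derive (fun t => f t * Cexp (freq b k * t))).
    - rewrite Cexp_freq_1, H1. replace (freq b k * 0) with (RtoC 0) by ring. rewrite Cexp_0.
      transitivity (f 0%R * (chi * Cexp (- (2 * PI * Ci * b)) - 1)); [ring|]. rewrite Hchi. ring.
    - intros t Ht. apply rderiv_eq with (df t * Cexp (freq b k * t) + f t * (freq b k * Cexp (freq b k * t))).
      + apply rderiv_mult; [now apply Hf|apply rderiv_Cexp].
      + ring.
    - exact (cont01_plus _ _ (cont01_fcoef b df k Hd) (cont01_mult _ _ (cont01_const (freq b k)) (cont01_fcoef b f k Cf))). }
  pose proof (cont01_fcoef b f k Cf) as Cf'.
  rewrite (CInt01_plus _ _ (cont01_fcoef b df k Hd) (cont01_mult _ _ (cont01_const (freq b k)) Cf')),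
    (CInt01_scal (freq b k) _ Cf') in I.
  fold (fcoef b df k) in I. fold (fcoef b f k) in I.
  replace (fcoef b df k) with (fcoef b df k + freq b k * fcoef b f k - freq b k * fcoef b f k) by ring.
  rewrite I. unfold freq. ring.
Qed.

Lemma fcoef_bound (b : C) (f : R -> C) : cont01 f -> exists K : R, forall k, (Cmod (fcoef b f k) <= K)%R.
Proof.
  intros Hf. destruct (cont01_bounded _ (cont01_fcoef b f 0 Hf)) as [M HM].
  exists (2 * M)%R. intros k. apply Cmod_CInt01_le; [now apply cont01_fcoef|].
  intros t Ht. specialize (HM t Ht).
  (* Since b may be non-real, the exponential need not be unimodular; but k only contributes a
     unimodular factor, so the bound for k = 0 serves for all k. *)
  assert (E : freq b k * t = 2 * PI * Ci * (- (IZR k) * t) + freq b 0 * t) by (unfold freq; ring).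
  rewrite E, Cexp_plus. rewrite !Cmod_mult in *.
  assert (E1 : Cmod (Cexp (2 * PI * Ci * (- (IZR k) * t))) = 1%R).
  { rewrite Cmod_Cexp, <- exp_0. f_equal. simpl. ring. }
  rewrite E1, Rmult_1_l. exact HM.
Qed.

(** Since cos (pi t)^2 = (exp (2 pi i t) + exp (- 2 pi i t)) / 4 + 1/2, vanishing of all
    coefficients passes from f to its products with the cosine kernels. Only the value at 0 is
    recovered, which is what the initial data need. *)
Lemma fcoef_zero (b chi : C) (f : R -> C) :
  chi * Cexp (- (2 * PI * Ci * b)) = 1 -> cont01 f -> f 1%R = chi * f 0%R ->
  (forall k, fcoef b f k = 0) -> f 0%R = 0.
Proof.
  intros Hchi Hf H1 Hz.
  assert (Cc : forall n, cont01 (fun t => RtoC (cos (PI * t) ^ (2 * n))%R * f t)).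
  { intros n. apply (cont01_mult (fun t => RtoC (cos (PI * t) ^ (2 * n))%R) f); [|auto].
    intros t _. split; [|apply continuous_const].
    apply continuous_ex_derive. simpl Re. auto_derive. auto. }
  assert (Zn : forall n k, fcoef b (fun t => RtoC (cos (PI * t) ^ (2 * n))%R * f t) k = 0).
  { induction n as [|n IH]; intros k.
    - rewrite <- (Hz k). apply CInt01_ext. intros t _. simpl. ring.
    - set (g := fun t : R => RtoC (cos (PI * t) ^ (2 * n))%R * f t) in *.
      assert (Cg : cont01 g) by apply Cc.
      set (h := fun (j : Z) (t : R) => Cexp (2 * PI * Ci * IZR j * t) * g t).
      assert (Ch : forall j, cont01 (h j)) by (intros j; apply cont01_mult; [apply cont01_Cexp|auto]).
      assert (E : forall t, RtoC (cos (PI * t) ^ (2 * S n))%R * f t = / 4 * (h 1%Z t + h (-1)%Z t) + / 2 * g t).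
      { intros t. unfold h, g.
        replace (cos (PI * t) ^ (2 * S n))%R with (cos (PI * t) ^ 2 * cos (PI * t) ^ (2 * n))%R
          by (rewrite <- pow_add; f_equal; lia).
        rewrite RtoC_mult.
        assert (E : RtoC (cos (PI * t) ^ 2) = / 4 * (Cexp (2 * PI * Ci * 1 * t) + Cexp (2 * PI * Ci * IZR (-1) * t)) + / 2).
        { assert (X : forall a : R, a = (2 * PI * t)%R -> Cexp (2 * PI * Ci * 1 * t) = (cos a, sin a)
             /\ Cexp (2 * PI * Ci * IZR (-1) * t) = (cos a, - sin a)%R).
          { intros a ->. split.
            - rewrite <- (Cmult_1_l (cos _, _)). change (Cexp (2 * PI * Ci * 1 * t) = circuit 1 t).
              rewrite circuit_Cexp, Cmult_1_l. f_equal. ring.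
            - replace (2 * PI * Ci * IZR (-1) * t) with (2 * PI * Ci * (- t)%R) by (rewrite RtoC_opp; ring).
              rewrite <- (Cmult_1_l (Cexp _)), <- circuit_Cexp. unfold circuit.
              replace (2 * PI * - t)%R with (- (2 * PI * t))%R by ring. rewrite cos_neg, sin_neg. apply Cmult_1_l. }
          destruct (X _ eq_refl) as [-> ->].
          replace (2 * PI * t)%R with (2 * (PI * t))%R by ring.
          replace (/ 4) with (RtoC (/ 4)) by (apply RtoC_inv; lra).
          replace (/ 2) with (RtoC (/ 2)) by (apply RtoC_inv; lra).
          rewrite cos_2a_cos. apply C_eq; unfold Re, Im; simpl; field. }
        rewrite E. ring. }
      assert (C2 : cont01 (fun t => / 4 * (h 1%Z t + h (-1)%Z t))).
      { apply cont01_mult; [apply cont01_const|now apply cont01_plus]. }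
      assert (C3 : cont01 (fun t => / 2 * g t)) by (apply cont01_mult; [apply cont01_const|auto]).
      transitivity (fcoef b (fun t => / 4 * (h 1%Z t + h (-1)%Z t) + / 2 * g t) k).
      { apply CInt01_ext. intros t _. now rewrite E. }
      rewrite (fcoef_plus b _ _ k C2 C3), (fcoef_scal b (/ 2) g k Cg),
          (fcoef_scal b (/ 4) _ k (cont01_plus _ _ (Ch 1%Z) (Ch (-1)%Z))), (fcoef_plus b _ _ k (Ch 1%Z) (Ch (-1)%Z)).
      unfold h. rewrite !fcoef_Cexp, !IH. ring. }
  set (u := fun t => f t * Cexp (freq b 0 * t)).
  assert (Cu : cont01 u) by now apply cont01_fcoef.
  assert (U0 : u 0%R = f 0%R).
  { unfold u. replace (freq b 0 * 0) with (RtoC 0) by ring. rewrite Cexp_0. ring. }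
  assert (U1 : u 1%R = u 0%R).
  { rewrite U0. unfold u. rewrite Cexp_freq_1, H1.
    transitivity (f 0%R * (chi * Cexp (- (2 * PI * Ci * b)))); [ring|]. rewrite Hchi. ring. }
  assert (I : forall n, CInt01 (fun t => RtoC (cos (PI * t) ^ (2 * n))%R * u t) = 0).
  { intros n. rewrite <- (Zn n 0%Z). apply CInt01_ext. intros t _. unfold u. ring. }
  rewrite <- U0. clearbody u. apply C_eq.
  - apply (cos_kernel_orthogonal (fun t => Re (u t))).
    + intros t Ht. exact (proj1 (Cu t Ht)).
    + now rewrite U1.
    + intros n. specialize (I n). apply (f_equal Re) in I.
      transitivity (RInt (fun t => Re (RtoC (cos (PI * t) ^ (2 * n))%R * u t)) 0 1); [|exact I].
      apply RInt_ext. intros t _. rewrite ?re_scal_l, ?im_scal_l. apply Rmult_comm.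
  - apply (cos_kernel_orthogonal (fun t => Im (u t))).
    + intros t Ht. exact (proj2 (Cu t Ht)).
    + now rewrite U1.
    + intros n. specialize (I n). apply (f_equal Im) in I.
      transitivity (RInt (fun t => Im (RtoC (cos (PI * t) ^ (2 * n))%R * u t)) 0 1); [|exact I].
      apply RInt_ext. intros t _. rewrite ?re_scal_l, ?im_scal_l. apply Rmult_comm.
Qed.

(* Obtained by inserting [z^b * sum c_k (z / z0)^k] into the equation with [n = l + 1]. *)
Definition recurrence (lambda mu l z0 b : C) (c : Z -> C) (k : Z) : Prop :=
  ((IZR k + b) ^ 2 + l * (IZR k + b) + lambda) * c k
  + mu / z0 * (IZR k + 1 + b) * c (k + 1)%Z
  - mu * z0 * (IZR k + b + l) * c (k - 1)%Z = 0.

(** Along the circuit d/dt is 2 pi i z d/dz, so the second unknown is taken to be q = z E'. The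
    system for E and q has only constants, z and 1/z as coefficients, and these shift the Fourier
    index by at most one. *)
Lemma floquet_recurrence (lambda mu l z0 b chi : C) :
  z0 <> 0 -> chi * Cexp (- (2 * PI * Ci * b)) = 1 ->
  floquet lambda mu (l + 1) z0 chi ->
  exists c : Z -> C,
    (exists K : R, forall k, (Cmod (c k) <= K)%R) /\
    (exists k, c k <> 0) /\
    forall k, recurrence lambda mu l z0 b c k.
Proof.
  intros Hz Hchi [p [y [S [P1 [Y1 PY]]]]].
  set (g := circuit z0). set (q := fun t => g t * y t).
  set (i2 := 2 * PI * Ci).
  assert (Hi2 : i2 <> 0) by apply two_PI_i_neq_0.
  assert (Cp : cont01 p) by exact (rderiv_cont01 p _ (fun t Ht => proj1 (S t Ht))).
  assert (Cy : cont01 y) by exact (rderiv_cont01 y _ (fun t Ht => proj2 (S t Ht))).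
  assert (Cg : cont01 g) by exact (rderiv_cont01 g _ (fun t _ => rderiv_circuit z0 t)).
  assert (Cq : cont01 q) by now apply cont01_mult.
  assert (Cgi : cont01 (fun t => / g t)).
  { apply cont01_ext with (fun t => / z0 * Cexp (2 * PI * Ci * IZR (-1) * t)).
    - intros t. symmetry. now apply Cinv_circuit.
    - apply cont01_mult; [apply cont01_const|apply cont01_Cexp]. }
  assert (Dp : forall t, (0 <= t <= 1)%R -> rderiv p t (i2 * q t)).
  { intros t Ht. destruct (S t Ht) as [D _]. apply rderiv_eq with (1 := D).
    unfold dcircuit, q, g, i2. ring. }
  (* The equation with n = l + 1 reads z (z E')' = - [G]. *)
  set (G := fun t => l * q t + mu * (/ g t * q t) + (- mu) * (g t * q t) + lambda * p t + (- mu * (l + 1)) * (g t * p t)).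
  assert (Dq : forall t, (0 <= t <= 1)%R -> rderiv q t (- i2 * G t)).
  { intros t Ht. destruct (S t Ht) as [_ D].
    apply rderiv_eq with (1 := rderiv_mult _ _ _ _ _ (rderiv_circuit z0 t) D).
    unfold ode_second, dcircuit, G, q, g, i2. field. now apply circuit_neq_0. }
  assert (C1 : cont01 (fun t => / g t * q t)) by now apply cont01_mult.
  assert (C2 : cont01 (fun t => g t * q t)) by now apply cont01_mult.
  assert (C3 : cont01 (fun t => g t * p t)) by now apply cont01_mult.
  assert (Cs : forall c f, cont01 f -> cont01 (fun t => c * f t)).
  { intros c f Hf. apply cont01_mult; [apply cont01_const|auto]. }
  pose proof (Cs l q Cq) as B1. pose proof (Cs mu _ C1) as B2. pose proof (Cs (- mu) _ C2) as B3.
  pose proof (Cs lambda _ Cp) as B4. pose proof (Cs (- mu * (l + 1)) _ C3) as B5.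
  pose proof (cont01_plus _ _ B1 B2) as B12. pose proof (cont01_plus _ _ B12 B3) as B123.
  assert (CG : cont01 G) by exact (cont01_plus _ _ (cont01_plus _ _ B123 B4) B5).
  assert (Q1 : q 1%R = chi * q 0%R).
  { unfold q, g. rewrite circuit_0, circuit_1, Y1. ring. }
  assert (Hq : forall k, fcoef b q k = (IZR k + b) * fcoef b p k).
  { intros k. pose proof (fcoef_derive b chi p (fun t => i2 * q t) k Hchi Dp (Cs _ _ Cq) P1) as H.
    rewrite fcoef_scal in H by auto. fold i2 in H.
    transitivity (/ i2 * (i2 * fcoef b q k)); [field; auto|]. rewrite H. field. auto. }
  assert (HG : forall k, fcoef b G k = - (IZR k + b) * ((IZR k + b) * fcoef b p k)).
  { intros k. pose proof (fcoef_derive b chi q (fun t => - i2 * G t) k Hchi Dq (Cs _ _ CG) Q1) as H.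
    rewrite fcoef_scal in H by auto. fold i2 in H.
    transitivity (- / i2 * (- i2 * fcoef b G k)); [field; auto|]. rewrite H, Hq. field. auto. }
  exists (fcoef b p). split; [now apply fcoef_bound|]. split.
  - apply Classical_Prop.NNPP. intros N.
    assert (Z : forall k, fcoef b p k = 0).
    { intros k. apply Classical_Prop.NNPP. intros H. apply N. now exists k. }
    apply PY. split; [now apply (fcoef_zero b chi)|].
    assert (Q0 : q 0%R = 0).
    { apply (fcoef_zero b chi); auto. intros k. rewrite Hq, Z. ring. }
    unfold q, g in Q0. rewrite circuit_0 in Q0.
    transitivity (/ z0 * (z0 * y 0%R)); [field; auto|]. rewrite Q0. ring.
  - intros k. pose proof (HG k) as H. unfold G in H.
    rewrite (fcoef_plus b _ _ k (cont01_plus _ _ B123 B4) B5), (fcoef_plus b _ _ k B123 B4),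
      (fcoef_plus b _ _ k B12 B3), (fcoef_plus b _ _ k B1 B2),
      (fcoef_scal b l q k Cq), (fcoef_scal b mu _ k C1), (fcoef_scal b (- mu) _ k C2),
      (fcoef_scal b lambda p k Cp), (fcoef_scal b (- mu * (l + 1)) _ k C3) in H.
    unfold g in H. rewrite (fcoef_circuit_inv b z0 q k Hz Cq), (fcoef_circuit b z0 q k Cq),
      (fcoef_circuit b z0 p k Cp), !Hq in H.
    unfold recurrence.
    rewrite plus_IZR, minus_IZR, RtoC_plus, RtoC_minus in H.
    match type of H with ?A = ?B => transitivity (A - B); [|rewrite H; ring] end.
    field. auto.
Qed.

(** * The infinite products *)

Definition Clim (u : nat -> C) (L : C) : Prop :=
  forall eps : R, (0 < eps)%R -> exists N : nat, forall n, (N <= n)%nat -> (Cmod (u n - L) < eps)%R.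

Lemma Clim_unique (u : nat -> C) (L L' : C) : Clim u L -> Clim u L' -> L = L'.
Proof.
  intros H H'. apply Ceq_minus, Cmod_eq_0. apply Rle_antisym; [|apply Cmod_ge_0].
  apply le_epsilon. intros eps Heps. rewrite Rplus_0_l.
  destruct (H (eps / 2)%R ltac:(lra)) as [N HN]. destruct (H' (eps / 2)%R ltac:(lra)) as [N' HN'].
  specialize (HN (max N N') ltac:(lia)). specialize (HN' (max N N') ltac:(lia)).
  rewrite Cmod_minus_sym in HN.
  replace (L - L') with ((L - u (max N N')) + (u (max N N') - L')) by ring.
  generalize (Cmod_triangle (L - u (max N N')) (u (max N N') - L')). lra.
Qed.

Lemma Clim_plus (u v : nat -> C) (L L' : C) : Clim u L -> Clim v L' -> Clim (fun n => u n + v n) (L + L').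
Proof.
  intros H H' eps Heps.
  destruct (H (eps / 2)%R ltac:(lra)) as [N HN]. destruct (H' (eps / 2)%R ltac:(lra)) as [N' HN'].
  exists (max N N'). intros n Hn. specialize (HN n ltac:(lia)). specialize (HN' n ltac:(lia)).
  replace (u n + v n - (L + L')) with ((u n - L) + (v n - L')) by ring.
  generalize (Cmod_triangle (u n - L) (v n - L')). lra.
Qed.

Lemma Clim_scal (c : C) (u : nat -> C) (L : C) : Clim u L -> Clim (fun n => c * u n) (c * L).
Proof.
  intros H eps Heps. assert (Hc := Cmod_ge_0 c).
  destruct (H (eps / (Cmod c + 1))%R) as [N HN]; [apply Rdiv_lt_0_compat; lra|].
  exists N. intros n Hn. specialize (HN n Hn).
  replace (c * u n - c * L) with (c * (u n - L)) by ring. rewrite Cmod_mult.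
  apply (Rmult_lt_compat_r (Cmod c + 1)) in HN; [|lra].
  replace (eps / (Cmod c + 1) * (Cmod c + 1))%R with eps in HN by (field; lra).
  generalize (Cmod_ge_0 (u n - L)). nra.
Qed.

Lemma Clim_ext (u v : nat -> C) (L : C) : (forall n, u n = v n) -> Clim u L -> Clim v L.
Proof.
  intros E H eps Heps. destruct (H eps Heps) as [N HN]. exists N. intros n Hn. rewrite <- E. auto.
Qed.

Lemma Clim_S (u : nat -> C) (L : C) : Clim u L <-> Clim (fun n => u (S n)) L.
Proof.
  split; intros H eps Heps; destruct (H eps Heps) as [N HN].
  - exists N. intros n Hn. apply HN. lia.
  - exists (S N). intros [|n] Hn; [lia|]. apply HN. lia.
Qed.

Lemma inv_INR_small (K eps : R) : (0 < eps)%R -> exists N : nat, forall n, (N <= n)%nat -> (K / (INR n + 1) < eps)%R.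
Proof.
  intros Heps. destruct (INR_unbounded (K / eps)) as [N HN]. exists N. intros n Hn.
  apply le_INR in Hn. generalize (pos_INR n). intros.
  apply (Rmult_lt_reg_r (INR n + 1)); [lra|].
  replace (K / (INR n + 1) * (INR n + 1))%R with K by (field; lra).
  apply (Rmult_lt_compat_r eps) in HN; [|auto].
  replace (K / eps * eps)%R with K in HN by (field; lra). nra.
Qed.

Lemma Clim_of_Cauchy (u : nat -> C) (K : R) :
  (forall N m, (Cmod (u (N + m)%nat - u N) <= K / (INR N + 1))%R) ->
  exists L, Clim u L /\ forall N, (Cmod (L - u N) <= K / (INR N + 1))%R.
Proof.
  intros H.
  assert (Cs : forall f : nat -> R, (forall N m, (Rabs (f (N + m)%nat - f N) <= K / (INR N + 1))%R) ->
     exists x, forall eps, (0 < eps)%R -> exists N, forall n, (N <= n)%nat -> (Rabs (f n - x) < eps)%R).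
  { intros f Hf.
    assert (Cf : Cauchy_crit f).
    { intros eps Heps. destruct (inv_INR_small K (eps / 2) ltac:(lra)) as [N HN].
      exists N. intros n m Hn Hm. unfold Rdist.
      pose proof (Hf N (n - N)%nat) as H1. pose proof (Hf N (m - N)%nat) as H2.
      specialize (HN N (le_n N)).
      replace (N + (n - N))%nat with n in H1 by lia. replace (N + (m - N))%nat with m in H2 by lia.
      replace (f n - f m)%R with ((f n - f N) - (f m - f N))%R by ring.
      eapply Rle_lt_trans; [apply Rabs_triang|]. rewrite Rabs_Ropp. lra. }
    destruct (Rcomplete.R_complete f Cf) as [x Hx]. exists x. exact Hx. }
  destruct (Cs (fun n => Re (u n))) as [x Hx].
  { intros N m. eapply Rle_trans; [|apply (H N m)]. apply (re_le_Cmod (u (N + m)%nat - u N)). }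
  destruct (Cs (fun n => Im (u n))) as [y Hy].
  { intros N m. eapply Rle_trans; [|apply (H N m)]. apply (Im_le_Cmod (u (N + m)%nat - u N)). }
  assert (HL : Clim u (x, y)).
  { intros eps Heps. destruct (Hx (eps / 2)%R ltac:(lra)) as [N1 H1].
    destruct (Hy (eps / 2)%R ltac:(lra)) as [N2 H2].
    exists (max N1 N2). intros n Hn. eapply Rle_lt_trans; [apply Cmod_le_Re_Im|].
    specialize (H1 n ltac:(lia)). specialize (H2 n ltac:(lia)).
    change (Rabs (Re (u n) - x) + Rabs (Im (u n) - y) < eps)%R. lra. }
  exists (x, y). split; [exact HL|]. intros N.
  apply le_epsilon. intros eps Heps. destruct (HL eps Heps) as [M HM].
  specialize (HM (N + M)%nat ltac:(lia)). rewrite Cmod_minus_sym in HM.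
  replace ((x, y) - u N) with (((x, y) - u (N + M)%nat) + (u (N + M)%nat - u N)) by ring.
  eapply Rle_trans; [apply Cmod_triangle|]. specialize (H N M). lra.
Qed.

(** [lim] is an abstract operator specified only on Cauchy filters. Convergence makes the filter
    Cauchy, and uniqueness of limits identifies its value. *)
Lemma lim_eventually (u : nat -> C) (L : C) :
  Clim u L -> lim (T := C_CompleteNormedModule) (filtermap u eventually) = L.
Proof.
  intros H.
  assert (F : forall eps : posreal, filtermap u eventually (ball (L : C_UniformSpace) eps)).
  { intros eps. destruct (H eps (cond_pos eps)) as [N HN]. exists N. intros n Hn.
    apply C_NormedModule_mixin_compat1. apply HN. exact Hn. }
  pose proof (complete_cauchy (T := C_CompleteNormedModule) (filtermap u eventually)
    (filtermap_proper_filter _ _ _ _ _) (fun eps => ex_intro _ L (F eps))) as G.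
  set (L' := lim _) in *.
  apply (Clim_unique u); [|exact H].
  intros eps Heps. assert (He : (0 < eps / 2)%R) by lra.
  destruct (G (mkposreal _ He)) as [N HN]. exists N. intros n Hn.
  apply (fun h => Rlt_le_trans _ _ _ (C_NormedModule_mixin_compat2 L' (u n) _ (HN n Hn)) h).
  simpl. generalize sqrt2_lt_2. nra.
Qed.

(** * The denominators d_k and the entries of the products *)

Definition denom (l : C) (k : nat) : C := (RtoC (INR k) - 1 / 2) ^ 2 - l ^ 2 / 4.

Lemma coeff_Mmult (A B : @matrix C 2 2) (i j : nat) : (i < 2)%nat -> (j < 2)%nat ->
  coeff_mat (0 : C) (Mmult (T := C_Ring) A B) i j =
  coeff_mat (0 : C) A i 0 * coeff_mat (0 : C) B 0 j + coeff_mat (0 : C) A i 1 * coeff_mat (0 : C) B 1 j.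
Proof.
  intros Hi Hj. unfold Mmult. rewrite coeff_mat_bij by auto.
  cbn [Init.Nat.pred]. rewrite sum_Sn, sum_O. reflexivity.
Qed.

Lemma Mprod_S (lambda mu l : C) (k N : nat) :
  Mprod lambda mu l k (S N) = Mmult (T := C_Ring) (M lambda mu l k) (Mprod lambda mu l (S k) N).
Proof.
  induction N as [|N IH].
  - cbn [Mprod]. rewrite Mmult_one_l, Mmult_one_r. now rewrite Nat.add_0_r.
  - cbn [Mprod] in *. rewrite IH, Mmult_assoc.
    now replace (k + S N)%nat with (S k + N)%nat by lia.
Qed.

(** A finite minimum settles the small i; for i > 2 |a| + 1 the triangle inequality gives |i + a| >=
    (i + 1) / 2. *)
Lemma lin_lower (a : C) :
  (forall i : nat, INR i + a <> 0) ->
  exists d : R, (0 < d)%R /\ forall i : nat, (d * (INR i + 1) <= Cmod (INR i + a))%R.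
Proof.
  intros Ha.
  assert (Fin : forall N : nat, exists d : R, (0 < d)%R /\ forall i : nat, (i < N)%nat -> (d * (INR i + 1) <= Cmod (INR i + a))%R).
  { induction N as [|N [d [Hd IH]]].
    - exists 1%R. split; [lra|]. intros i Hi. lia.
    - assert (HN := pos_INR N).
      assert (HC : (0 < Cmod (INR N + a))%R) by (apply Cmod_gt_0, Ha).
      exists (Rmin d (Cmod (INR N + a) / (INR N + 1))). split.
      { apply Rmin_pos; [auto|]. apply Rdiv_lt_0_compat; lra. }
      intros i Hi. assert (Hi0 := pos_INR i). destruct (Nat.eq_dec i N) as [->|Hne].
      + apply Rle_trans with (Cmod (INR N + a) / (INR N + 1) * (INR N + 1))%R.
        * apply Rmult_le_compat_r; [lra|apply Rmin_r].
        * right. field. lra.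
      + apply Rle_trans with (d * (INR i + 1))%R; [|apply IH; lia].
        apply Rmult_le_compat_r; [lra|apply Rmin_l]. }
  destruct (INR_unbounded (2 * Cmod a + 1)) as [N HN].
  destruct (Fin N) as [d [Hd HdN]].
  exists (Rmin d (1 / 2)). split; [apply Rmin_pos; lra|].
  intros i. assert (Hi0 := pos_INR i). destruct (Nat.lt_ge_cases i N) as [Hi|Hi].
  - apply Rle_trans with (d * (INR i + 1))%R; [|apply HdN; lia].
    apply Rmult_le_compat_r; [lra|apply Rmin_l].
  - apply Rle_trans with (1 / 2 * (INR i + 1))%R; [apply Rmult_le_compat_r; [lra|apply Rmin_r]|].
    apply le_INR in Hi.
    generalize (Cmod_triangle_rev (INR i) (- a)). rewrite Cmod_opp, Cmod_R, Rabs_pos_eq by auto.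
    replace (INR i - - a) with (INR i + a) by ring. lra.
Qed.

(** Here the exclusion of odd l acts: these linear factors make up all d_k and, after shifts of k,
    the outer coefficients of the recurrence. *)
Lemma not_odd_shift (l : C) (hl : forall m : Z, l <> RtoC (IZR (2 * m + 1))) (k : Z) :
  IZR k - 1 / 2 - l / 2 <> 0 /\ IZR k - 1 / 2 + l / 2 <> 0.
Proof.
  split; intros E.
  - apply (hl (k - 1)%Z). transitivity (2 * (IZR k - 1 / 2 - l / 2) + l); [rewrite E; ring|].
    rewrite plus_IZR, mult_IZR, minus_IZR, RtoC_plus, RtoC_mult, RtoC_minus. field.
  - apply (hl (- k)%Z). transitivity (- 2 * (IZR k - 1 / 2 + l / 2) + l); [rewrite E; ring|].
    rewrite plus_IZR, mult_IZR, opp_IZR, RtoC_plus, RtoC_mult, !RtoC_opp. field.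
Qed.

Lemma denom_factor (l : C) (k : nat) : denom l k = (INR k - 1 / 2 - l / 2) * (INR k - 1 / 2 + l / 2).
Proof. unfold denom. field. Qed.

Lemma denom_neq_0 (l : C) (hl : forall m : Z, l <> RtoC (IZR (2 * m + 1))) (k : nat) : denom l k <> 0.
Proof.
  rewrite denom_factor, INR_IZR_INZ. now apply Cmult_neq_0; apply not_odd_shift.
Qed.

(** The comparison is with (k + 1) (k + 2) because the sum of its inverses telescopes, which gives
    explicit tails in [p_limit]. *)
Lemma denom_lower (l : C) (hl : forall m : Z, l <> RtoC (IZR (2 * m + 1))) :
  exists d : R, (0 < d)%R /\ forall k : nat, (d * ((INR k + 1) * (INR k + 2)) <= Cmod (denom l k))%R.
Proof.
  destruct (lin_lower (- (1 / 2) - l / 2)) as [d1 [Hd1 H1]].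
  { intros i E. apply (proj1 (not_odd_shift l hl (Z.of_nat i))). rewrite <- INR_IZR_INZ, <- E. ring. }
  destruct (lin_lower (- (1 / 2) + l / 2)) as [d2 [Hd2 H2]].
  { intros i E. apply (proj2 (not_odd_shift l hl (Z.of_nat i))). rewrite <- INR_IZR_INZ, <- E. ring. }
  exists (d1 * d2 / 2)%R. split; [nra|]. intros k. rewrite denom_factor, Cmod_mult.
  specialize (H1 k). specialize (H2 k). assert (Hk := pos_INR k).
  replace (INR k - 1 / 2 - l / 2) with (INR k + (- (1 / 2) - l / 2)) by ring.
  replace (INR k - 1 / 2 + l / 2) with (INR k + (- (1 / 2) + l / 2)) by ring.
  apply Rle_trans with ((d1 * (INR k + 1)) * (d2 * (INR k + 1)))%R.
  - assert (0 < d1 * d2)%R by nra. nra.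
  - apply Rmult_le_compat; auto; apply Rmult_le_pos; lra.
Qed.

Section Rcoef.
Variables (lambda mu l : C).
Hypothesis hl : forall m : Z, l <> RtoC (IZR (2 * m + 1)).

Let p (k N : nat) : C := coeff_mat (0 : C) (Mprod lambda mu l k N) 0 0.
Let q (k N : nat) : C := coeff_mat (0 : C) (Mprod lambda mu l k N) 0 1.

Local Lemma coeff_M (k i j : nat) : (i < 2)%nat -> (j < 2)%nat ->
  coeff_mat (0 : C) (M lambda mu l k) i j =
   match i, j with
    | 0%nat, 0%nat => 1 + lambda / denom l k
    | 0%nat, _     => mu ^ 2 / denom l k
    | _,     0%nat => 1
    | _,     _     => 0
    end.
Proof. intros Hi Hj. unfold M. now rewrite coeff_mat_bij. Qed.

Local Lemma p_right (k N : nat) : p k (S N) = p k N * (1 + lambda / denom l (k + N)) + q k N.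
Proof. unfold p, q. cbn [Mprod]. rewrite coeff_Mmult, !coeff_M by lia. ring. Qed.

Local Lemma q_right (k N : nat) : q k (S N) = p k N * (mu ^ 2 / denom l (k + N)).
Proof. unfold p, q. cbn [Mprod]. rewrite coeff_Mmult, !coeff_M by lia. ring. Qed.

(** The second row of M_k is (1, 0), so the left factor M_k copies the first row of the remaining
    product into the second. In the limit R_(k,21) = R_(k+1,11). *)
Local Lemma y_left (k N : nat) : coeff_mat (0 : C) (Mprod lambda mu l k (S N)) 1 0 = p (S k) N.
Proof. unfold p. rewrite Mprod_S, coeff_Mmult, !coeff_M by lia. ring. Qed.

Local Lemma p_left (k N : nat) :
  p k (S (S N)) = (1 + lambda / denom l k) * p (S k) (S N) + (mu ^ 2 / denom l k) * p (S (S k)) N.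
Proof.
  unfold p. rewrite Mprod_S, coeff_Mmult, !coeff_M by lia. rewrite y_left. reflexivity.
Qed.

Local Lemma pq_0 (k : nat) : p k 0 = 1 /\ q k 0 = 0.
Proof. split; reflexivity. Qed.

(** A discrete Gronwall bound keeps the first rows bounded uniformly in k and N; then p + q has
    telescoping increments and q tends to 0. The tail estimate shows that x_k tends to 1, so that
    the decaying solutions built from it are not trivial. *)
Local Lemma p_limit : exists K : R, forall k, exists x : C,
  Clim (p k) x /\ (Cmod (x - 1) <= K / (INR k + 1))%R.
Proof.
  destruct (denom_lower l hl) as [d [Hd Hden]].
  assert (P1 := Cmod_ge_0 lambda). assert (P2 := Cmod_ge_0 (mu ^ 2)).
  set (A := ((Cmod lambda + Cmod (mu ^ 2)) / d)%R).
  assert (HA : (0 <= A)%R) by (apply Rdiv_le_0_compat; lra).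
  set (e := fun k : nat => (A * (/ (INR k + 1) - / (INR k + 2)))%R).
  assert (Epos : forall k, (0 <= e k)%R).
  { intros k. assert (Hk := pos_INR k). apply Rmult_le_pos; [auto|].
    assert (/ (INR k + 2) <= / (INR k + 1))%R by (apply Rinv_le_contravar; lra). lra. }
  assert (HB : forall k, (Cmod (lambda / denom l k) + Cmod (mu ^ 2 / denom l k) <= e k)%R).
  { intros k. assert (Hk := pos_INR k). specialize (Hden k).
    set (k2 := ((INR k + 1) * (INR k + 2))%R) in *.
    assert (Hk2 : (0 < k2)%R) by (unfold k2; nra).
    assert (Hdk : (0 < d * k2)%R) by now apply Rmult_lt_0_compat.
    rewrite !Cmod_div by (now apply denom_neq_0). unfold Rdiv. rewrite <- Rmult_plus_distr_r.
    apply Rle_trans with ((Cmod lambda + Cmod (mu ^ 2)) * / (d * k2))%R.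
    - apply Rmult_le_compat_l; [lra|]. apply Rinv_le_contravar; auto.
    - right. unfold e, A, k2. field. repeat split; lra. }
  assert (Tel : forall k N : nat, (e (k + N)%nat = A / (INR (k + N) + 1) - A / (INR (k + N) + 2))%R).
  { intros k N. unfold e. field. generalize (pos_INR (k + N)); split; lra. }
  (* The sum of the [e] j for k <= j < k + N. *)
  set (s := fun k N : nat => (A / (INR k + 1) - A / (INR (k + N) + 1))%R).
  assert (Hs : forall k N, (0 <= s k N <= A)%R /\ (s k (S N) = s k N + e (k + N)%nat)%R).
  { intros k N. split.
    - unfold s. assert (Hk := pos_INR k). rewrite plus_INR. assert (HN := pos_INR N).
      assert (/ (INR k + INR N + 1) <= / (INR k + 1))%R by (apply Rinv_le_contravar; lra).
      assert (/ (INR k + 1) <= 1)%R by (rewrite <- Rinv_1; apply Rinv_le_contravar; lra).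
      assert (0 < / (INR k + INR N + 1))%R by (apply Rinv_0_lt_compat; lra).
      unfold Rdiv. split; nra.
    - rewrite Tel. unfold s. rewrite Nat.add_succ_r, S_INR.
      replace (INR (k + N) + 1 + 1)%R with (INR (k + N) + 2)%R by ring. ring. }
  assert (T : forall k N, (Cmod (p k N) + Cmod (q k N) <= exp (s k N))%R).
  { intros k. induction N as [|N IH].
    - destruct (pq_0 k) as [-> ->]. rewrite Cmod_1, Cmod_0.
      replace (s k 0%nat) with 0%R by (unfold s; rewrite Nat.add_0_r; ring). rewrite exp_0. lra.
    - rewrite (proj2 (Hs k N)), exp_plus, p_right, q_right.
      specialize (HB (k + N)%nat). set (D := denom l (k + N)) in *.
      assert (G1 := Cmod_ge_0 (p k N)). assert (G2 := Cmod_ge_0 (q k N)).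
      apply Rle_trans with ((Cmod (p k N) + Cmod (q k N)) * (1 + e (k + N)%nat))%R.
      + rewrite (Cmod_mult (p k N) (mu ^ 2 / D)).
        assert (Cmod (p k N * (1 + lambda / D) + q k N) <= Cmod (p k N) * (1 + Cmod (lambda / D)) + Cmod (q k N))%R.
        { eapply Rle_trans; [apply Cmod_triangle|]. apply Rplus_le_compat_r. rewrite Cmod_mult.
          apply Rmult_le_compat_l; [auto|]. eapply Rle_trans; [apply Cmod_triangle|]. rewrite Cmod_1. lra. }
        specialize (Epos (k + N)%nat). nra.
      + apply Rmult_le_compat; auto; [lra|specialize (Epos (k + N)%nat); lra|apply exp_ineq1_le]. }
  set (E := exp A).
  assert (HE : (0 < E)%R) by apply exp_pos.
  assert (PB : forall k N, (Cmod (p k N) <= E)%R).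
  { intros k N. apply Rle_trans with (exp (s k N)); [specialize (T k N); generalize (Cmod_ge_0 (q k N)); lra|].
    destruct (Hs k N) as [[_ H] _]. destruct H as [H| ->]; [left; now apply exp_increasing|apply Rle_refl]. }
  (* In p + q the old q cancels, and the increment is p times (lambda + mu^2) / d. *)
  set (w := fun k N : nat => p k N + q k N).
  assert (W1 : forall k N, (Cmod (w k (S N) - w k N) <= E * e (k + N)%nat)%R).
  { intros k N. unfold w. rewrite p_right, q_right.
    specialize (HB (k + N)%nat). set (D := denom l (k + N)) in *.
    replace (p k N * (1 + lambda / D) + q k N + p k N * (mu ^ 2 / D) - (p k N + q k N))
      with (p k N * (lambda / D + mu ^ 2 / D)) by ring.
    rewrite Cmod_mult. apply Rmult_le_compat; try apply Cmod_ge_0; auto.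
    eapply Rle_trans; [apply Cmod_triangle|exact HB]. }
  assert (W2 : forall k N m, (Cmod (w k (N + m)%nat - w k N) <= E * A / (INR (k + N) + 1) - E * A / (INR (k + N + m) + 1))%R).
  { intros k N. induction m as [|m IH].
    - rewrite !Nat.add_0_r. rewrite Cmod_diag. lra.
    - replace (w k (N + S m)%nat - w k N) with ((w k (S (N + m)) - w k (N + m)%nat) + (w k (N + m)%nat - w k N))
        by (rewrite Nat.add_succ_r; ring).
      eapply Rle_trans; [apply Cmod_triangle|]. specialize (W1 k (N + m)%nat).
      rewrite Tel, Nat.add_assoc in W1.
      replace (INR (k + N + S m) + 1)%R with (INR (k + N + m) + 2)%R by (rewrite Nat.add_succ_r, S_INR; ring).
      unfold Rdiv in *. lra. }
  assert (W3 : forall k N m, (Cmod (w k (N + m)%nat - w k N) <= E * A / (INR N + 1))%R).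
  { intros k N m. eapply Rle_trans; [apply W2|].
    rewrite !plus_INR. generalize (pos_INR k) (pos_INR N) (pos_INR m). intros.
    assert (/ (INR k + INR N + 1) <= / (INR N + 1))%R by (apply Rinv_le_contravar; lra).
    assert (0 < / (INR k + INR N + INR m + 1))%R by (apply Rinv_0_lt_compat; lra).
    assert (0 <= E * A)%R by (apply Rmult_le_pos; lra). unfold Rdiv. nra. }
  exists (E * A)%R. intros k.
  destruct (Clim_of_Cauchy (w k) (E * A) (W3 k)) as [x [Hx _]].
  exists x. split.
  - assert (Q : Clim (q k) 0).
    { apply Clim_S. intros eps Heps.
      destruct (inv_INR_small (E * A) eps Heps) as [N HN]. exists N. intros n Hn.
      specialize (HN n Hn). rewrite q_right. replace (p k n * (mu ^ 2 / denom l (k + n)) - 0) with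
        (p k n * (mu ^ 2 / denom l (k + n))) by ring. rewrite Cmod_mult.
      apply Rle_lt_trans with (2 := HN).
      specialize (HB (k + n)%nat).
      apply Rle_trans with (E * e (k + n)%nat)%R.
      - apply Rmult_le_compat; try apply Cmod_ge_0; auto.
        generalize (Cmod_ge_0 (lambda / denom l (k + n))). lra.
      - unfold Rdiv. rewrite Rmult_assoc. apply Rmult_le_compat_l; [lra|].
        unfold e. apply Rmult_le_compat_l; [auto|].
        rewrite plus_INR. generalize (pos_INR k) (pos_INR n). intros.
        assert (/ (INR k + INR n + 1) <= / (INR n + 1))%R by (apply Rinv_le_contravar; lra).
        assert (0 < / (INR k + INR n + 2))%R by (apply Rinv_0_lt_compat; lra). lra. }
    replace x with (x + (- (1)) * 0) by ring.
    apply Clim_ext with (fun n => w k n + (- (1)) * q k n).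
    + intros n. unfold w. ring.
    + apply Clim_plus; [auto|now apply Clim_scal].
  - apply le_epsilon. intros eps Heps. destruct (Hx eps Heps) as [N HN].
    specialize (HN N (le_n N)). rewrite Cmod_minus_sym in HN.
    specialize (W2 k 0%nat N). rewrite Nat.add_0_r, Nat.add_0_l in W2.
    assert (W0 : w k 0%nat = 1) by (unfold w; destruct (pq_0 k) as [-> ->]; ring).
    rewrite W0 in W2.
    replace (x - 1) with ((x - w k N) + (w k N - 1)) by ring.
    eapply Rle_trans; [apply Cmod_triangle|].
    assert (0 <= E * A / (INR (k + N) + 1))%R.
    { apply Rdiv_le_0_compat; [apply Rmult_le_pos; lra|]. generalize (pos_INR (k + N)); lra. }
    lra.
Qed.

Lemma Rcoef_spec :
  (forall k, Rcoef lambda mu l k 2 1 = Rcoef lambda mu l (S k) 1 1) /\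
  (forall k, Rcoef lambda mu l k 1 1 =
     (1 + lambda / denom l k) * Rcoef lambda mu l (S k) 1 1
     + mu ^ 2 / denom l k * Rcoef lambda mu l (S (S k)) 1 1) /\
  exists K : R, forall k, (Cmod (Rcoef lambda mu l k 1 1 - 1) <= K / (INR k + 1))%R.
Proof.
  destruct p_limit as [K HK].
  assert (L : forall k, Clim (p k) (Rcoef lambda mu l k 1 1)).
  { intros k. destruct (HK k) as [x [Hx _]].
    unfold Rcoef, Rmat. rewrite coeff_mat_bij by (simpl; lia). simpl pred.
    pose proof (lim_eventually _ _ Hx) as E. unfold p in *. rewrite E. exact Hx. }
  split; [|split].
  - intros k. unfold Rcoef at 1, Rmat. rewrite coeff_mat_bij by (simpl; lia). simpl pred.
    apply lim_eventually. apply Clim_S. apply Clim_ext with (p (S k)); [|apply L].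
    intros n. symmetry. apply y_left.
  - intros k. apply (Clim_unique (fun n => p k (S (S n)))).
    + exact (proj1 (Clim_S _ _) (proj1 (Clim_S _ _) (L k))).
    + apply Clim_ext with (1 := fun n => eq_sym (p_left k n)).
      exact (Clim_plus _ _ _ _ (Clim_scal _ _ _ (proj1 (Clim_S _ _) (L (S k))))
        (Clim_scal _ _ _ (L (S (S k))))).
  - exists K. intros k. destruct (HK k) as [x [Hx Hx1]].
    now rewrite (Clim_unique _ _ _ (L k) Hx).
Qed.
End Rcoef.

(** * The three-term recurrence *)

(** Both convergence of the power series on the whole plane and the decay that singles out the
    recessive solution of the recurrence. *)
Definition entire (a : nat -> C) : Prop := forall r : R, (0 < r)%R -> geom a r.

Lemma entire_scal (c : C) (a : nat -> C) : entire a -> entire (fun n => c * a n).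
Proof. intros H r Hr. now apply geom_scal, H. Qed.

Lemma entire_plus (a b : nat -> C) : entire a -> entire b -> entire (fun n => a n + b n).
Proof. intros H H' r Hr. apply geom_plus; auto. Qed.

Lemma entire_S (a : nat -> C) : entire a -> entire (fun n => a (S n)).
Proof. intros H r Hr. now apply geom_shift, H. Qed.

Lemma entire_shift_right (a : nat -> C) : entire a -> entire (shift_right a).
Proof. intros H r Hr. apply geom_shift_right; auto. Qed.

Lemma entire_INR (a : nat -> C) : entire a -> entire (fun n => INR n * a n).
Proof.
  intros H r Hr. replace r with (2 * (r / 2))%R by field. apply geom_INR; try lra. apply H. lra.
Qed.

Lemma entire_dcoef (a : nat -> C) : entire a -> entire (dcoef a).
Proof. intros H. apply (entire_S (fun n => INR n * a n)), entire_INR, H. Qed.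

Lemma entire_bounded_mult (a x : nat -> C) (B : R) :
  (forall n, (Cmod (x n) <= B)%R) -> entire a -> entire (fun n => a n * x n).
Proof.
  intros HB H r Hr. destruct (H r Hr) as [K HK]. exists (K * B)%R. intros n. rewrite Cmod_mult.
  replace (K * B * r ^ n)%R with (K * r ^ n * B)%R by ring.
  apply Rmult_le_compat; auto; apply Cmod_ge_0.
Qed.

Lemma geom_of_ratio (a : nat -> C) (r : R) (J : nat) :
  (0 < r)%R -> (forall j, (J <= j)%nat -> (Cmod (a (S j)) <= r * Cmod (a j))%R) -> geom a r.
Proof.
  intros Hr H.
  assert (Fin : forall N, exists K, forall j, (j <= N)%nat -> (Cmod (a j) <= K * r ^ j)%R).
  { induction N as [|N [K HK]].
    - exists (Cmod (a 0%nat)). intros j Hj. replace j with 0%nat by lia. simpl. lra.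
    - exists (Rmax K (Cmod (a (S N)) / r ^ S N)). intros j Hj.
      assert (Hp : (0 < r ^ j)%R) by now apply pow_lt.
      destruct (Nat.eq_dec j (S N)) as [->|Hne].
      + apply Rle_trans with (Cmod (a (S N)) / r ^ S N * r ^ S N)%R.
        * right. field. lra.
        * apply Rmult_le_compat_r; [lra|apply Rmax_r].
      + apply Rle_trans with (K * r ^ j)%R; [apply HK; lia|].
        apply Rmult_le_compat_r; [lra|apply Rmax_l]. }
  destruct (Fin J) as [K HK]. exists K.
  induction n as [|n IH]; [apply HK; lia|].
  destruct (Nat.le_gt_cases (S n) J) as [Hn|Hn]; [now apply HK|].
  eapply Rle_trans; [apply H; lia|]. simpl. nra.
Qed.

(** Up to normalisation zeta^i / Gamma (i - 1/2 - l/2). Dividing by this factor turns the recurrence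
    for the Fourier coefficients into the one for x_k, and it makes the solutions decay faster than
    every geometric sequence. *)
Fixpoint gam (l zeta : C) (i : nat) : C :=
  match i with
  | O => 1
  | S j => zeta / (INR j - 1 / 2 - l / 2) * gam l zeta j
  end.

(* [W i = u i * v (i + 1) - u (i + 1) * v i] satisfies [D i * W i = - B i * W (i + 1)], so it
   cannot decay faster than every geometric sequence unless it vanishes. *)
Lemma casoratian_zero (A B D u v : nat -> C) (L K : R) :
  (forall i, A i * u (S i) + B i * u (S (S i)) = D i * u i) ->
  (forall i, A i * v (S i) + B i * v (S (S i)) = D i * v i) ->
  (forall i, D i <> 0) -> (0 < L)%R -> (forall i, (Cmod (B i) <= L * Cmod (D i))%R) ->
  (forall i, (Cmod (u i) <= K)%R) -> entire v ->
  u 0%nat * v 1%nat = u 1%nat * v 0%nat.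
Proof.
  intros Hu Hv HD HL HB HK Hent.
  set (W := fun i => u i * v (S i) - u (S i) * v i).
  assert (Wrec : forall i, D i * W i = - (B i * W (S i))).
  { intros i. unfold W.
    transitivity ((D i * u i) * v (S i) - u (S i) * (D i * v i)); [ring|].
    rewrite <- Hu, <- Hv. ring. }
  assert (Wle : forall i, (Cmod (W i) <= L * Cmod (W (S i)))%R).
  { intros i. specialize (Wrec i). apply (f_equal Cmod) in Wrec. rewrite Cmod_opp, !Cmod_mult in Wrec.
    assert (Hd : (0 < Cmod (D i))%R) by now apply Cmod_gt_0.
    apply (Rmult_le_reg_l (Cmod (D i))); [auto|]. rewrite Wrec.
    specialize (HB i). generalize (Cmod_ge_0 (W (S i))). nra. }
  assert (W0 : forall n, (Cmod (W 0%nat) <= L ^ n * Cmod (W n))%R).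
  { induction n as [|n IH]; [simpl; lra|].
    eapply Rle_trans; [exact IH|]. simpl.
    specialize (Wle n). assert (0 < L ^ n)%R by now apply pow_lt. nra. }
  assert (HK0 : (0 <= K)%R) by (generalize (HK 0%nat) (Cmod_ge_0 (u 0%nat)); lra).
  (* With decay of ratio / (2 L), the bound L^n |W n| on |W 0| becomes a constant times 2^(-n). *)
  set (r := (/ (2 * L))%R).
  assert (Hr : (0 < r)%R) by (apply Rinv_0_lt_compat; lra).
  destruct (Hent r Hr) as [K2 HK2].
  assert (Wn : forall n, (Cmod (W n) <= K * K2 * (1 + r) * r ^ n)%R).
  { intros n. unfold W. eapply Rle_trans; [apply Cmod_triangle|]. rewrite Cmod_opp, !Cmod_mult.
    replace (K * K2 * (1 + r) * r ^ n)%R with (K * (K2 * r ^ S n) + K * (K2 * r ^ n))%R by (simpl; ring).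
    apply Rplus_le_compat; apply Rmult_le_compat; auto; apply Cmod_ge_0. }
  assert (Z : Cmod (W 0%nat) = 0%R).
  { apply Rle_antisym; [|apply Cmod_ge_0]. apply le_epsilon. intros eps Heps. rewrite Rplus_0_l.
    set (Q := (K * K2 * (1 + r))%R).
    destruct (pow_lt_1_zero (/ 2) ltac:(rewrite Rabs_pos_eq; lra) (eps / (Rabs Q + 1)))%R as [N HN].
    { apply Rdiv_lt_0_compat; [auto|]. generalize (Rabs_pos Q); lra. }
    specialize (HN N (le_n N)). rewrite Rabs_pos_eq in HN by (apply pow_le; lra).
    eapply Rle_trans; [apply (W0 N)|].
    apply Rle_trans with (L ^ N * (Q * r ^ N))%R; [apply Rmult_le_compat_l; [apply pow_le; lra|apply Wn]|].
    replace (L ^ N * (Q * r ^ N))%R with (Q * (L * r) ^ N)%R by (rewrite Rpow_mult_distr; ring).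
    replace (L * r)%R with (/ 2)%R by (unfold r; field; lra).
    assert (Hp : (0 <= (/ 2) ^ N)%R) by (apply pow_le; lra).
    apply Rle_trans with ((Rabs Q + 1) * (/ 2) ^ N)%R.
    - apply Rmult_le_compat_r; [auto|]. generalize (Rle_abs Q); lra.
    - apply (Rmult_lt_compat_l (Rabs Q + 1)) in HN; [|generalize (Rabs_pos Q); lra].
      replace ((Rabs Q + 1) * (eps / (Rabs Q + 1)))%R with eps in HN
        by (field; generalize (Rabs_pos Q); lra). lra. }
  apply Cmod_eq_0 in Z. unfold W in Z. now apply Ceq_minus.
Qed.

Lemma Cdiv_neq_0 (x y : C) : x <> 0 -> y <> 0 -> x / y <> 0.
Proof.
  intros Hx Hy E. apply Hx. transitivity (x / y * y); [now field|]. rewrite E. ring.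
Qed.

(* [field] asks for [2 E <> 0] with denominators cleared where [E <> 0] is known. *)
Ltac clear_halves :=
  cbv beta; repeat split; auto;
  match goal with
  | H : ?E <> RtoC 0 |- ?T <> RtoC 0 =>
      let Z := fresh in
      intros Z; apply H; replace E with (T / 2) by field; rewrite Z; field
  end.

Section Solutions.
Variables (lambda mu l z0 : C).
Hypothesis hl : forall m : Z, l <> RtoC (IZR (2 * m + 1)).
Hypothesis hmu : mu <> 0.
Hypothesis hz0 : z0 <> 0.

Local Notation X k := (Rcoef lambda mu l k 1 1).
Local Notation b := ((1 - l) / 2).

Lemma lin_neq_0 (i : nat) : INR i - 1 / 2 - l / 2 <> 0 /\ INR i - 1 / 2 + l / 2 <> 0.
Proof. rewrite INR_IZR_INZ. now apply not_odd_shift. Qed.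

Lemma gam_entire (zeta : C) : entire (gam l zeta).
Proof.
  intros r Hr.
  destruct (lin_lower (- (1 / 2) - l / 2)) as [d [Hd H]].
  { intros i E. apply (proj1 (lin_neq_0 i)). rewrite <- E. ring. }
  destruct (INR_unbounded (Cmod zeta / (d * r))) as [J HJ].
  apply geom_of_ratio with J; [auto|]. intros j Hj. cbn [gam]. rewrite Cmod_mult.
  apply Rmult_le_compat_r; [apply Cmod_ge_0|].
  rewrite Cmod_div by apply lin_neq_0. specialize (H j).
  replace (INR j - 1 / 2 - l / 2) with (INR j + (- (1 / 2) - l / 2)) by ring.
  apply le_INR in Hj. generalize (pos_INR j) (Cmod_ge_0 zeta). intros Hj0 Hz.
  assert (Hdr : (0 < d * r)%R) by now apply Rmult_lt_0_compat.
  apply (Rmult_lt_compat_r (d * r)) in HJ; [|auto].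
  replace (Cmod zeta / (d * r) * (d * r))%R with (Cmod zeta) in HJ by (field; lra).
  set (D := Cmod (INR j + (- (1 / 2) - l / 2))) in *.
  assert (HD : (0 < D)%R) by nra.
  apply (Rmult_le_reg_r D); [auto|]. unfold Rdiv. rewrite Rmult_assoc, Rinv_l by lra. nra.
Qed.

Lemma gam_neq_0 (zeta : C) (i : nat) : zeta <> 0 -> gam l zeta i <> 0.
Proof.
  intros Hz. induction i as [|i IH]; [apply C1_nz|]. cbn [gam].
  apply Cmult_neq_0; [|auto]. apply Cdiv_neq_0; [auto|apply lin_neq_0].
Qed.

(* The solutions of the recurrence decaying as [k -> +oo], resp. [k -> -oo]:
   [right_sol i] stands for [c (i - 1)] and [left_sol i] for [c (- i)]. *)
Definition right_sol (i : nat) : C := gam l (mu * z0) (S i) * X (S i).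
Definition left_sol (i : nat) : C := gam l (mu / z0) i * (X (S i) - X i).

(** Since (i + b) (i + b + l) = d_(i+1), after the gauge factor is removed this is d_(i+1) times the
    relation between x_(i+1), x_(i+2) and x_(i+3). *)
Lemma right_sol_rec (i : nat) :
  ((INR i + b) ^ 2 + l * (INR i + b) + lambda) * right_sol (S i)
  + mu / z0 * (INR i + 1 + b) * right_sol (S (S i))
  = mu * z0 * (INR i + b + l) * right_sol i.
Proof.
  unfold right_sol. destruct (Rcoef_spec lambda mu l hl) as [_ [HX _]].
  rewrite (HX (S i)). set (x2 := X (S (S i))). set (x3 := X (S (S (S i)))).
  rewrite denom_factor.
  pose proof (lin_neq_0 (S i)) as [E1 F1]. pose proof (lin_neq_0 (S (S i))) as [E2 _].
  cbn [gam]. set (g := gam l (mu * z0) i).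
  pose proof (proj1 (lin_neq_0 i)) as E0.
  rewrite !S_INR, !RtoC_plus in *. field.
  clear_halves.
Qed.

(** Multiply the relations for x_i and x_(i+1) by d_i and d_(i+1) and subtract: y_i = x_(i+1) - x_i
    satisfies d_i y_i = (d_(i+1) + lambda) y_(i+1) + mu^2 y_(i+2), which is the claim without the
    gauge factor. *)
Lemma left_sol_rec (i : nat) :
  ((- INR (S i) + b) ^ 2 + l * (- INR (S i) + b) + lambda) * left_sol (S i)
  - mu * z0 * (- INR (S i) + b + l) * left_sol (S (S i))
  = - (mu / z0 * (- INR (S i) + 1 + b)) * left_sol i.
Proof.
  unfold left_sol. destruct (Rcoef_spec lambda mu l hl) as [_ [HX _]].
  rewrite (HX i), (HX (S i)). set (x2 := X (S (S i))). set (x3 := X (S (S (S i)))).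
  rewrite !denom_factor.
  pose proof (lin_neq_0 i) as [E0 F0].
  pose proof (lin_neq_0 (S i)) as [E1 F1].
  cbn [gam]. set (g := gam l (mu / z0) i).
  rewrite !S_INR, !RtoC_plus in *. field. clear_halves.
Qed.

Lemma Rcoef_bounded : exists K : R, forall k, (Cmod (X k) <= K)%R.
Proof.
  destruct (Rcoef_spec lambda mu l hl) as [_ [_ [K HK]]]. exists (Rabs K + 1)%R. intros k.
  specialize (HK k). generalize (Cmod_triangle_rev (X k) 1). rewrite Cmod_1.
  assert (Hk := pos_INR k).
  assert (K / (INR k + 1) <= Rabs K)%R.
  { apply (Rmult_le_reg_r (INR k + 1)); [lra|].
    replace (K / (INR k + 1) * (INR k + 1))%R with K by (field; lra).
    generalize (Rle_abs K) (Rabs_pos K). nra. }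
  lra.
Qed.

Lemma right_sol_entire : entire right_sol.
Proof.
  destruct Rcoef_bounded as [K HK].
  apply (entire_bounded_mult (fun i => gam l (mu * z0) (S i)) (fun i => X (S i)) K).
  - intros i. apply HK.
  - apply entire_S, gam_entire.
Qed.

Lemma left_sol_entire : entire left_sol.
Proof.
  destruct Rcoef_bounded as [K HK].
  apply (entire_bounded_mult (gam l (mu / z0)) (fun i => X (S i) - X i) (K + K)).
  - intros i. eapply Rle_trans; [apply Cmod_triangle|]. rewrite Cmod_opp.
    apply Rplus_le_compat; apply HK.
  - apply gam_entire.
Qed.

(** As mu <> 0, the relation can be solved for the later term, so two consecutive zeros would
    annihilate all later x_k; but x_k tends to 1. *)
Lemma Rcoef_neq_0 : ~ (X 1%nat = 0 /\ X 2%nat = 0).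
Proof.
  intros [H1 H2]. destruct (Rcoef_spec lambda mu l hl) as [_ [HX [K HK]]].
  assert (Z : forall k, X (S k) = 0 /\ X (S (S k)) = 0).
  { induction k as [|k [Z1 Z2]]; [auto|]. split; [auto|].
    specialize (HX (S k)). rewrite Z1, Z2 in HX.
    pose proof (denom_neq_0 l hl (S k)) as HD.
    transitivity (denom l (S k) / mu ^ 2 * (mu ^ 2 / denom l (S k) * X (S (S (S k))))).
    - field. auto.
    - transitivity (denom l (S k) / mu ^ 2 * ((1 + lambda / denom l (S k)) * 0 + mu ^ 2 / denom l (S k) * X (S (S (S k))))); [ring|].
      rewrite <- HX. ring. }
  destruct (inv_INR_small K 1 Rlt_0_1) as [N HN].
  specialize (HN (S N) ltac:(lia)). specialize (HK (S N)). rewrite (proj1 (Z N)) in HK.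
  replace (0 - 1) with (- (1)) in HK by ring. rewrite Cmod_m1 in HK. lra.
Qed.

Lemma lin_bound (p q : C) : (forall i : nat, INR i + q <> 0) ->
  exists L : R, (0 < L)%R /\ forall i : nat, (Cmod (INR i + p) <= L * Cmod (INR i + q))%R.
Proof.
  intros Hq. destruct (lin_lower q Hq) as [d [Hd H]].
  assert (Hp := Cmod_ge_0 p).
  exists ((1 + Cmod p) / d)%R. split; [apply Rdiv_lt_0_compat; lra|].
  intros i. specialize (H i). assert (Hi := pos_INR i).
  apply Rle_trans with ((1 + Cmod p) / d * (d * (INR i + 1)))%R.
  - replace ((1 + Cmod p) / d * (d * (INR i + 1)))%R with ((1 + Cmod p) * (INR i + 1))%R by (field; lra).
    eapply Rle_trans; [apply Cmod_triangle|]. rewrite Cmod_R, Rabs_pos_eq by auto. nra.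
  - apply Rmult_le_compat_l; [apply Rdiv_le_0_compat; lra|auto].
Qed.

(* The right and left solutions are proportional. *)
Definition matching : Prop := right_sol 1 * left_sol 1 = right_sol 0 * left_sol 0.

(** On each half-line [casoratian_zero] makes the bounded solution proportional to the decaying one.
    The pair (c 0, c (-1)) is nonzero and common to both halves; eliminating it leaves the
    determinant. *)
Lemma recurrence_matching (c : Z -> C) (K : R) :
  (forall k, recurrence lambda mu l z0 b c k) ->
  (forall k, (Cmod (c k) <= K)%R) -> (exists k, c k <> 0) -> matching.
Proof.
  intros Hrec HK Hne.
  (* The two halves overlap in two indices: u 0 = v 1 = c (-1) and u 1 = v 0 = c 0. *)
  set (u := fun i : nat => c (Z.of_nat i - 1)%Z).
  set (v := fun i : nat => c (- Z.of_nat i)%Z).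
  assert (Hz1 : mu / z0 <> 0) by now apply Cdiv_neq_0.
  assert (Hz2 : mu * z0 <> 0) by now apply Cmult_neq_0.
  assert (Ru : forall i : nat, ((INR i + b) ^ 2 + l * (INR i + b) + lambda) * u (S i)
     + mu / z0 * (INR i + 1 + b) * u (S (S i)) = mu * z0 * (INR i + b + l) * u i).
  { intros i. specialize (Hrec (Z.of_nat i)). unfold recurrence in Hrec.
    rewrite <- INR_IZR_INZ in Hrec. unfold u.
    replace (Z.of_nat (S i) - 1)%Z with (Z.of_nat i) by lia.
    replace (Z.of_nat (S (S i)) - 1)%Z with (Z.of_nat i + 1)%Z by lia.
    apply Ceq_minus. exact Hrec. }
  assert (Rv : forall i : nat, ((- INR (S i) + b) ^ 2 + l * (- INR (S i) + b) + lambda) * v (S i)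
     + - (mu * z0 * (- INR (S i) + b + l)) * v (S (S i)) = - (mu / z0 * (- INR (S i) + 1 + b)) * v i).
  { intros i. specialize (Hrec (- Z.of_nat (S i))%Z). unfold recurrence in Hrec.
    rewrite opp_IZR, <- INR_IZR_INZ, RtoC_opp in Hrec. unfold v.
    replace (- Z.of_nat (S (S i)))%Z with (- Z.of_nat (S i) - 1)%Z by lia.
    replace (- Z.of_nat i)%Z with (- Z.of_nat (S i) + 1)%Z by lia.
    apply Ceq_minus. rewrite <- Hrec. ring. }
  assert (Du : forall i : nat, INR i + (b + l) <> 0).
  { intros i E. apply (proj2 (lin_neq_0 (S i))). rewrite S_INR, RtoC_plus, <- E. field. }
  assert (Bu : forall i : nat, INR i + (1 + b) <> 0).
  { intros i E. apply (proj1 (lin_neq_0 (S (S i)))). rewrite !S_INR, !RtoC_plus, <- E. field. }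
  assert (Dv : forall i : nat, INR i + (- b) <> 0).
  { intros i E. apply (proj2 (lin_neq_0 i)). rewrite <- E. field. }
  assert (Bv : forall i : nat, INR i + (1 - b - l) <> 0).
  { intros i E. apply (proj1 (lin_neq_0 (S i))). rewrite S_INR, RtoC_plus, <- E. field. }
  assert (Cu : u 0%nat * right_sol 1 = u 1%nat * right_sol 0).
  { destruct (lin_bound (1 + b) (b + l) Du) as [L [HL HB]].
    assert (Hr : (0 < Cmod (mu / z0) / Cmod (mu * z0))%R).
    { apply Rdiv_lt_0_compat; now apply Cmod_gt_0. }
    apply (casoratian_zero _ _ _ u right_sol (Cmod (mu / z0) / Cmod (mu * z0) * L) K Ru right_sol_rec).
    - intros i. apply Cmult_neq_0; [auto|]. rewrite <- Cplus_assoc. apply Du.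
    - now apply Rmult_lt_0_compat.
    - intros i. rewrite !(Cmod_mult _ (_ + _)). rewrite <- !Cplus_assoc.
      replace (Cmod (mu / z0) / Cmod (mu * z0) * L * (Cmod (mu * z0) * Cmod (INR i + (b + l))))%R
        with (Cmod (mu / z0) * (L * Cmod (INR i + (b + l))))%R.
      2:{ field. apply Rgt_not_eq. now apply Cmod_gt_0. }
      apply Rmult_le_compat_l; [apply Cmod_ge_0|apply HB].
    - intros i. apply HK.
    - apply right_sol_entire. }
  assert (Cv : v 0%nat * left_sol 1 = v 1%nat * left_sol 0).
  { destruct (lin_bound (1 - b - l) (- b) Dv) as [L [HL HB]].
    assert (Hr : (0 < Cmod (mu * z0) / Cmod (mu / z0))%R).
    { apply Rdiv_lt_0_compat; now apply Cmod_gt_0. }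
    assert (EB : forall i : nat, - (mu * z0 * (- INR (S i) + b + l)) = mu * z0 * (INR i + (1 - b - l))).
    { intros i. rewrite S_INR, RtoC_plus. ring. }
    assert (ED : forall i : nat, - (mu / z0 * (- INR (S i) + 1 + b)) = mu / z0 * (INR i + (- b))).
    { intros i. rewrite S_INR, RtoC_plus. ring. }
    apply (casoratian_zero _ _ _ v left_sol (Cmod (mu * z0) / Cmod (mu / z0) * L) K Rv).
    - intros i. rewrite <- left_sol_rec. ring.
    - intros i. rewrite ED. apply Cmult_neq_0; auto.
    - now apply Rmult_lt_0_compat.
    - intros i. rewrite ED, EB. rewrite (Cmod_mult (mu * z0) (_ + _)), (Cmod_mult (mu / z0) (_ + _)).
      replace (Cmod (mu * z0) / Cmod (mu / z0) * L * (Cmod (mu / z0) * Cmod (INR i + - b)))%R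
        with (Cmod (mu * z0) * (L * Cmod (INR i + - b)))%R.
      2:{ field. apply Rgt_not_eq. now apply Cmod_gt_0. }
      apply Rmult_le_compat_l; [apply Cmod_ge_0|apply HB].
    - intros i. apply HK.
    - apply left_sol_entire. }
  change (c (-1)%Z * right_sol 1 = c 0%Z * right_sol 0) in Cu.
  change (c 0%Z * left_sol 1 = c (-1)%Z * left_sol 0) in Cv.
  (* The outer coefficients of the recurrence do not vanish, so two consecutive zeros would
     propagate in both directions. *)
  assert (N0 : ~ (c 0%Z = 0 /\ c (-1)%Z = 0)).
  { intros [Z0 Z1]. destruct Hne as [k Hk]. apply Hk.
    assert (Up : forall i : nat, u i = 0 /\ u (S i) = 0).
    { induction i as [|i [I1 I2]]; [split; assumption|]. split; [auto|].
      specialize (Ru i). rewrite I1, I2 in Ru.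
      apply (Cmult_eq_0_reg (mu / z0 * (INR i + 1 + b))).
      - apply Cmult_neq_0; [auto|]. rewrite <- Cplus_assoc. apply Bu.
      - rewrite <- (Cplus_0_l (_ * u _)), <- (Cmult_0_r ((INR i + b) ^ 2 + l * (INR i + b) + lambda)), Ru. ring. }
    assert (Dn : forall i : nat, v i = 0 /\ v (S i) = 0).
    { induction i as [|i [I1 I2]]; [split; assumption|]. split; [auto|].
      specialize (Rv i). rewrite I1, I2 in Rv.
      apply (Cmult_eq_0_reg (- (mu * z0 * (- INR (S i) + b + l)))).
      - replace (- (mu * z0 * (- INR (S i) + b + l))) with (mu * z0 * (INR i + (1 - b - l)))
          by (rewrite S_INR, RtoC_plus; ring).
        apply Cmult_neq_0; auto.
      - rewrite <- (Cplus_0_l (_ * v _)), <- (Cmult_0_r ((- INR (S i) + b) ^ 2 + l * (- INR (S i) + b) + lambda)), Rv. ring. }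
    destruct (Z_le_gt_dec 0 k) as [H|H].
    - destruct (Up (Z.to_nat k)) as [_ E]. unfold u in E.
      now replace (Z.of_nat (S (Z.to_nat k)) - 1)%Z with k in E by lia.
    - destruct (Dn (Z.to_nat (- k))) as [E _]. unfold v in E.
      now replace (- Z.of_nat (Z.to_nat (- k)))%Z with k in E by lia. }
  unfold matching. apply Ceq_minus.
  destruct (Classical_Prop.classic (c 0%Z = 0)) as [Z0|Z0].
  - assert (Z1 : c (-1)%Z <> 0) by tauto. rewrite Z0 in Cu, Cv.
    rewrite (Cmult_eq_0_reg _ _ Z1 (eq_trans Cu (Cmult_0_l _))).
    rewrite (Cmult_eq_0_reg _ _ Z1 (eq_trans (eq_sym Cv) (Cmult_0_l _))). ring.
  - apply (Cmult_eq_0_reg (c 0%Z)); [auto|].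
    transitivity (right_sol 1 * (c 0%Z * left_sol 1) - (c 0%Z * right_sol 0) * left_sol 0); [ring|].
    rewrite Cv, <- Cu. ring.
Qed.

(** The relation at k = 0 expresses x_0 by x_1 and x_2; the determinant is then a nonzero multiple
    of lambda x_1^2 + 2 mu^2 x_1 x_2 - mu^2 x_2^2 = (lambda + mu^2) x_1^2 - mu^2 (x_1 - x_2)^2. The
    base point only enters through the nonzero factor. *)
Lemma matching_iff (omega : C) :
  omega <> 0 -> lambda + mu ^ 2 = 1 / (4 * omega ^ 2) ->
  matching <->
  (X 1%nat + 2 * omega * mu * (X 1%nat - X 2%nat) = 0 \/
   X 1%nat - 2 * omega * mu * (X 1%nat - X 2%nat) = 0).
Proof.
  intros Hw Hrel. unfold matching, right_sol, left_sol.
  destruct (Rcoef_spec lambda mu l hl) as [_ [HX _]]. rewrite (HX 0%nat).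
  set (x1 := X 1%nat). set (x2 := X 2%nat).
  pose proof (lin_neq_0 0) as [E0 F0]. pose proof (lin_neq_0 1) as [E1 F1].
  rewrite denom_factor. cbn [gam].
  set (P := x1 + 2 * omega * mu * (x1 - x2)). set (Q := x1 - 2 * omega * mu * (x1 - x2)).
  assert (Hl : lambda = 1 / (4 * omega ^ 2) - mu ^ 2) by (rewrite <- Hrel; ring).
  match goal with |- ?A = ?B <-> _ =>
    assert (Key : A - B = - (mu * z0) / (4 * omega ^ 2 * (INR 0 - 1 / 2 - l / 2) ^ 2 * (INR 1 - 1 / 2 - l / 2)) * (P * Q))
  end.
  { unfold P, Q. rewrite Hl. simpl INR in *. field. clear_halves. }
  set (k := - (mu * z0) / _) in Key.
  assert (Hk : k <> 0).
  { assert (H4 : RtoC 4 <> 0) by (intros E; apply RtoC_inj in E; lra).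
    unfold k. apply Cdiv_neq_0.
    - intros E. apply (Cmult_neq_0 _ _ hmu hz0). transitivity (- - (mu * z0)); [ring|]. rewrite E. ring.
    - repeat apply Cmult_neq_0; auto; try apply C1_nz. }
  split.
  - intros H. apply (proj1 (Ceq_minus _ _)) in H. rewrite Key in H.
    destruct (Classical_Prop.classic (P = 0)) as [HP|HP]; [now left|].
    destruct (Classical_Prop.classic (Q = 0)) as [HQ|HQ]; [now right|].
    exfalso. apply (Cmult_neq_0 k (P * Q)); auto. now apply Cmult_neq_0.
  - intros H. apply (proj2 (Ceq_minus _ _)). rewrite Key. destruct H as [-> | ->]; ring.
Qed.
End Solutions.

(** * From the recurrence to a Floquet solution *)

Lemma entire_radius (z : C) : exists r : R, (0 < r)%R /\ (r * Cmod z < 1)%R.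
Proof.
  assert (Hz := Cmod_ge_0 z). exists (/ (Cmod z + 1))%R.
  split; [apply Rinv_0_lt_compat; lra|].
  apply (Rmult_lt_reg_l (Cmod z + 1)); [lra|].
  rewrite <- Rmult_assoc, Rinv_r by lra. lra.
Qed.

Lemma entire_is_cps (a : nat -> C) (z : C) : entire a -> is_cps a z (CPS a z).
Proof.
  intros H. destruct (entire_radius z) as [r [Hr Hz]].
  apply (CPS_correct a r); auto; lra.
Qed.

Lemma CPS_plus (a c : nat -> C) (z : C) : entire a -> entire c ->
  CPS (fun n => a n + c n) z = CPS a z + CPS c z.
Proof. intros Ha Hc. apply is_cps_unique, is_cps_plus; now apply entire_is_cps. Qed.

Lemma CPS_scal (k : C) (a : nat -> C) (z : C) : entire a -> CPS (fun n => k * a n) z = k * CPS a z.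
Proof. intros Ha. apply is_cps_unique, is_cps_scal. now apply entire_is_cps. Qed.

Lemma CPS_shift_right (a : nat -> C) (z : C) : entire a -> CPS (shift_right a) z = z * CPS a z.
Proof. intros Ha. apply is_cps_unique, is_cps_shift_right. now apply entire_is_cps. Qed.

Lemma CPS_ext (a c : nat -> C) (z : C) : entire a -> (forall n, a n = c n) -> CPS a z = CPS c z.
Proof.
  intros Ha E. symmetry. apply is_cps_unique. apply is_cps_ext with (1 := E). now apply entire_is_cps.
Qed.

Lemma CPS_combination (s0 s1 s2 s3 s4 t : nat -> C) (c1 c2 c3 c4 z : C) :
  entire s0 -> entire s1 -> entire s2 -> entire s3 -> entire s4 ->
  (forall n, s0 n + (c1 * s1 n + (c2 * s2 n + (c3 * s3 n + c4 * s4 n))) = t n) ->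
  CPS s0 z + (c1 * CPS s1 z + (c2 * CPS s2 z + (c3 * CPS s3 z + c4 * CPS s4 z))) = CPS t z.
Proof.
  intros H0 H1 H2 H3 H4 E. symmetry. apply is_cps_unique. apply is_cps_ext with (1 := E).
  apply entire_is_cps with (z := z) in H0, H1, H2, H3, H4.
  exact (is_cps_plus _ _ _ _ _ H0 (is_cps_plus _ _ _ _ _ (is_cps_scal _ _ _ _ H1)
    (is_cps_plus _ _ _ _ _ (is_cps_scal _ _ _ _ H2)
      (is_cps_plus _ _ _ _ _ (is_cps_scal _ _ _ _ H3) (is_cps_scal _ _ _ _ H4))))).
Qed.

Lemma entire_const (c : C) : entire (fun n => match n with O => c | S _ => 0 end).
Proof.
  intros r Hr. exists (Cmod c). intros [|n]; simpl; [lra|]. rewrite Cmod_0.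
  apply Rmult_le_pos; [apply Cmod_ge_0|]. apply Rmult_le_pos; [lra|apply pow_le; lra].
Qed.

Lemma CPS_const (c z : C) : CPS (fun n => match n with O => c | S _ => 0 end) z = c.
Proof. apply is_cps_unique, is_cps_const. Qed.

Lemma CPS_split (a : nat -> C) (z : C) : entire a -> CPS a z = a 0%nat + z * CPS (fun n => a (S n)) z.
Proof.
  intros Ha. pose proof (entire_S a Ha) as Ha'.
  rewrite <- CPS_shift_right, <- (CPS_const (a 0%nat) z) by auto.
  rewrite <- CPS_plus; [|apply entire_const|now apply entire_shift_right].
  apply CPS_ext; [auto|]. intros [|n]; simpl; ring.
Qed.

Lemma rderiv_CPS_Cexp (a : nat -> C) (k : C) (t : R) : entire a ->
  rderiv (fun s => CPS a (Cexp (k * s))) t (k * CPS (fun n => INR n * a n) (Cexp (k * t))).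
Proof.
  intros Ha.
  apply rderiv_eq with (k * Cexp (k * t) * CPS (dcoef a) (Cexp (k * t))).
  - apply (rderiv_comp (CPS a)); [|apply rderiv_Cexp].
    destruct (entire_radius (Cexp (k * t))) as [r [Hr Hz]].
    apply (cderiv_CPS a r); auto.
  - rewrite <- Cmult_assoc, <- CPS_shift_right by (now apply entire_dcoef). f_equal.
    apply CPS_ext; [now apply entire_shift_right, entire_dcoef|].
    intros [|n]; unfold dcoef; simpl shift_right; [simpl INR; ring|reflexivity].
Qed.

(* Integrating the series termwise gives a periodic function whose derivative is constant. *)
Lemma circle_mean_zero (a m : nat -> C) (k : C) :
  k <> 0 -> Cexp k = 1 -> entire a -> entire m ->
  (forall t : R, (0 <= t <= 1)%R -> CPS a (Cexp (k * t)) + CPS m (Cexp (- k * t)) = 0) ->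
  a 0%nat + m 0%nat = 0.
Proof.
  intros Hk Ek Ha Hm Z.
  set (int := fun (s : nat -> C) (n : nat) => match n with O => RtoC 0 | S _ => / INR n * s n end).
  assert (Hint : forall s, entire s -> entire (int s)).
  { intros s Hs r Hr. destruct (Hs r Hr) as [K HK]. exists K. intros n. specialize (HK n).
    destruct n as [|n]; cbn [int].
    - unfold int. rewrite Cmod_0. generalize (Cmod_ge_0 (s 0%nat)). lra.
    - unfold int. rewrite <- RtoC_inv by (apply not_0_INR; lia).
      rewrite Cmod_mult, Cmod_R.
      assert (Hn : (1 <= INR (S n))%R) by (rewrite S_INR; generalize (pos_INR n); lra).
      rewrite Rabs_pos_eq by (left; apply Rinv_0_lt_compat; lra).
      assert (/ INR (S n) <= 1)%R by (rewrite <- Rinv_1; apply Rinv_le_contravar; lra).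
      generalize (Cmod_ge_0 (s (S n))). nra. }
  assert (Dint : forall s z, entire s -> CPS (fun n => INR n * int s n) z = CPS s z - s 0%nat).
  { intros s z Hs. rewrite (CPS_split s z Hs).
    transitivity (CPS (shift_right (fun n => s (S n))) z).
    - apply CPS_ext; [now apply entire_INR, Hint|]. intros [|n]; unfold int; cbn [shift_right]; [ring|].
      field. intros E. apply RtoC_inj in E. apply (not_0_INR (S n)) in E; [auto|lia].
    - rewrite CPS_shift_right by (now apply entire_S). ring. }
  (* [int] discards constant terms, so they are what is missing from H'. The minus sign compensates
     the exponent - k, and the rest of H' is k times the sum assumed to vanish. *)
  set (H := fun t : R => CPS (int a) (Cexp (k * t)) + (- (1)) * CPS (int m) (Cexp (- k * t))).
  assert (DH : forall t, (0 <= t <= 1)%R -> rderiv H t (- k * (a 0%nat + m 0%nat))).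
  { intros t Ht. apply rderiv_eq with (1 := rderiv_plus _ _ _ _ _ (rderiv_CPS_Cexp (int a) k t (Hint a Ha))
       (rderiv_scal (- (1)) _ _ _ (rderiv_CPS_Cexp (int m) (- k) t (Hint m Hm)))).
    rewrite !Dint by auto.
    transitivity (k * (CPS a (Cexp (k * t)) + CPS m (Cexp (- k * t))) - k * (a 0%nat + m 0%nat)); [ring|].
    rewrite Z by auto. ring. }
  pose proof (CInt01_derive H _ DH (cont01_const _)) as I.
  assert (E1 : H 1%R = H 0%R).
  { unfold H. replace (k * 1) with k by ring. replace (- k * 1) with (- k) by ring.
    replace (k * 0) with (RtoC 0) by ring. replace (- k * 0) with (RtoC 0) by ring.
    assert (Ek' : Cexp (- k) = 1) by (rewrite <- (Cexp_opp_l k), Ek; ring).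
    now rewrite Ek, Ek', Cexp_0. }
  assert (E2 : forall c : C, CInt01 (fun _ => c) = c).
  { intros c. unfold CInt01. rewrite !(RInt_const (V := R_CompleteNormedModule)).
    apply C_eq; unfold scal; simpl; unfold mult; simpl; ring. }
  rewrite E1, E2 in I.
  transitivity (- / k * (- k * (a 0%nat + m 0%nat))); [now field|]. rewrite I. field. auto.
Qed.

(** Here u i is c (i - 1) and w i is c (- i); the two equalities say that the halves agree on the
    overlap c (-1), c 0. The nonnegative and the negative powers each satisfy the equation up to two
    boundary terms, and these cancel in the sum. *)
Lemma matched_floquet (lambda mu l z0 b : C) (u w : nat -> C) :
  z0 <> 0 -> entire u -> entire w -> u 0%nat = w 1%nat -> u 1%nat = w 0%nat ->
  ~ (u 0%nat = 0 /\ u 1%nat = 0) ->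
  (forall i : nat, ((INR i + b) ^ 2 + l * (INR i + b) + lambda) * u (S i)
     + mu / z0 * (INR i + 1 + b) * u (S (S i)) = mu * z0 * (INR i + b + l) * u i) ->
  (forall i : nat, ((- INR (S i) + b) ^ 2 + l * (- INR (S i) + b) + lambda) * w (S i)
     - mu * z0 * (- INR (S i) + b + l) * w (S (S i)) = - (mu / z0 * (- INR (S i) + 1 + b)) * w i) ->
  floquet lambda mu (l + 1) z0 (Cexp (2 * PI * Ci * b)).
Proof.
  intros Hz Hu Hw E01 E10 Hne Ru Rw.
  set (k := 2 * PI * Ci).
  assert (Hk : k <> 0) by apply two_PI_i_neq_0.
  assert (Ek : Cexp k = 1).
  { replace k with (2 * PI * Ci * IZR 1) by (unfold k; ring). apply Cexp_2PI_Z. }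
  (* a n = c n for n >= 0 and m n = c (- n) for n >= 1; m 0 = 0 prevents c 0 from being counted
     twice. *)
  set (a := fun n => u (S n)). set (m := shift_right (fun n => w (S n))).
  assert (Ha : entire a) by now apply entire_S.
  assert (Hm : entire m) by now apply entire_shift_right, entire_S.
  set (T := fun (s : C) (f : nat -> C) (n : nat) => b * f n + s * (INR n * f n)).
  assert (HT : forall s f, entire f -> entire (T s f)).
  { intros s f Hf. apply entire_plus; [now apply entire_scal|]. now apply entire_scal, entire_INR. }
  (* [J f g] is the value of [z^b (sum f_n z^n + sum g_n z^-n)] on the unit circle; [T] gives the action of [z d/dz]. *)
  set (J := fun (f g : nat -> C) (t : R) => Cexp (k * b * t) * (CPS f (Cexp (k * t)) + CPS g (Cexp (- k * t)))).
  assert (DJ : forall f g t, entire f -> entire g -> rderiv (J f g) t (k * J (T 1 f) (T (- (1)) g) t)).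
  { intros f g t Hf Hg. unfold J.
    apply rderiv_eq with (1 := rderiv_mult _ _ _ _ _ (rderiv_Cexp (k * b) t)
      (rderiv_plus _ _ _ _ _ (rderiv_CPS_Cexp f k t Hf) (rderiv_CPS_Cexp g (- k) t Hg))).
    pose proof (entire_INR f Hf) as Hf1. pose proof (entire_INR g Hg) as Hg1.
    unfold T. rewrite (CPS_plus (fun n => b * f n) (fun n => 1 * (INR n * f n))) by (now apply entire_scal).
    rewrite (CPS_plus (fun n => b * g n) (fun n => - (1) * (INR n * g n))) by (now apply entire_scal).
    rewrite !CPS_scal by auto. ring. }
  set (p := J a m). set (q := J (T 1 a) (T (- (1)) m)).
  set (r := J (T 1 (T 1 a)) (T (- (1)) (T (- (1)) m))).
  assert (Dp : forall t, rderiv p t (k * q t)) by (intros t; now apply DJ).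
  assert (Dq : forall t, rderiv q t (k * r t)) by (intros t; apply DJ; auto).
  set (g := circuit z0).
  assert (Hg : forall t, g t <> 0) by (intros t; now apply circuit_neq_0).
  assert (Key : forall t, r t = - ((l + mu * (/ g t - g t)) * q t + (lambda - mu * (l + 1) * g t) * p t)).
  { intros t. unfold g. rewrite Cinv_circuit, circuit_Cexp by auto. fold k.
    replace (k * IZR (-1) * t) with (- k * t) by ring.
    set (e := Cexp (k * t)). set (d := Cexp (- k * t)).
    assert (Hed : d * e = 1).
    { unfold d, e. replace (- k * t) with (- (k * t)) by ring. apply Cexp_opp_l. }
    unfold r, q, p, J. fold e d.
    (* The couplings across the cut: up to sign, [k0] is what c (-1) contributes to order 0, and
       [k1] is what c 0 contributes to order -1. *)
    set (k0 := mu * z0 * (b + l) * u 0%nat). set (k1 := mu / z0 * b * u 1%nat).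
    pose proof (HT 1 a Ha) as HTa. pose proof (HT 1 _ HTa) as HTTa.
    pose proof (HT (- (1)) m Hm) as HTm. pose proof (HT (- (1)) _ HTm) as HTTm.
    assert (S1 : CPS (T 1 (T 1 a)) e + l * CPS (T 1 a) e + lambda * CPS a e
       + mu / z0 * d * CPS (T 1 a) e - mu * z0 * e * (CPS (T 1 a) e + (l + 1) * CPS a e) = k0 + d * k1).
    { transitivity (CPS (T 1 (T 1 a)) e + (l * CPS (T 1 a) e + (lambda * CPS a e
         + (mu / z0 * CPS (fun n => T 1 a (S n)) e
         + (- (mu * z0)) * (e * (CPS (T 1 a) e + (l + 1) * CPS a e))))) + d * k1).
      - rewrite (CPS_split (T 1 a) e HTa) at 2.
        replace (T 1 a 0%nat) with (b * a 0%nat) by (unfold T; simpl INR; ring).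
        unfold k1. change (u 1%nat) with (a 0%nat).
        transitivity (CPS (T 1 (T 1 a)) e + l * CPS (T 1 a) e + lambda * CPS a e
           + mu / z0 * (d * (b * a 0%nat) + (d * e) * CPS (fun n => T 1 a (S n)) e)
           - mu * z0 * e * (CPS (T 1 a) e + (l + 1) * CPS a e)); [ring|].
        rewrite Hed. ring.
      - f_equal.
        rewrite <- (CPS_scal (l + 1) a), <- (CPS_plus (T 1 a)) by (auto; now apply entire_scal).
        assert (Hx : entire (fun n => T 1 a n + (l + 1) * a n)) by (apply entire_plus; [auto|now apply entire_scal]).
        rewrite <- CPS_shift_right by auto. pose proof (entire_shift_right _ Hx) as Hxi.
        pose proof (entire_S _ HTa) as HTs.
        rewrite <- (CPS_const k0 e). apply CPS_combination; auto.
        intros n. specialize (Ru n). unfold T, a, k0.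
        destruct n as [|n]; cbn [shift_right]; rewrite ?(S_INR (S n)), ?(S_INR n), ?RtoC_plus in *; simpl (INR 0) in *;
          simpl (INR 1) in *.
        + transitivity (mu * z0 * (0 + b + l) * u 0%nat); [rewrite <- Ru; ring|ring].
        + apply Ceq_minus in Ru. rewrite <- Ru. ring. }
    assert (S2 : CPS (T (- (1)) (T (- (1)) m)) d + l * CPS (T (- (1)) m) d + lambda * CPS m d
       + mu / z0 * d * CPS (T (- (1)) m) d - mu * z0 * e * (CPS (T (- (1)) m) d + (l + 1) * CPS m d) = - k0 - d * k1).
    { set (x := fun n => T (- (1)) m n + (l + 1) * m n).
      assert (Hx : entire x) by (apply entire_plus; [auto|now apply entire_scal]).
      transitivity (CPS (T (- (1)) (T (- (1)) m)) d + (l * CPS (T (- (1)) m) d + (lambda * CPS m d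
         + (mu / z0 * CPS (shift_right (T (- (1)) m)) d
         + (- (mu * z0)) * CPS (fun n => x (S n)) d)))).
      - rewrite CPS_shift_right by auto.
        assert (Ex : CPS (T (- (1)) m) d + (l + 1) * CPS m d = d * CPS (fun n => x (S n)) d).
        { transitivity (CPS x d).
          - unfold x. rewrite (CPS_plus (T (- (1)) m) (fun n => (l + 1) * m n)) by (auto; now apply entire_scal).
            now rewrite CPS_scal.
          - rewrite (CPS_split x d Hx). replace (x 0%nat) with (RtoC 0) by (unfold x, T, m; cbn [shift_right]; ring). ring. }
        rewrite Ex.
        transitivity (CPS (T (- (1)) (T (- (1)) m)) d + l * CPS (T (- (1)) m) d + lambda * CPS m d
          + mu / z0 * d * CPS (T (- (1)) m) d - mu * z0 * ((d * e) * CPS (fun n => x (S n)) d)); [ring|].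
        rewrite Hed. ring.
      - pose proof (entire_S _ Hx) as Hxs. pose proof (entire_shift_right _ HTm) as HTi.
        transitivity (CPS (fun n => match n with O => - k0 | S _ => 0 end) d
           + CPS (shift_right (fun n => match n with O => - k1 | S _ => 0 end)) d).
        2:{ rewrite CPS_shift_right by apply entire_const. rewrite !CPS_const. ring. }
        rewrite <- CPS_plus; [|apply entire_const|apply entire_shift_right, entire_const].
        apply CPS_combination; auto.
        intros n. unfold x, T, m, k0, k1. rewrite E01, E10.
        destruct n as [|[|n]]; cbn [shift_right].
        + simpl (INR 0). simpl (INR 1). ring.
        + specialize (Rw 0%nat). simpl (INR 0) in *. simpl (INR 1) in *. simpl (INR 2).
          transitivity (((- (1) + b) ^ 2 + l * (- (1) + b) + lambda) * w 1%nat - mu * z0 * (- (1) + b + l) * w 2%nat).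
          * rewrite RtoC_plus. ring.
          * rewrite Rw. ring.
        + specialize (Rw (S n)). rewrite !S_INR, !RtoC_plus in *.
          apply Ceq_minus in Rw. transitivity (RtoC 0); [|ring]. rewrite <- Rw. ring. }
    set (EE := Cexp (k * b * t)).
    apply Ceq_minus.
    transitivity (EE * ((CPS (T 1 (T 1 a)) e + l * CPS (T 1 a) e + lambda * CPS a e
       + mu / z0 * d * CPS (T 1 a) e - mu * z0 * e * (CPS (T 1 a) e + (l + 1) * CPS a e))
       + (CPS (T (- (1)) (T (- (1)) m)) d + l * CPS (T (- (1)) m) d + lambda * CPS m d
       + mu / z0 * d * CPS (T (- (1)) m) d - mu * z0 * e * (CPS (T (- (1)) m) d + (l + 1) * CPS m d)))).
    - unfold Cdiv. ring.
    - rewrite S1, S2. ring. }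
  assert (Sol : forall t, curve_solution lambda mu (l + 1) g (dcircuit z0) p (fun t => / g t * q t) t).
  { intros t. split.
    - apply rderiv_eq with (1 := Dp t). unfold dcircuit. fold k g. field. apply Hg.
    - assert (Dg : rderiv (fun t => / g t) t (- k * / g t)).
      { apply rderiv_eq with (/ z0 * ((k * IZR (-1)) * Cexp (k * IZR (-1) * t))).
        - apply rderiv_ext with (fun t => / z0 * Cexp (k * IZR (-1) * t)).
          + intros s. symmetry. now apply Cinv_circuit.
          + apply rderiv_scal, rderiv_Cexp.
        - unfold g. rewrite Cinv_circuit by auto. fold k. ring. }
      apply rderiv_eq with (1 := rderiv_mult _ _ _ _ _ Dg (Dq t)).
      rewrite Key. unfold ode_second, dcircuit. fold k. fold (g t). field. apply Hg. }
  assert (J1 : forall f h, J f h 1%R = Cexp (k * b) * J f h 0%R).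
  { intros f h. unfold J. replace (k * b * 1) with (k * b) by ring. replace (k * 1) with k by ring.
    replace (- k * 1) with (- k) by ring.
    replace (k * b * 0) with (RtoC 0) by ring. replace (k * 0) with (RtoC 0) by ring.
    replace (- k * 0) with (RtoC 0) by ring.
    assert (Ek' : Cexp (- k) = 1) by (rewrite <- (Cexp_opp_l k), Ek; ring).
    rewrite Ek, Ek', Cexp_0. ring. }
  exists p, (fun t => / g t * q t).
  split; [intros t _; apply Sol|]. split; [apply J1|].
  split; [unfold g; rewrite circuit_0, circuit_1; unfold q; rewrite J1; ring|].
  intros [P0 Y0].
  assert (Z : forall t, (0 <= t <= 1)%R -> p t = 0).
  { intros t Ht.
    destruct (curve_solution_unique lambda mu (l + 1) g (dcircuit z0) p (fun t => / g t * q t)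
      (fun _ => 0) (fun _ => 0) (Cmod z0) (Cmod z0) (Cmod k * Cmod z0)) with (t := t) as [H _]; auto.
    - now apply Cmod_gt_0.
    - intros s _. unfold g, dcircuit. rewrite Cmod_mult, Cmod_circuit. fold k. lra.
    - intros s _. split.
      + apply rderiv_eq with (RtoC 0); [apply rderiv_const|ring].
      + apply rderiv_eq with (RtoC 0); [apply rderiv_const|]. unfold ode_second. field. apply Hg. }
  assert (Z' : forall t : R, (0 <= t <= 1)%R -> CPS a (Cexp (k * t)) + CPS m (Cexp (- k * t)) = 0).
  { intros t Ht. specialize (Z t Ht). unfold p, J in Z.
    transitivity (/ Cexp (k * b * t) * (Cexp (k * b * t) * (CPS a (Cexp (k * t)) + CPS m (Cexp (- k * t))))).
    - field. apply Cexp_neq_0.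
    - rewrite Z. ring. }
  (* The mean over the circle extracts the constant term c 0; after multiplication by exp (k t) it
     extracts c (-1). *)
  apply Hne. split.
  - assert (C := circle_mean_zero (shift_right a) (fun n => m (S n)) k Hk Ek (entire_shift_right _ Ha) (entire_S _ Hm)).
    unfold m in C at 2. cbn [shift_right] in C. rewrite <- E01, Cplus_0_l in C. apply C.
    intros t Ht. rewrite CPS_shift_right by auto. specialize (Z' t Ht).
    rewrite (CPS_split m _ Hm) in Z'. unfold m at 1 in Z'. cbn [shift_right] in Z'.
    assert (Hed : Cexp (- k * t) * Cexp (k * t) = 1).
    { replace (- k * t) with (- (k * t)) by ring. apply Cexp_opp_l. }
    transitivity (Cexp (k * t) * CPS a (Cexp (k * t)) + (Cexp (- k * t) * Cexp (k * t)) * CPS (fun n => m (S n)) (Cexp (- k * t))).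
    + rewrite Hed. ring.
    + transitivity (Cexp (k * t) * (CPS a (Cexp (k * t)) + (0 + Cexp (- k * t) * CPS (fun n => m (S n)) (Cexp (- k * t))))); [ring|].
      rewrite Z'. ring.
  - assert (C := circle_mean_zero a m k Hk Ek Ha Hm Z').
    unfold a, m in C. cbn [shift_right] in C. now rewrite Cplus_0_r in C.
Qed.

(** A vanishing determinant gives proportionality only between nonzero pairs. The left pair vanishes
    when x_0 = x_1 = x_2, and the relation at k = 0 then reads (lambda + mu^2) x_1 = 0; this is
    where lambda + mu^2 <> 0 is used. *)
Lemma matching_floquet (lambda mu l z0 : C) (hl : forall m : Z, l <> RtoC (IZR (2 * m + 1))) :
  mu <> 0 -> z0 <> 0 -> lambda + mu ^ 2 <> 0 -> matching lambda mu l z0 ->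
  floquet lambda mu (l + 1) z0 (Cexp (2 * PI * Ci * ((1 - l) / 2))).
Proof.
  intros hmu hz0 hrel Hm. unfold matching in Hm.
  set (U := right_sol lambda mu l z0) in *. set (V := left_sol lambda mu l z0) in *.
  assert (Hz1 : mu / z0 <> 0) by now apply Cdiv_neq_0.
  assert (Hz2 : mu * z0 <> 0) by now apply Cmult_neq_0.
  assert (HU : ~ (U 0%nat = 0 /\ U 1%nat = 0)).
  { intros [U0 U1]. apply (Rcoef_neq_0 lambda mu l hl hmu). split.
    - apply Cmult_eq_0_reg with (2 := U0). now apply gam_neq_0.
    - apply Cmult_eq_0_reg with (2 := U1). now apply gam_neq_0. }
  assert (HV : ~ (V 0%nat = 0 /\ V 1%nat = 0)).
  { intros [V0 V1]. apply (Rcoef_neq_0 lambda mu l hl hmu).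
    apply Cmult_eq_0_reg in V0; [|now apply gam_neq_0]. apply Cmult_eq_0_reg in V1; [|now apply gam_neq_0].
    destruct (Rcoef_spec lambda mu l hl) as [_ [HX _]]. specialize (HX 0%nat).
    apply Ceq_minus in V0. apply Ceq_minus in V1. rewrite V1 in *.
    pose proof (denom_neq_0 l hl 0) as Hd.
    set (x := Rcoef lambda mu l 1 1 1) in *.
    assert (Hx : x = 0).
    { apply (Cmult_eq_0_reg (lambda + mu ^ 2)); [auto|].
      transitivity (denom l 0 * (((1 + lambda / denom l 0) * x + mu ^ 2 / denom l 0 * x) - x)); [now field|].
      rewrite <- HX, V0. ring. }
    auto. }
  (* The indices are crossed because U i stands for c (i - 1) and V i for c (- i). *)
  assert (Hk : exists k, U 1%nat = k * V 0%nat /\ U 0%nat = k * V 1%nat).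
  { destruct (Classical_Prop.classic (V 0%nat = 0)) as [Z|Z].
    - assert (V1 : V 1%nat <> 0) by tauto. exists (U 0%nat / V 1%nat). split; [|now field].
      rewrite Z, Cmult_0_r. apply (Cmult_eq_0_reg (V 1%nat)); [auto|]. rewrite Cmult_comm, Hm, Z. ring.
    - exists (U 1%nat / V 0%nat). split; [now field|].
      transitivity (U 0%nat * V 0%nat / V 0%nat); [now field|]. rewrite <- Hm. now field. }
  destruct Hk as [k [K1 K0]].
  apply (matched_floquet lambda mu l z0 _ U (fun i => k * V i)); auto.
  - now apply right_sol_entire.
  - now apply entire_scal, left_sol_entire.
  - intros i. now apply right_sol_rec.
  - intros i. pose proof (left_sol_rec lambda mu l z0 hl hz0 i) as R. fold V in R.
    match type of R with ?A = ?B => transitivity (k * A); [ring|rewrite R; ring] end.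
Qed.

Theorem theorem5p15 (lambda mu omega l n : C)
  (hrel : lambda + mu ^ 2 = 1 / (4 * omega ^ 2))
  (homega : omega <> 0) (hmu : mu <> 0)
  (hn : n = l + 1)
  (hl : forall m : Z, l <> RtoC (IZR (2 * m + 1)))
  (z0 : C) (hz0 : z0 <> 0) :
  monodromy_eigenvalue lambda mu n z0 (- Cexp (- (RtoC PI * Ci * l))) <->
  (let R11 := Rcoef lambda mu l 1 1 1 in
   let R21 := Rcoef lambda mu l 1 2 1 in
   R11 + 2 * omega * mu * (R11 - R21) = 0 \/
   R11 - 2 * omega * mu * (R11 - R21) = 0).
Proof.
  cbv zeta. rewrite (proj1 (Rcoef_spec lambda mu l hl) 1%nat).
  rewrite <- (matching_iff lambda mu l z0 hl hmu hz0 omega homega hrel).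
  assert (Echi : Cexp (2 * PI * Ci * ((1 - l) / 2)) = - Cexp (- (RtoC PI * Ci * l))).
  { replace (2 * PI * Ci * ((1 - l) / 2)) with (PI * Ci + - (PI * Ci * l)) by field.
    rewrite Cexp_plus, Cexp_PI. ring. }
  rewrite <- Echi, hn. split.
  - intros H. apply monodromy_floquet in H; [|auto].
    apply (floquet_recurrence _ _ _ _ ((1 - l) / 2)) in H; [|auto|].
    + destruct H as [c [[K HK] [Hne Hrec]]]. exact (recurrence_matching lambda mu l z0 hl hmu hz0 c K Hrec HK Hne).
    + rewrite Cmult_comm. apply Cexp_opp_l.
  - intros H. apply floquet_monodromy; [auto|]. apply matching_floquet; auto.
    rewrite hrel. apply Cdiv_neq_0; [apply C1_nz|].
    assert (RtoC 4 <> 0) by (intros E; apply RtoC_inj in E; lra).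
    apply Cmult_neq_0; [auto|now apply Cpow_nz].
Qed.
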